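(* Let $Y_{n,j}$, $j=1,\dots,n$, $n\in\mathbb{N}$, be a triangular array of real random variables whose rows are adapted to a filtration $(\mathcal{F}_j)_{j\in\mathbb{N}}$ (i.e. $Y_{n,j}$ is $\mathcal{F}_j$-measurable for all $n$ and all $1\le j\le n$). Let $\phi_{n,j}(t)=\mathbb{E}e^{\mathbf{i}tY_{n,j}}$. Suppose there are a constant $C_1>0$, an integer $\ell\ge 1$, a decreasing sequence $\alpha(k)\ge 0$ with $\lim_{k\to\infty}\alpha(k)=0$, a characteristic function $\varphi(t)$, and positive constants $C_2$ and $\mu$ such that for every $n\in\mathbb{N}$ the following hold: (A1) for all $j=1,\dots,n$, $$\mathbb{P}(Y_{n,j}\ne 0)\le \frac{C_1}{n}\quad\text{and}\quad \mathbb{E}|Y_{n,j}|\le \frac{C_1}{n},$$ and for all $i,j\in\{1,\dots,n\}$ with $i\neq j$, $$\mathbb{E}\big[|Y_{n,j}|\,\mathbf{1}_{\{Y_{n,i}\ne 0\}}\big]\le \Big(\frac{C_1}{n}\Big)^2;$$ (A2) for all $i,j$ with $1\le i\le j-\ell$, $j\le n$, $$\Big|\mathbb{E}\big(Y_{n,j}\,\big|\,\mathcal{F}_i\big)-\mathbb{E}Y_{n,j}\Big|\le \frac{C_1}{n}\,\alpha(j-i)\quad\text{a.s.};$$ (A3) for all $1\le i<j\le n$ and every measurable function $v$ on $\mathbb{R}^{n-j+1}$ with $|v(x)|\le 1$ for all $x\in\mathbb{R}^{n-j+1}$, $$\Big|\mathbb{E}\big(v(Y_{n,j},\dots,Y_{n,n})\,\big|\,\mathcal{F}_i\big)-\mathbb{E}v(Y_{n,j},\dots,Y_{n,n})\Big|\le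 \alpha(j-i)\quad\text{a.s.};$$ (A4) for all $j=1,\dots,n$ and all $t\in\mathbb{R}$, $$\Big|\dot\phi_{n,j}(t)-n^{-1}\mu\,\dot\varphi(t)\Big|\le C_2n^{-2}.$$ Then $$S_n=\sum_{j=1}^nY_{n,j}\xrightarrow[n\to\infty]{d}S,$$ where $S$ has the compound Poisson distribution with intensity $\mu$ and i.i.d. jumps with characteristic function $\varphi(t)$. Moreover, if in addition (A5) $\alpha(k)\le C_3r^k$ for all $k$, for some $r\in(0,1)$ and $C_3>0$, then there is a constant $C>0$ such that for all $n$ large enough, $$L\big(\mathscr{L}(S_n),\mathscr{L}(S)\big)\le C\,n^{-1/2}\log n,$$ where $L\big(\mathscr{L}(S_n),\mathscr{L}(S)\big)$ is the L\'evy distance between the distribution functions of $S_n$ and $S$.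
   Context: Notation: $\mathbf{i}$ is the imaginary unit; $\dot g(t)=\frac{d}{dt}g(t)$ (the function $\varphi$ in (A4) is understood to be differentiable); $\xrightarrow{d}$ denotes convergence in distribution; $\mathscr{L}(X)$ denotes the law of $X$, identified with its distribution function. The compound Poisson distribution with intensity $\mu>0$ and i.i.d. jumps with characteristic function $\varphi$ is the law of $\sum_{k=1}^{N}\xi_k$, where $N$ is Poisson with mean $\mu$, independent of the i.i.d. sequence $(\xi_k)$ with characteristic function $\varphi$; its characteristic function is $\psi(t)=e^{\mu(\varphi(t)-1)}$, $t\in\mathbb{R}$. The L\'evy distance between distribution functions $F$ and $G$ is $$L(G,F)=\inf\big\{h>0:\ G(x-h)-h\le F(x)\le G(x+h)+h\ \text{ for all } x\in\mathbb{R}\big\}.$$ *)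

(* Defs.v *)
From HB Require Import structures.
From mathcomp Require Import all_boot all_order all_algebra.
From mathcomp Require Import finmap complex.
From mathcomp Require Import all_classical all_reals all_analysis.
From mathcomp Require Import measurable_realfun.

Set Implicit Arguments.
Unset Strict Implicit.
Unset Printing Implicit Defensive.

Import Order.TTheory GRing.Theory Num.Theory.
Import numFieldNormedType.Exports.

Local Open Scope classical_set_scope.
Local Open Scope ring_scope.
Local Open Scope complex_scope.

Section complex_valued.
Variable R : realType.

Definition expi (x : R) : R[i] := cos x +i* sin x.

Definition cexpectation d (T : measurableType d) (P : probability T R)
    (Z : T -> R[i]) : R[i] :=
  fine 'E_P[fun w => complex.Re (Z w)] +i* fine 'E_P[fun w => complex.Im (Z w)].

Definition charfun d (T : measurableType d) (P : probability T R)
    (X : T -> R) (t : R) : R[i] :=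
  cexpectation P (fun w => expi (t * X w)).

Definition is_charfun (phi : R -> R[i]) : Prop :=
  exists Q : probability (measurableTypeR R) R,
    forall t, phi t = charfun Q (fun x : R => x) t.

(* R[i] is a normed module over itself but not over R, so derivatives of
   functions from R to R[i] are taken componentwise. *)
Definition cderivable (f : R -> R[i]) (t : R) : Prop :=
  derivable (fun s => complex.Re (f s)) t 1 /\
  derivable (fun s => complex.Im (f s)) t 1.

Definition cderive (f : R -> R[i]) (t : R) : R[i] :=
  derive1 (fun s => complex.Re (f s)) t +i* derive1 (fun s => complex.Im (f s)) t.

End complex_valued.

Section conditioning.
Context d (T : measurableType d) (R : realType).

Definition filtration (F : nat -> set_system T) : Prop :=
  [/\ forall j, sigma_algebra setT (F j),
      forall j, F j `<=` measurable
    & forall i j, (i <= j)%N -> F i `<=` F j].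

Definition measurable_wrt (G : set_system T) (X : T -> R) : Prop :=
  forall B : set R, measurable B -> G (X @^-1` B).

(* Z is a version of the conditional expectation E(X | G); such a Z is unique
   up to P-almost sure equality. *)
Definition is_cond_exp (P : probability T R) (G : set_system T)
    (X Z : T -> R) : Prop :=
  [/\ measurable_wrt G Z,
      P.-integrable setT (EFin \o Z)
    & forall A, G A -> (\int[P]_(w in A) (Z w)%:E = \int[P]_(w in A) (X w)%:E)%E].

End conditioning.

Section compound_poisson.
Variable R : realType.

Section family.
Context d (T : measurableType d) (P : probability T R).

Definition independent_family (xi : nat -> T -> R) : Prop :=
  forall (J : {fset nat}) (A : nat -> set R), (forall k, measurable (A k)) ->
    P (\bigcap_(k in [set` J]) (xi k @^-1` A k)) =
    (\prod_(k <- J) P (xi k @^-1` A k))%E.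

Definition sigma_family (xi : nat -> T -> R) : set_system T :=
  <<s [set E | exists k (B : set R), measurable B /\ E = xi k @^-1` B] >>.

Definition independent_of_family (N : T -> nat) (xi : nat -> T -> R) : Prop :=
  forall (B : set nat) (E : set T), sigma_family xi E ->
    P (N @^-1` B `&` E) = (P (N @^-1` B) * P E)%E.

End family.

(* The law of S is that of xi 0 + ... + xi (N - 1); the space carrying N and
   the jumps need not be the one on which S lives. *)
Definition compound_poisson (mu : R) (phi : R -> R[i])
    d (T : measurableType d) (P : probability T R) (S : {RV P >-> R}) : Prop :=
  exists (d0 : measure_display) (T0 : measurableType d0)
    (P0 : probability T0 R) (N : {RV P0 >-> nat}) (xi : nat -> {RV P0 >-> R}),
    [/\ forall k, P0 (N @^-1` [set k]) = (poisson_pmf mu k)%:E,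
        independent_family P0 xi,
        forall k (B : set R), measurable B ->
          distribution P0 (xi k) B = distribution P0 (xi 0%N) B,
        forall k t, charfun P0 (xi k) t = phi t
      & independent_of_family P0 N xi /\
        forall B : set R, measurable B ->
          distribution P S B = P0 [set w | B (\sum_(k < N w) xi k w)]].

End compound_poisson.

Section distribution_functions.
Variable R : realType.

Definition dfun d (T : measurableType d) (P : probability T R)
    (X : {RV P >-> R}) (x : R) : R := fine (cdf X x).

Definition cvg_in_distribution
    d (T : measurableType d) (P : probability T R) (X : nat -> {RV P >-> R})
    d' (T' : measurableType d') (P' : probability T' R) (Y : {RV P' >-> R})
    : Prop :=
  forall x, {for x, continuous (dfun Y)} ->
    dfun (X n) x @[n --> \oo] --> dfun Y x.

Definition levy_distance (G F : R -> R) : R :=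
  inf [set h | 0 < h /\
    forall x, G (x - h) - h <= F x /\ F x <= G (x + h) + h].

End distribution_functions.

(* Main.v *)
Require Import Defs.
From HB Require Import structures.
From mathcomp Require Import all_boot all_order all_algebra.
From mathcomp Require Import finmap complex.
From mathcomp Require Import all_classical all_reals all_analysis.
From mathcomp Require Import measurable_realfun.
From mathcomp Require Import ring lra zify.

Set Implicit Arguments.
Unset Strict Implicit.
Unset Printing Implicit Defensive.

Import Order.TTheory GRing.Theory Num.Theory.
Import numFieldNormedType.Exports.

Local Open Scope classical_set_scope.
Local Open Scope ring_scope.
Local Open Scope complex_scope.

(** The rows are compared with independent ones at the level of characteristic
    functions, the independent product is compared with the compound Poisson
    law, and the resulting closeness of characteristic functions is turned into
    closeness of distribution functions.

    Comparison with independence ([range_charfun_blocks], [row_charfun_prod]).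
    Write the sum up to the end of a block as past, gap and block.  Since
    [|exp (i t x) - 1|] is bounded both by [|t| * |x|] and by [2] times the
    indicator of [x <> 0], the bound on pairs of summands shows that dropping
    the gap, or decoupling the summands inside the block, costs only [|t|]
    times the number of pairs involved times [n ^- 2].  What remains is the
    covariance of a bounded function of the past with a bounded function of the
    block, which the mixing condition controls ([cond_exp_covariance],
    [complex_decoupling]).  Because the mixing error is paid once per block and
    not once per summand, a bounded number of long blocks is enough when the
    mixing coefficients merely tend to zero; with geometric mixing one takes blocks of
    length one and gaps of length of order [ln n], which gives an error of
    order [|t| * ln n / n].

    Comparison with the compound Poisson law ([prod_complex_exp],
    [charfun_compound_poisson]).  Integrating the assumption on derivatives
    from [0] shows that each factor is [1 + (mu / n) (phi t - 1)] up to a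
    multiple of [|t| * n ^- 2].  So it differs by that order from
    [exp ((mu / n) (phi t - 1))], whose [n]-th power is the characteristic
    function of the limit.

    Smoothing ([smoothing]).  Instead of Fourier inversion, the indicator of a
    half-line is approximated by the antiderivative of a power [cos ^ (2 N)],
    which is a trigonometric polynomial up to a linear term.  Only finitely
    many values of the characteristic functions enter, there is no integral
    over frequencies, and the price is periodicity, which is harmless because
    the distributions have small mass outside half a period.  For a
    given accuracy a fixed [N] and a fixed period suffice, whence convergence
    in distribution; with [N] equal to [n ^ 2], period of order [sqrt n] and
    smoothing scale [ln n / sqrt n] one gets the rate. *)

Local Notation cabs := ComplexField.Normc.normc.

(** * Modulus and elementary estimates *)

Section modulus.
Variable R : realType.
Implicit Types (x y t : R) (z w : R[i]).

Lemma cabsE z : cabs z = Num.sqrt (complex.Re z ^+ 2 + complex.Im z ^+ 2).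
Proof. by case: z. Qed.

Lemma cabs_ge0 z : 0 <= cabs z.
Proof. by rewrite cabsE sqrtr_ge0. Qed.

Lemma cabsM z w : cabs (z * w) = cabs z * cabs w.
Proof. exact: ComplexField.Normc.normcM. Qed.

Lemma cabsX z n : cabs (z ^+ n) = cabs z ^+ n.
Proof.
elim: n => [|n IH]; first by rewrite !expr0 ComplexField.Normc.normc1.
by rewrite !exprS cabsM IH.
Qed.

Lemma cabsD z w : cabs (z + w) <= cabs z + cabs w.
Proof. exact: le_normcD. Qed.

Lemma cabsN z : cabs (- z) = cabs z.
Proof. exact: normcN. Qed.

Lemma cabsB z w : cabs (z - w) <= cabs z + cabs w.
Proof. by rewrite -(cabsN w); exact: cabsD. Qed.

Lemma cabs_real x : cabs x%:C = `|x|.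
Proof. by rewrite cabsE /= expr0n addr0 sqrtr_sqr. Qed.

Lemma sqr_cabs z : cabs z ^+ 2 = complex.Re z ^+ 2 + complex.Im z ^+ 2.
Proof. by rewrite cabsE sqr_sqrtr// addr_ge0// sqr_ge0. Qed.

Lemma Re_le_cabs z : `|complex.Re z| <= cabs z.
Proof. by rewrite cabsE -sqrtr_sqr ler_wsqrtr// lerDl sqr_ge0. Qed.

Lemma Im_le_cabs z : `|complex.Im z| <= cabs z.
Proof. by rewrite cabsE -sqrtr_sqr ler_wsqrtr// lerDr sqr_ge0. Qed.

Lemma cabs_le z : cabs z <= `|complex.Re z| + `|complex.Im z|.
Proof.
rewrite -(@ler_pXn2r _ 2)// ?nnegrE ?cabs_ge0 ?addr_ge0// sqr_cabs sqrrD.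
by rewrite !real_normK ?num_real// lerD2r lerDl mulrn_wge0// mulr_ge0.
Qed.

Lemma cabs_le_pair z (a b : R) :
  `|complex.Re z| <= a -> `|complex.Im z| <= b -> cabs z <= a + b.
Proof. by move=> ha hb; rewrite (le_trans (cabs_le _))// lerD. Qed.

Lemma Re_cD z w : complex.Re (z + w) = complex.Re z + complex.Re w.
Proof. by case: z w => [a b] [c e]. Qed.

Lemma Im_cD z w : complex.Im (z + w) = complex.Im z + complex.Im w.
Proof. by case: z w => [a b] [c e]. Qed.

Lemma Re_cN z : complex.Re (- z) = - complex.Re z.
Proof. by case: z. Qed.

Lemma Im_cN z : complex.Im (- z) = - complex.Im z.
Proof. by case: z. Qed.

Lemma Re_cM z w : complex.Re (z * w) =
  complex.Re z * complex.Re w - complex.Im z * complex.Im w.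
Proof. by case: z w => [a b] [c e]. Qed.

Lemma Im_cM z w : complex.Im (z * w) =
  complex.Re z * complex.Im w + complex.Im z * complex.Re w.
Proof. by case: z w => [a b] [c e]. Qed.

Lemma Re_sum I (r : seq I) (Q : pred I) (f : I -> R[i]) :
  complex.Re (\sum_(i <- r | Q i) f i) = \sum_(i <- r | Q i) complex.Re (f i).
Proof. exact: (big_morph _ Re_cD). Qed.

Lemma Re_cMn z n : complex.Re (z *+ n) = complex.Re z *+ n.
Proof. by elim: n => // n IH; rewrite !mulrS Re_cD IH. Qed.

Lemma cabs_prod_le1 I (r : seq I) (Q : pred I) (f : I -> R[i]) :
  (forall i, Q i -> cabs (f i) <= 1) -> cabs (\prod_(i <- r | Q i) f i) <= 1.
Proof.
move=> h; elim/big_ind : _ => // [|x y hx hy].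
  by rewrite ComplexField.Normc.normc1.
by rewrite cabsM mulr_ile1 ?cabs_ge0.
Qed.

(** Errors of factors in the closed unit disc add up without
    amplification: swap the factors one at a time. *)
Lemma cabs_prodB (n : nat) (f g : nat -> R[i]) (e : R) :
  (forall i, (i < n)%N -> cabs (f i) <= 1) ->
  (forall i, (i < n)%N -> cabs (g i) <= 1) ->
  (forall i, (i < n)%N -> cabs (f i - g i) <= e) ->
  cabs (\prod_(0 <= i < n) f i - \prod_(0 <= i < n) g i) <= n%:R * e.
Proof.
elim: n => [|n IH] hf hg he.
  by rewrite !big_geq// subrr ComplexField.Normc.normc0 mul0r.
rewrite !big_nat_recr//=; set F := \prod_(_ <= _ < _) f _.
set G := \prod_(_ <= _ < _) g _.
have -> : F * f n - G * g n = (F - G) * f n + G * (f n - g n) by ring.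
rewrite (le_trans (cabsD _ _))// !cabsM -[n.+1]addn1 natrD mulrDl mul1r lerD//.
  rewrite (le_trans _ (IH _ _ _))// ?ler_piMr ?cabs_ge0 ?hf//.
  - by move=> i hi; rewrite hf// ltnW.
  - by move=> i hi; rewrite hg// ltnW.
  - by move=> i hi; rewrite he// ltnW.
rewrite (le_trans _ (he n _))// ler_piMl ?cabs_ge0//.
rewrite /G big_nat_cond cabs_prod_le1// => i /andP[/andP[_ hi] _].
by rewrite hg// ltnW.
Qed.

End modulus.

Section real_calculus.
Variable R : realType.
Implicit Types (f df : R -> R) (a b c x y K : R).

Lemma mean_value f df a b : a <= b ->
  (forall x, is_derive x 1 f (df x)) ->
  exists2 c, a <= c <= b & f b - f a = df c * (b - a).
Proof.
move=> ab hf.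
have hc : {within `[a, b], continuous f}.
  by apply: derivable_within_continuous => x _; have [] := hf x.
have [c + ->] := MVT_segment ab (fun x _ => hf x) hc.
by rewrite in_itv/=; exists c.
Qed.

Lemma mean_value_bound f df a b K :
  (forall x, is_derive x 1 f (df x)) ->
  (forall x, Num.min a b <= x <= Num.max a b -> `|df x| <= K) ->
  `|f b - f a| <= K * `|b - a|.
Proof.
move=> hf hK; have [ab|ba] := leP a b.
  have [c hc ->] := mean_value ab hf.
  by rewrite normrM ler_wpM2r// hK// min_l// max_r.
have [c hc] := mean_value (ltW ba) hf.
rewrite distrC => ->; rewrite normrM (distrC b) ler_wpM2r// hK//.
by rewrite min_r ?max_l ?(ltW ba).
Qed.

Lemma le_of_derive_ge0 f df a b : a <= b ->
  (forall x, is_derive x 1 f (df x)) -> (forall x, 0 <= df x) -> f a <= f b.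
Proof.
move=> ab hf h0; have [c _ e] := mean_value ab hf.
by rewrite -subr_ge0 e mulr_ge0// subr_ge0.
Qed.

Lemma norm_sin_le x : `|sin x| <= `|x|.
Proof.
have := @mean_value_bound sin cos 0 x 1 (@is_derive_sin R) (fun y _ => cos_max y).
by rewrite sin0 !subr0 mul1r.
Qed.

Lemma norm_cosB1_le x : `|cos x - 1| <= `|x|.
Proof.
have h y : Num.min 0 x <= y <= Num.max 0 x -> `|- sin y| <= 1.
  by rewrite normrN sin_max.
by have := mean_value_bound (@is_derive_cos R) h; rewrite cos0 !subr0 mul1r.
Qed.

Lemma norm_cosB1_le_sqr x : `|cos x - 1| <= x ^+ 2.
Proof.
have -> : x ^+ 2 = `|x| * `|x - 0|.
  by rewrite subr0 -normrM ger0_norm ?expr2// -expr2 sqr_ge0.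
rewrite -[X in cos x - X]cos0.
apply: (@mean_value_bound cos (fun y => - sin y)) => y hy.
rewrite normrN (le_trans (norm_sin_le _))//.
by case: (leP 0 x) hy => hx /andP[h1 h2];
  rewrite ?(ger0_norm hx) ?(ltr0_norm hx) ler_norml; apply/andP; split; lra.
Qed.

Lemma norm_sinBid_le_sqr x : `|sin x - x| <= x ^+ 2.
Proof.
have -> : x ^+ 2 = `|x| * `|x - 0|.
  by rewrite subr0 -normrM ger0_norm ?expr2// -expr2 sqr_ge0.
have -> : sin x - x = (sin x - x) - (sin 0 - 0) by rewrite sin0 !subr0.
apply: (@mean_value_bound (fun y => sin y - y) (fun y => cos y - 1)) => y hy.
rewrite (le_trans (norm_cosB1_le _))//.
by case: (leP 0 x) hy => hx /andP[h1 h2];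
  rewrite ?(ger0_norm hx) ?(ltr0_norm hx) ler_norml; apply/andP; split; lra.
Qed.

Lemma norm_expRB1_le x : x <= 0 -> `|expR x - 1| <= `|x|.
Proof.
move=> x0; rewrite ler0_norm ?subr_le0 ?expR_le1// ler0_norm//.
by rewrite opprB lerBlDr -lerBlDl opprK; exact: expR_ge1Dx.
Qed.

Lemma norm_expRB1D_le_sqr x : x <= 0 -> `|expR x - 1 - x| <= x ^+ 2.
Proof.
move=> x0; have -> : x ^+ 2 = `|x| * `|x - 0|.
  by rewrite subr0 -normrM ger0_norm ?expr2// -expr2 sqr_ge0.
have -> : expR x - 1 - x = (expR x - 1 - x) - (expR 0 - 1 - 0).
  by rewrite expR0 subrr !subr0.
apply: (@mean_value_bound (fun y => expR y - 1 - y) (fun y => expR y - 1)).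
  move=> y; have := is_deriveB (is_deriveB (is_derive_expR y)
    (is_derive_cst (1 : R) y 1)) (is_derive_id y 1).
  by rewrite subr0.
move=> y; rewrite min_r// max_l// => /andP[h1 h2].
by rewrite (le_trans (norm_expRB1_le h2))// !ler0_norm// lerN2.
Qed.

End real_calculus.

Section unit_circle.
Variable R : realType.
Implicit Types (x y t : R) (z w : R[i]).

Lemma expi0 : expi (0 : R) = 1.
Proof. by rewrite /expi cos0 sin0. Qed.

Lemma expiD x y : expi (x + y) = expi x * expi y.
Proof. by rewrite /expi cosD sinD [sin x * _ + _]addrC. Qed.

Lemma cabs_expi x : cabs (expi x) = 1.
Proof. by rewrite cabsE /= cos2Dsin2 sqrtr1. Qed.

Lemma expi_mulrn x n : expi (n%:R * x) = expi x ^+ n.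
Proof.
elim: n => [|n IH]; first by rewrite mul0r expi0.
by rewrite exprS -IH -expiD -[n.+1]add1n natrD mulrDl mul1r.
Qed.

Lemma cabs_expiB1_le2 x : cabs (expi x - 1) <= 2.
Proof.
rewrite (le_trans (cabsB _ _))// cabs_expi ComplexField.Normc.normc1.
by rewrite -[1 + 1]/(2).
Qed.

(** The sharp constant comes from the half-angle formula, since
    [|exp (i x) - 1| = 2 |sin (x / 2)|]. *)
Lemma cabs_expiB1_le x : cabs (expi x - 1) <= `|x|.
Proof.
rewrite -(@ler_pXn2r _ 2)// ?nnegrE ?cabs_ge0// sqr_cabs /= !subr0.
have -> : x = (x / 2) *+ 2 by rewrite -mulr_natr; field.
rewrite cos_mulr2n sin_mulr2n real_normK ?num_real//.
have e := cos2Dsin2 (x / 2).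
have h : sin (x / 2) ^+ 2 <= (x / 2) ^+ 2.
  rewrite -[leLHS]real_normK ?num_real// -[leRHS]real_normK ?num_real//.
  by rewrite ler_pXn2r ?nnegrE// norm_sin_le.
move: e h; set c := cos _; set s := sin _; set u := x / 2 => e h.
have {}e : c ^+ 2 = 1 - s ^+ 2 by rewrite -e addrK.
rewrite -(mulr_natr _ 2) -(mulr_natr (c * s)) -(mulr_natr u) e.
have -> : ((1 - s ^+ 2) * 2 - 1 - 1) ^+ 2 + (c * s * 2) ^+ 2 = 4 * s ^+ 2 :> R.
  by rewrite !exprMn e; ring.
by rewrite exprMn; lra.
Qed.

End unit_circle.

(** * A smooth step built from powers of the cosine *)

Section smooth_step.
Variable R : realType.
Implicit Types (u v x y : R) (N i : nat).

Definition frequency N i : R := (N%:R - i%:R) * 2.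

(** Fourier coefficients of the [2 * N]-th power of the cosine. *)
Definition binomial_weight N i : R := 'C(2 * N, i)%:R / 4 ^+ N.

Definition step_slope N : R := binomial_weight N N.

(** The antiderivative of the [2 * N]-th power of the cosine, written as a
    trigonometric polynomial plus the linear term coming from the constant
    Fourier coefficient. *)
Definition smooth_step N u : R :=
  \sum_(i < (2 * N).+1) binomial_weight N i *
    (if i == N :> nat then u else sin (frequency N i * u) / frequency N i).

Lemma frequency_eq0 N i : (frequency N i == 0) = (i == N).
Proof. by rewrite mulf_eq0 pnatr_eq0 orbF subr_eq0 eqr_nat eq_sym. Qed.

Lemma norm_frequency_ge2 N i : i != N -> 2 <= `|frequency N i|.
Proof.
move=> iN; rewrite normrM (ger0_norm (ler0n _ 2)) ler_peMl//.
case: (ltngtP i N) iN => // [lt|lt] _.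
- by rewrite -natrB ?(ltnW lt)// normr_nat ler1n subn_gt0.
- by rewrite distrC -natrB ?(ltnW lt)// normr_nat ler1n subn_gt0.
Qed.

Lemma binomial_weight_ge0 N i : 0 <= binomial_weight N i.
Proof. by rewrite divr_ge0// exprn_ge0. Qed.

Lemma sum_binomial_weight N : \sum_(i < (2 * N).+1) binomial_weight N i = 1.
Proof.
rewrite -mulr_suml -natr_sum.
have -> : (\sum_(i < (2 * N).+1) 'C(2 * N, i) = 2 ^ (2 * N))%N.
  rewrite -[2%N in RHS]/(1 + 1)%N expnDn; apply: eq_bigr => i _.
  by rewrite !exp1n !muln1.
by rewrite expnM natrX divff// expf_neq0// pnatr_eq0.
Qed.

(** Expand [(exp (i u) + exp (- i u)) ^ (2 N)] and take real parts. *)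
Lemma cos_pow_fourier N u : cos u ^+ (2 * N) =
  \sum_(i < (2 * N).+1) binomial_weight N i * cos (frequency N i * u).
Proof.
have twocos : (2 * cos u)%:C = expi u + expi (- u).
  by rewrite /expi cosN sinN; apply/eqP; rewrite eq_complex/= subrr eqxx andbT;
    rewrite -mulr2n mulr_natl.
have : (2 * cos u)%:C ^+ (2 * N) = (expi u + expi (- u)) ^+ (2 * N).
  by rewrite twocos.
rewrite -rmorphXn exprMn [RHS]exprDn => /(congr1 (@complex.Re R)) /=.
rewrite Re_sum exprM.
have -> : 2 ^+ 2 = 4 :> R by ring.
move=> h; apply: (@mulfI _ (4 ^+ N)); first by rewrite expf_neq0// pnatr_eq0.
rewrite h mulr_sumr; apply: eq_bigr => i _.
rewrite /binomial_weight mulrA [4 ^+ N * _]mulrC divfK ?expf_neq0 ?pnatr_eq0//.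
rewrite -!expi_mulrn -expiD.
have -> : (2 * N - i)%:R * u + i%:R * - u = frequency N i * u.
  have hi : (i <= 2 * N)%N by rewrite -ltnS ltn_ord.
  by rewrite (natrB _ hi) /frequency natrM; ring.
rewrite Re_cMn /=.
by rewrite mulr_natl.
Qed.

Lemma is_derive_smooth_step N u :
  is_derive u 1 (smooth_step N) (cos u ^+ (2 * N)).
Proof.
pose h (i : 'I_(2 * N).+1) u : R := binomial_weight N i *
    (if i == N :> nat then u else sin (frequency N i * u) / frequency N i).
have -> : smooth_step N = \sum_i h i by apply/funext => v; rewrite fct_sumE.
rewrite cos_pow_fourier; apply: is_derive_sum => i; rewrite /h.
have [->|iN] := eqVneq (i : nat) N.
  rewrite /frequency subrr mul0r mul0r cos0.
  exact: (is_deriveZ (binomial_weight N N) (is_derive_id u 1)).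
have f0 : frequency N i != 0 by rewrite frequency_eq0.
set f := frequency N i in f0 *; set b := binomial_weight N i.
have d1 : is_derive u 1 (fun u => f * u) f.
  have := is_deriveZ f (is_derive_id u 1).
  by rewrite /GRing.scale /= mulr1.
have d2 := is_derive1_comp (is_derive_sin (f * u)) d1.
have := is_deriveZ (b / f) d2.
have -> : (b / f) *: (cos (f * u) * f) = b * cos (f * u).
  by rewrite /GRing.scale /=; field.
congr is_derive; apply/funext => v /=; rewrite /GRing.scale /=; ring.
Qed.

Lemma smooth_step_nondecreasing N u v : u <= v ->
  smooth_step N u <= smooth_step N v.
Proof.
move=> uv; apply: (le_of_derive_ge0 uv (is_derive_smooth_step N)) => x.
by rewrite exprM exprn_ge0// sqr_ge0.
Qed.

Lemma smooth_stepN N u : smooth_step N (- u) = - smooth_step N u.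
Proof.
rewrite /smooth_step -sumrN; apply: eq_bigr => i _; rewrite -mulrN.
by case: ifP => // _; rewrite (mulrN (frequency N i)) sinN mulNr.
Qed.

Lemma sin_natMpi n : sin (n%:R * pi) = 0 :> R.
Proof.
elim: n => [|n IH]; first by rewrite mul0r sin0.
by rewrite -addn1 natrD mulrDl mul1r sinDpi IH oppr0.
Qed.

Lemma sin_natBMpi m n : sin ((m%:R - n%:R) * pi) = 0 :> R.
Proof. by rewrite mulrBl sinB !sin_natMpi mul0r mulr0 subrr. Qed.

Lemma smooth_step_pihalf N : smooth_step N (pi / 2) = step_slope N * (pi / 2).
Proof.
rewrite /smooth_step.
have hN : (N < (2 * N).+1)%N by lia.
rewrite (bigD1 (Ordinal hN))//= eqxx big1 ?addr0// => i iN.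
rewrite ifN; last by apply: contraNN iN => /eqP iN; apply/eqP/val_inj.
have -> : frequency N i * (pi / 2) = (N%:R - i%:R) * pi.
  by rewrite /frequency; field.
by rewrite sin_natBMpi mul0r mulr0.
Qed.

Lemma smooth_stepDpi N u :
  smooth_step N (u + pi) = smooth_step N u + step_slope N * pi.
Proof.
have hN : (N < (2 * N).+1)%N by lia.
rewrite /smooth_step [LHS](bigD1 (Ordinal hN))//=.
rewrite [in RHS](bigD1 (Ordinal hN))//= eqxx -/(step_slope N) mulrDr.
rewrite -!addrA; congr (_ + _); rewrite addrC; congr (_ + _).
apply: eq_bigr => i iN.
have {}iN : (i == N :> nat) = false.
  by apply: contraNF iN => /eqP iN; apply/eqP/val_inj.
rewrite iN.
have fpi : frequency N i * pi = ((2 * N)%:R - (2 * i)%:R) * pi.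
  by rewrite /frequency !natrM; ring.
have fpi2 : frequency N i * pi = ((N%:R - i%:R) * pi) *+ 2.
  by rewrite /frequency -mulr_natr; ring.
rewrite mulrDr sinD.
have -> : sin (frequency N i * pi) = 0 by rewrite fpi sin_natBMpi.
have -> : cos (frequency N i * pi) = 1.
  rewrite fpi2 cos_mulr2n cos2sin2 sin_natBMpi expr0n subr0 mulr2n.
  by rewrite addrK.
by rewrite mulr1 mulr0 addr0.
Qed.

(** Away from the jump the step has reached its plateau up to the height of the
    tail of the bump, because its derivative is at most that height there. *)
Lemma smooth_step_plateau N h u : 0 <= h -> h <= u <= pi - h ->
  `|smooth_step N u - step_slope N * (pi / 2)| <= cos h ^+ (2 * N) * (pi / 2).
Proof.
move=> h0 /andP[hu uh]; rewrite -smooth_step_pihalf.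
have pi0 := pi_gt0 R.
have hh : h <= pi / 2 by lra.
have hpi : `|u - pi / 2| <= pi / 2 by rewrite ler_norml; apply/andP; split; lra.
have cosh0 : 0 <= cos h by apply: cos_ge0_pihalf; apply/andP; split; lra.
apply: le_trans (ler_wpM2l _ hpi); last by rewrite exprn_ge0.
apply: (mean_value_bound (is_derive_smooth_step N)) => x hx.
have {hx} /andP[hx xh] : h <= x <= pi - h.
  by case: (leP (pi / 2) u) hx => h1 /andP[h2 h3]; apply/andP; split; lra.
rewrite normrX lerXn2r ?nnegrE// ler_norml; apply/andP; split.
- have -> : - cos h = cos (pi - h).
    by rewrite cosB cospi sinpi mul0r addr0 mulN1r.
  by rewrite leNgt ltr_cos ?in_itv/= -?leNgt//; apply/andP; split; lra.
- by rewrite leNgt ltr_cos ?in_itv/= -?leNgt//; apply/andP; split; lra.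
Qed.

(** The mean [step_slope N] of the bump is only of order [1 / sqrt N], far above
    the trivial [1 / (2 N + 1)]; this is where the square root in the final
    scale comes from.  Consecutive central coefficients have ratio
    [2 (2 N + 1) / (N + 1)]. *)
Lemma central_binomial_ge N : (0 < N)%N ->
  (16 ^ N <= 4 * N * 'C(2 * N, N) ^ 2)%N.
Proof.
elim: N => // -[|N] IH _; first by [].
have {IH} := IH isT; set M := N.+1; set c := 'C(2 * M, M) => IH.
have e1 : ((2 * M).+1 * c = M.+1 * 'C((2 * M).+1, M))%N.
  by have := mul_bin_down (2 * M).+1 M; rewrite /= -/c => ->; congr (_ * _)%N; lia.
have e2 : ('C(2 * M.+1, M.+1) = 2 * 'C((2 * M).+1, M))%N.
  have -> : (2 * M.+1 = (2 * M).+2)%N by lia.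
  rewrite [LHS]binS; have -> : ('C((2 * M).+1, M.+1) = 'C((2 * M).+1, M))%N.
    by rewrite -bin_sub; [congr 'C(_, _); lia|lia].
  by rewrite addnn -mul2n.
have M0 : (0 < M.+1)%N by [].
rewrite -(leq_pmul2l M0) e2; set b := 'C(_, _) in e1 *.
rewrite expnS.
have : (M.+1 ^ 2 * b ^ 2 = (2 * M).+1 ^ 2 * c ^ 2)%N by rewrite -!expnMn e1.
nia.
Qed.

Lemma step_slope_ge N : (0 < N)%N -> 1 <= 2 * Num.sqrt N%:R * step_slope N.
Proof.
move=> N0; have hs : 0 < Num.sqrt N%:R :> R by rewrite sqrtr_gt0 ltr0n.
rewrite mulrA ler_pdivlMr ?exprn_gt0// mul1r [2 * _]mulrC [leRHS]mulrC.
rewrite -(@ler_pXn2r _ 2) ?nnegrE ?exprn_ge0 ?mulr_ge0 ?sqrtr_ge0//.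
have := central_binomial_ge N0; rewrite -(ler_nat R) !natrM !natrX.
rewrite !exprMn sqr_sqrtr ?ler0n//.
have -> : 16 = 4 ^+ 2 :> R by ring.
by rewrite -exprM mulnC exprM => /le_trans; apply; lra.
Qed.

Lemma step_slope_gt0 N : 0 < step_slope N.
Proof. by rewrite divr_gt0// ?exprn_gt0// ltr0n bin_gt0; lia. Qed.

End smooth_step.

(** * Expectations of real and complex functions *)

Section real_expectation.
Context d (T : measurableType d) (R : realType) (P : probability T R).
Implicit Types (f g X : T -> R) (A : set T).

Definition rintegrable f := P.-integrable setT (EFin \o f).

Lemma fine_expectation X : fine 'E_P[X] = \int[P]_w X w.
Proof. by rewrite unlock. Qed.

Lemma rintegrable_measurable f : rintegrable f -> measurable_fun setT f.
Proof. by move=> /measurable_int/measurable_EFinP. Qed.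

Lemma rintegrableD f g : rintegrable f -> rintegrable g ->
  rintegrable (fun w => f w + g w).
Proof. by move=> hf hg; exact: (integrableD measurableT hf hg). Qed.

Lemma rintegrableB f g : rintegrable f -> rintegrable g ->
  rintegrable (fun w => f w - g w).
Proof. by move=> hf hg; exact: (integrableB measurableT hf hg). Qed.

Lemma rintegrableZ (k : R) f : rintegrable f -> rintegrable (fun w => k * f w).
Proof. by move=> hf; exact: (integrableZl measurableT k hf). Qed.

Lemma rintegrable_norm f : rintegrable f -> rintegrable (fun w => `|f w|).
Proof. by move=> hf; exact: integrable_norm. Qed.

Lemma le_rintegrable f g : measurable_fun setT f ->
  (forall w, `|f w| <= g w) -> rintegrable g -> rintegrable f.
Proof.
move=> mf fg; apply: le_integrable => //; first exact/measurable_EFinP.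
by move=> w _; rewrite lee_fin (le_trans (fg w))// ler_norm.
Qed.

Lemma rintegrable_cst (k : R) : rintegrable (fun=> k).
Proof. exact: finite_measure_integrable_cst. Qed.

Lemma rintegrable_bounded f (K : R) : measurable_fun setT f ->
  (forall w, `|f w| <= K) -> rintegrable f.
Proof. by move=> mf fK; apply: (le_rintegrable mf fK (rintegrable_cst K)). Qed.

Lemma rintegrable_sum I (r : seq I) (f : I -> T -> R) :
  (forall i, rintegrable (f i)) -> rintegrable (fun w => \sum_(i <- r) f i w).
Proof.
move=> hf; elim: r => [|i r IH].
  by under [X in rintegrable X]eq_fun do rewrite big_nil; exact: rintegrable_cst.
by under [X in rintegrable X]eq_fun do rewrite big_cons; exact: rintegrableD.
Qed.

Lemma Rintegral_const (k : R) : \int[P]_w k = k.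
Proof. by rewrite Rintegral_cst//= probability_setT mulr1. Qed.

Lemma RintegralDT f g : rintegrable f -> rintegrable g ->
  \int[P]_w (f w + g w) = \int[P]_w f w + \int[P]_w g w.
Proof. exact: RintegralD. Qed.

Lemma RintegralBT f g : rintegrable f -> rintegrable g ->
  \int[P]_w (f w - g w) = \int[P]_w f w - \int[P]_w g w.
Proof. exact: RintegralB. Qed.

Lemma RintegralZT k f : rintegrable f ->
  \int[P]_w (k * f w) = k * \int[P]_w f w.
Proof. exact: RintegralZl. Qed.

Lemma Rintegral_sum I (r : seq I) (f : I -> T -> R) :
  (forall i, rintegrable (f i)) ->
  \int[P]_w (\sum_(i <- r) f i w) = \sum_(i <- r) \int[P]_w f i w.
Proof.
move=> hf; elim: r => [|i r IH].
  under eq_Rintegral do rewrite big_nil.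
  by rewrite big_nil Rintegral_const.
under eq_Rintegral do rewrite big_cons.
by rewrite big_cons RintegralDT ?IH//; exact: rintegrable_sum.
Qed.

Lemma le_RintegralT f g : rintegrable f -> rintegrable g ->
  (forall w, f w <= g w) -> \int[P]_w f w <= \int[P]_w g w.
Proof. by move=> hf hg fg; apply: le_Rintegral. Qed.

Lemma norm_Rintegral_le f g : rintegrable f -> rintegrable g ->
  (forall w, `|f w| <= g w) -> `|\int[P]_w f w| <= \int[P]_w g w.
Proof.
move=> hf hg fg; rewrite (le_trans (le_normr_Rintegral _ _))//.
by apply: le_RintegralT => //; exact: rintegrable_norm.
Qed.

Lemma measurable_indicT A : measurable A ->
  measurable_fun setT (\1_A : T -> R).
Proof. by move=> mA; exact: measurable_indic. Qed.

Lemma rintegrable_indic A : measurable A -> rintegrable (\1_A : T -> R).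
Proof.
move=> mA; apply: (@rintegrable_bounded _ 1); first exact: measurable_indicT.
by move=> w; rewrite indicE ger0_norm// lern1; case: (_ \in _).
Qed.

Lemma Rintegral_indic A : measurable A -> \int[P]_w (\1_A w : R) = fine (P A).
Proof. by move=> mA; rewrite /Rintegral integral_indic// setIT. Qed.

Lemma norm_indicM_le A f w : `|\1_A w * f w| <= `|f w|.
Proof.
rewrite normrM ler_piMl// indicE ger0_norm// lern1; by case: (_ \in _).
Qed.

Lemma rintegrable_indicM A f : measurable A -> rintegrable f ->
  rintegrable (fun w => \1_A w * f w).
Proof.
move=> mA hf.
apply: (@le_rintegrable _ (fun w => `|f w|)).
- by apply: measurable_funM; [exact: measurable_indicT|
                              exact: rintegrable_measurable].
- exact: norm_indicM_le.
- exact: rintegrable_norm.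
Qed.

Lemma Rintegral_indicM A f : measurable A ->
  \int[P]_w (\1_A w * f w) = \int[P]_(w in A) f w.
Proof.
move=> mA; rewrite [RHS]Rintegral_mkcond; apply: eq_Rintegral => w _.
by rewrite patchE indicE; case: ifP => _; rewrite ?mul1r ?mul0r.
Qed.

Lemma probability_fin A : measurable A -> (fine (P A))%:E = P A.
Proof. by move=> mA; rewrite fineK// fin_num_measure. Qed.

End real_expectation.

Section complex_expectation.
Context d (T : measurableType d) (R : realType) (P : probability T R).
Implicit Types (Z W : T -> R[i]).

Definition cmeasurable Z :=
  measurable_fun setT (fun w => complex.Re (Z w)) /\
  measurable_fun setT (fun w => complex.Im (Z w)).

Definition cintegrable Z :=
  rintegrable P (fun w => complex.Re (Z w)) /\
  rintegrable P (fun w => complex.Im (Z w)).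

Lemma Re_cexpectation Z :
  complex.Re (cexpectation P Z) = \int[P]_w complex.Re (Z w).
Proof. by rewrite /cexpectation /= fine_expectation. Qed.

Lemma Im_cexpectation Z :
  complex.Im (cexpectation P Z) = \int[P]_w complex.Im (Z w).
Proof. by rewrite /cexpectation /= fine_expectation. Qed.

Lemma complex_eq (z w : R[i]) :
  complex.Re z = complex.Re w -> complex.Im z = complex.Im w -> z = w.
Proof. by case: z w => [a b] [c e] /= -> ->. Qed.

Lemma eq_cexpectation Z W : Z =1 W -> cexpectation P Z = cexpectation P W.
Proof. by move=> /funext ->. Qed.

Lemma cmeasurable_cst z : cmeasurable (fun=> z).
Proof. by split; exact: measurable_cst. Qed.

Lemma cmeasurableB Z W : cmeasurable Z -> cmeasurable W ->
  cmeasurable (fun w => Z w - W w).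
Proof.
move=> [a b] [a' b']; split.
- by under eq_fun do rewrite Re_cD Re_cN; exact: measurable_funB.
- by under eq_fun do rewrite Im_cD Im_cN; exact: measurable_funB.
Qed.

Lemma cmeasurableM Z W : cmeasurable Z -> cmeasurable W ->
  cmeasurable (fun w => Z w * W w).
Proof.
move=> [a b] [a' b']; split.
- by under eq_fun do rewrite Re_cM;
    apply: measurable_funB; apply: measurable_funM.
- by under eq_fun do rewrite Im_cM;
    apply: measurable_funD; apply: measurable_funM.
Qed.

Lemma cmeasurable_expi (X : T -> R) (t : R) : measurable_fun setT X ->
  cmeasurable (fun w => expi (t * X w)).
Proof.
move=> mX; have mtX : measurable_fun setT (fun w => t * X w).
  exact: measurable_funM.
split; apply: measurableT_comp mtX; apply: continuous_measurable_fun.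
- exact: continuous_cos.
- exact: continuous_sin.
Qed.

Lemma cmeasurable_indic (A : set T) : measurable A ->
  cmeasurable (fun w => (\1_A w)%:C).
Proof. by move=> mA; split; [exact: measurable_indicT|exact: measurable_cst]. Qed.

Lemma measurable_cabs Z : cmeasurable Z ->
  measurable_fun setT (fun w => cabs (Z w)).
Proof.
move=> [a b]; under eq_fun do rewrite cabsE.
apply: (@measurableT_comp _ _ _ _ _ _ (@Num.sqrt R)).
  by apply: continuous_measurable_fun; exact: sqrt_continuous.
by apply: measurable_funD; apply: measurable_funX.
Qed.

Lemma le_cintegrable Z (g : T -> R) : cmeasurable Z ->
  (forall w, cabs (Z w) <= g w) -> rintegrable P g -> cintegrable Z.
Proof.
move=> [a b] Zg hg; split; apply: (le_rintegrable _ _ hg) => // w.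
- exact: le_trans (Re_le_cabs _) (Zg w).
- exact: le_trans (Im_le_cabs _) (Zg w).
Qed.

Lemma cintegrable_bounded Z (K : R) : cmeasurable Z ->
  (forall w, cabs (Z w) <= K) -> cintegrable Z.
Proof. by move=> mZ ZK; apply: (le_cintegrable mZ ZK); exact: rintegrable_cst. Qed.

Lemma cintegrable_expi (X : T -> R) t : measurable_fun setT X ->
  cintegrable (fun w => expi (t * X w)).
Proof.
move=> mX; apply: (@cintegrable_bounded _ 1); first exact: cmeasurable_expi.
by move=> w; rewrite cabs_expi.
Qed.

Lemma cintegrable_cst z : cintegrable (fun=> z).
Proof. by split; exact: rintegrable_cst. Qed.

Lemma cintegrableD Z W : cintegrable Z -> cintegrable W ->
  cintegrable (fun w => Z w + W w).
Proof.
move=> [a b] [a' b']; split.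
- by under [X in rintegrable _ X]eq_fun do rewrite Re_cD; exact: rintegrableD.
- by under [X in rintegrable _ X]eq_fun do rewrite Im_cD; exact: rintegrableD.
Qed.

Lemma cintegrableZ z Z : cintegrable Z -> cintegrable (fun w => z * Z w).
Proof.
move=> [a b]; split.
- under [X in rintegrable _ X]eq_fun do rewrite Re_cM.
  by apply: rintegrableB; exact: rintegrableZ.
- under [X in rintegrable _ X]eq_fun do rewrite Im_cM.
  by apply: rintegrableD; exact: rintegrableZ.
Qed.

Lemma cexpectation_cst z : cexpectation P (fun=> z) = z.
Proof.
by apply: complex_eq; rewrite ?Re_cexpectation ?Im_cexpectation Rintegral_const.
Qed.

Lemma cexpectationD Z W : cintegrable Z -> cintegrable W ->
  cexpectation P (fun w => Z w + W w) = cexpectation P Z + cexpectation P W.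
Proof.
move=> [a b] [a' b']; apply: complex_eq;
  rewrite ?Re_cD ?Im_cD ?Re_cexpectation ?Im_cexpectation -RintegralDT//;
  by apply: eq_Rintegral => w _; rewrite ?Re_cD ?Im_cD.
Qed.

Lemma cexpectationZ z Z : cintegrable Z ->
  cexpectation P (fun w => z * Z w) = z * cexpectation P Z.
Proof.
move=> [a b]; apply: complex_eq.
- rewrite Re_cM !Re_cexpectation Im_cexpectation -!RintegralZT// -RintegralBT//;
    try exact: rintegrableZ.
  by apply: eq_Rintegral => w _; rewrite Re_cM.
- rewrite Im_cM !Im_cexpectation Re_cexpectation -!RintegralZT// -RintegralDT//;
    try exact: rintegrableZ.
  by apply: eq_Rintegral => w _; rewrite Im_cM.
Qed.

Lemma cexpectationB Z W : cintegrable Z -> cintegrable W ->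
  cexpectation P (fun w => Z w - W w) = cexpectation P Z - cexpectation P W.
Proof.
move=> hZ hW; rewrite -(mulN1r (cexpectation P W)) -cexpectationZ//.
rewrite -cexpectationD//; last exact: cintegrableZ.
by apply: eq_cexpectation => w; rewrite mulN1r.
Qed.

Lemma cintegrable_sum I (r : seq I) (Z : I -> T -> R[i]) :
  (forall i, cintegrable (Z i)) -> cintegrable (fun w => \sum_(i <- r) Z i w).
Proof.
move=> hf; elim: r => [|i r IH].
  rewrite (_ : (fun _ => _) = (fun=> 0)); first exact: cintegrable_cst.
  by apply/funext => w; rewrite big_nil.
rewrite (_ : (fun _ => _) = (fun w => Z i w + \sum_(j <- r) Z j w)).
  exact: cintegrableD.
by apply/funext => w; rewrite big_cons.
Qed.

Lemma cexpectation_sum I (r : seq I) (Z : I -> T -> R[i]) :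
  (forall i, cintegrable (Z i)) ->
  cexpectation P (fun w => \sum_(i <- r) Z i w) =
  \sum_(i <- r) cexpectation P (Z i).
Proof.
move=> hf; elim: r => [|i r IH].
  rewrite big_nil -[RHS](cexpectation_cst 0).
  by apply: eq_cexpectation => w; rewrite big_nil.
rewrite big_cons -IH -cexpectationD//; last exact: cintegrable_sum.
by apply: eq_cexpectation => w; rewrite big_cons.
Qed.

(** The triangle inequality is proved by pairing with the conjugate of the
    expectation, so that no constant is lost; products of characteristic
    functions must stay in the unit disc. *)
Lemma cabs_cexpectation_le Z (g : T -> R) : cintegrable Z ->
  (forall w, cabs (Z w) <= g w) -> rintegrable P g ->
  cabs (cexpectation P Z) <= \int[P]_w g w.
Proof.
move=> hZ Zg hg; have [hR hI] := hZ; set z := cexpectation P Z.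
have [->|z0] := eqVneq (cabs z) 0.
  by apply: Rintegral_ge0 => w _; rewrite (le_trans _ (Zg w))// cabs_ge0.
have {}z0 : 0 < cabs z by rewrite lt_neqAle eq_sym z0 cabs_ge0.
rewrite -(ler_pM2l z0) -expr2 sqr_cabs -RintegralZT//.
rewrite !expr2 {2}/z Re_cexpectation {3}/z Im_cexpectation.
rewrite -!RintegralZT// -RintegralDT; [|exact: rintegrableZ..].
apply: le_RintegralT => [||w]; [|exact: rintegrableZ|].
  by apply: rintegrableD; exact: rintegrableZ.
apply: (@le_trans _ _ (cabs z * cabs (Z w))); last first.
  by rewrite ler_wpM2l ?cabs_ge0.
pose z' := complex.Re z +i* (- complex.Im z).
have -> : cabs z = cabs z' by rewrite !cabsE /= sqrrN.
rewrite -cabsM (le_trans _ (Re_le_cabs _))// (le_trans _ (ler_norm _))//.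
by rewrite Re_cM /= mulNr opprK !fine_expectation.
Qed.

Lemma cabs_charfun_le1 (X : T -> R) t : measurable_fun setT X ->
  cabs (charfun P X t) <= 1.
Proof.
move=> mX; rewrite -[leRHS](Rintegral_const P) cabs_cexpectation_le//.
- exact: cintegrable_expi.
- by move=> w; rewrite cabs_expi.
- exact: rintegrable_cst.
Qed.

End complex_expectation.

(** * Decoupling by slicing *)

Section decoupling.
Context d (T : measurableType d) (R : realType) (P : probability T R).
Implicit Types (U V : T -> R).

(** When [|U| <= 1] the slices of width [1 / (n + 1)] starting at [- 1]
    partition the space, so a sum over slices picks out a single term. *)
Lemma sum_indic_level (U : T -> R) (n : nat) (c : nat -> R) w : `|U w| <= 1 ->
  exists k : nat,
    [/\ (k < (2 * n.+1).+1)%N, 0 <= U w - (k%:R / n.+1%:R - 1) <= n.+1%:R^-1 &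
    \sum_(i < (2 * n.+1).+1) c i *
      \1_(U @^-1` `[i%:R / n.+1%:R - 1, i.+1%:R / n.+1%:R - 1[) w = c k].
Proof.
move=> /ler_normlP[hU1 hU2].
have n0 : (0 : R) < n.+1%:R by rewrite ltr0n.
pose x := (U w + 1) * n.+1%:R; pose k := Num.truncn x.
have x0 : 0 <= x by apply: mulr_ge0; [lra|exact: ltW].
have /andP[kx xk] := truncn_itv x0.
have hk : (k < (2 * n.+1).+1)%N.
  rewrite ltnS -(ler_nat R) (le_trans kx)// natrM ler_pM2r//; lra.
have Ux : U w = x / n.+1%:R - 1 by rewrite /x mulfK ?gt_eqF// addrK.
exists k; split => //.
  rewrite {}Ux; have -> : x / n.+1%:R - 1 - (k%:R / n.+1%:R - 1) =
    (x - k%:R) / n.+1%:R by rewrite mulrBl; ring.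
  rewrite divr_ge0 ?(ltW n0) ?subr_ge0//= ler_pdivrMr// mulVf ?gt_eqF//.
  by rewrite lerBlDl natr1 ltW.
have level i : U w \in `[i%:R / n.+1%:R - 1, i.+1%:R / n.+1%:R - 1[ = (i == k).
  rewrite in_itv/= Ux lerD2r ltrD2r ler_pM2r ?invr_gt0// ltr_pM2r ?invr_gt0//.
  by rewrite eq_sym -truncn_eq.
rewrite (bigD1 (Ordinal hk))//= indicE mem_set/= ?mulr1; last by rewrite level.
rewrite big1 ?addr0// => i ik; rewrite indicE memNset ?mulr0//= level.
by apply/negP; apply: contraNN ik => /eqP ik; apply/eqP/val_inj.
Qed.

(** If the integral of [V] over every level set of [U] is small relative to the
    probability of that set, then so is the integral of [U * V]: cut the range
    of [U] into thin slices, on which [U] is nearly constant. *)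
Lemma decoupling U V (a : R) : measurable_fun setT U ->
  (forall w, `|U w| <= 1) -> rintegrable P V ->
  (forall B, measurable B -> `|\int[P]_w (\1_(U @^-1` B) w * V w)| <=
     a * fine (P (U @^-1` B))) ->
  `|\int[P]_w (U w * V w)| <= a.
Proof.
move=> mU U1 iV hV.
have iUV : rintegrable P (fun w => U w * V w).
  apply: (le_rintegrable _ _ (rintegrable_norm iV)).
    by apply: measurable_funM => //; exact: rintegrable_measurable iV.
  by move=> w; rewrite normrM ler_piMl.
pose K := \int[P]_w `|V w|.
suff h n : `|\int[P]_w (U w * V w)| <= a + n.+1%:R^-1 * K.
  apply/ler_addgt0Pl => e e0; have K0 : 0 <= K by exact: Rintegral_ge0.
  have [n hn] : exists n : nat, K / e <= n.+1%:R.
    exists (Num.truncn (K / e)); apply/ltW.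
    by have /andP[] := truncn_itv (divr_ge0 K0 (ltW e0)).
  rewrite (le_trans (h n))// addrC lerD2r mulrC ler_pdivrMr ?ltr0n//.
  by rewrite -ler_pdivrMl// mulrC.
pose c (k : nat) : R := k%:R / n.+1%:R - 1.
pose A (k : nat) : set T :=
  U @^-1` `[k%:R / n.+1%:R - 1, k.+1%:R / n.+1%:R - 1[.
have mA k : measurable (A k) by rewrite -[A k]setTI; exact: mU.
pose N := (2 * n.+1).+1.
pose U' w : R := \sum_(i < N) c i * \1_(A i) w.
have c1 (k : nat) : (k < N)%N -> `|c k| <= 1.
  move=> kN; rewrite ler_norml /c lerBrDr addNr divr_ge0//= lerBlDr.
  by rewrite ler_pdivrMr ?ltr0n// -[1 + 1]/(2%:R) -natrM ler_nat; move: kN; rewrite ltnS.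
have U'w w : exists2 k : nat, `|c k| <= 1 & U' w = c k /\ `|U w - U' w| <= n.+1%:R^-1.
  have [k [kN /andP[h1 h2] e]] := sum_indic_level n c (U1 w).
  exists k; first exact: c1.
  by rewrite /U' /N e; split => //; rewrite ger0_norm.
have mU' : measurable_fun setT U'.
  rewrite /U'; apply: measurable_sum => i; exact: measurable_funM.
have iAV i : rintegrable P (fun w => \1_(A i) w * V w).
  exact: rintegrable_indicM.
have iU'V : rintegrable P (fun w => U' w * V w).
  apply: (le_rintegrable _ _ (rintegrable_norm iV)).
    by apply: measurable_funM => //; exact: rintegrable_measurable iV.
  by move=> w; have [k ck [-> _]] := U'w w; rewrite normrM ler_piMl.
have -> : \int[P]_w (U w * V w) =
    \int[P]_w (U' w * V w) + \int[P]_w (U w * V w - U' w * V w).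
  by rewrite RintegralBT// addrC subrK.
rewrite (le_trans (ler_normD _ _))// lerD//; last first.
  rewrite -RintegralZT; last exact: rintegrable_norm.
  apply: norm_Rintegral_le => [||w].
  - exact: rintegrableB.
  - by apply: rintegrableZ; exact: rintegrable_norm.
  - by rewrite -mulrBl normrM ler_wpM2r//; have [k _ []] := U'w w.
have -> : \int[P]_w (U' w * V w) =
    \sum_(i < N) c i * \int[P]_w (\1_(A i) w * V w).
  rewrite (eq_bigr (fun i : 'I_N =>
    \int[P]_w (c i * (\1_(A i) w * V w)))); last first.
    by move=> i _; rewrite RintegralZT.
  rewrite -Rintegral_sum; last by move=> i; exact: rintegrableZ.
  by apply: eq_Rintegral => w _; rewrite mulr_suml; apply: eq_bigr => i _;
    rewrite mulrA.
rewrite (le_trans (ler_norm_sum _ _ _))//.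
have sumP : \sum_(i < N) fine (P (A i)) = 1.
  rewrite -[RHS](Rintegral_const P 1).
  rewrite (eq_bigr (fun i : 'I_N => \int[P]_w (1 * \1_(A i) w))); last first.
    move=> i _; rewrite -(Rintegral_indic P (mA i)).
    by apply: eq_Rintegral => w _; rewrite mul1r.
  rewrite -Rintegral_sum; last first.
    by move=> i; apply: rintegrableZ; exact: rintegrable_indic.
  apply: eq_Rintegral => w _.
  by have [k [_ _]] := sum_indic_level n (fun=> 1) (U1 w).
rewrite -[a in leRHS]mulr1 -sumP mulr_sumr; apply: ler_sum => i _.
by rewrite normrM (le_trans _ (hV _ _))// ler_piMl// c1.
Qed.

Section complex_decoupling.
Variables (G : set_system T) (U V : T -> R[i]) (a : R).
Hypothesis mU : cmeasurable U.
Hypothesis GU : measurable_wrt G (fun w => complex.Re (U w)) /\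
                measurable_wrt G (fun w => complex.Im (U w)).
Hypothesis U1 : forall w, cabs (U w) <= 1.
Hypothesis iV : cintegrable P V.
Hypothesis hV : forall A, G A ->
  `|\int[P]_w (\1_A w * complex.Re (V w))| <= a * fine (P A) /\
  `|\int[P]_w (\1_A w * complex.Im (V w))| <= a * fine (P A).

(** A product of complex factors consists of four real covariances, hence the
    factor four. *)
Lemma complex_decoupling : cabs (cexpectation P (fun w => U w * V w)) <= 4 * a.
Proof.
have [mR mI] := mU; have [GR GI] := GU; have [iR iI] := iV.
have bR w : `|complex.Re (U w)| <= 1 := le_trans (Re_le_cabs _) (U1 w).
have bI w : `|complex.Im (U w)| <= 1 := le_trans (Im_le_cabs _) (U1 w).
have i_ (f g : T -> R) : measurable_fun setT f -> (forall w, `|f w| <= 1) ->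
    rintegrable P g -> rintegrable P (fun w => f w * g w).
  move=> mf f1 ig; apply: (le_rintegrable _ _ (rintegrable_norm ig)).
    by apply: measurable_funM => //; exact: rintegrable_measurable ig.
  by move=> w; rewrite normrM ler_piMl.
have h1 := decoupling mR bR iR (fun B mB => (hV (GR B mB)).1).
have h2 := decoupling mI bI iI (fun B mB => (hV (GI B mB)).2).
have h3 := decoupling mR bR iI (fun B mB => (hV (GR B mB)).2).
have h4 := decoupling mI bI iR (fun B mB => (hV (GI B mB)).1).
have -> : 4 * a = (a + a) + (a + a) by ring.
apply: cabs_le_pair.
- rewrite Re_cexpectation; under eq_Rintegral do rewrite Re_cM.
  by rewrite RintegralBT ?i_// (le_trans (ler_normB _ _))// lerD.
- rewrite Im_cexpectation; under eq_Rintegral do rewrite Im_cM.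
  by rewrite RintegralDT ?i_// (le_trans (ler_normD _ _))// lerD.
Qed.

End complex_decoupling.

(** On events of the conditioning family the variable may be replaced by its
    conditional expectation, which is close to a constant by assumption. *)
Lemma cond_exp_covariance (G : set_system T) (V Z : T -> R) (a : R) :
  0 <= a -> G `<=` measurable -> rintegrable P V -> is_cond_exp P G V Z ->
  {ae P, forall w, `|Z w - \int[P]_w V w| <= a} ->
  forall A, G A ->
    `|\int[P]_w (\1_A w * (V w - \int[P]_w V w))| <= a * fine (P A).
Proof.
move=> a0 mG iV [_ iZ eqZ] aeZ A GA; have mA := mG _ GA.
set m := \int[P]_w V w in aeZ *.
have iZm : rintegrable P (fun w => Z w - m).
  by apply: rintegrableB => //; exact: rintegrable_cst.
have -> : \int[P]_w (\1_A w * (V w - m)) = \int[P]_w (\1_A w * (Z w - m)).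
  have split_ f : rintegrable P f -> \int[P]_w (\1_A w * (f w - m)) =
      \int[P]_(w in A) f w - \int[P]_w (\1_A w * m).
    move=> hf; rewrite -(Rintegral_indicM P f mA) -RintegralBT.
    - by apply: eq_Rintegral => w _; rewrite mulrBr.
    - exact: rintegrable_indicM.
    - by apply: rintegrable_indicM => //; exact: rintegrable_cst.
  by rewrite !split_// /Rintegral eqZ.
rewrite (le_trans (le_normr_Rintegral _ _))//; first exact: rintegrable_indicM.
rewrite -(Rintegral_indic P mA) -RintegralZT; last exact: rintegrable_indic.
have i1 : rintegrable P (fun w => `|\1_A w * (Z w - m)|).
  by apply: rintegrable_norm; exact: rintegrable_indicM.
have i2 : rintegrable P (fun w => a * \1_A w).
  by apply: rintegrableZ; exact: rintegrable_indic.
rewrite /Rintegral fine_le//; [exact: integrable_fin_num..|].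
apply: ae_ge0_le_integral => //=.
- exact: measurable_int i1.
- by move=> w _; rewrite lee_fin mulr_ge0.
- exact: measurable_int i2.
apply: filterS aeZ => w Zw _; rewrite lee_fin normrM mulrC.
have i0 : 0 <= \1_A w :> R by [].
by rewrite (ger0_norm i0) ler_wpM2r.
Qed.

End decoupling.

(** * Sums over blocks of a row *)

Section block_estimate.
Context d (T : measurableType d) (R : realType) (P : probability T R).
Variables (Y : nat -> {RV P >-> R}) (t : R).
Implicit Types (a b c j : nat).

Definition range_sum a b w : R := \sum_(a <= j < b) Y j w.

Definition range_expi a b w : R[i] := expi (t * range_sum a b w).

Definition range_charfun a b : R[i] := charfun P (range_sum a b) t.

Lemma measurable_range_sum a b : measurable_fun setT (range_sum a b).
Proof. by apply: measurable_sum. Qed.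

Lemma cmeasurable_range_expi a b : cmeasurable (range_expi a b).
Proof. by apply: cmeasurable_expi; exact: measurable_range_sum. Qed.

Lemma cintegrable_range_expi a b : cintegrable P (range_expi a b).
Proof. by apply: cintegrable_expi; exact: measurable_range_sum. Qed.

Lemma cabs_range_expi a b w : cabs (range_expi a b w) = 1.
Proof. exact: cabs_expi. Qed.

Lemma cabs_range_charfun a b : cabs (range_charfun a b) <= 1.
Proof. by apply: cabs_charfun_le1; exact: measurable_range_sum. Qed.

Lemma range_expi_cat b a c w : (a <= b)%N -> (b <= c)%N ->
  range_expi a c w = range_expi a b w * range_expi b c w.
Proof.
move=> ab bc; rewrite /range_expi /range_sum (@big_cat_nat _ _ _ b)//=.
by rewrite mulrDr expiD.
Qed.

Lemma range_expi_nil a w : range_expi a a w = 1.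
Proof. by rewrite /range_expi /range_sum big_geq// mulr0 expi0. Qed.

Lemma range_charfun_nil a : range_charfun a a = 1.
Proof.
rewrite /range_charfun -[RHS](cexpectation_cst P 1).
by apply: eq_cexpectation => w; exact: range_expi_nil.
Qed.

Lemma range_charfun1 j : range_charfun j j.+1 = charfun P (Y j) t.
Proof.
by apply: eq_cexpectation => w; rewrite /range_sum big_nat1.
Qed.

(** Passing from a sum to its summands costs nothing because the partial
    products have modulus one. *)
Lemma cabs_range_expiB1_le a b w : cabs (range_expi a b w - 1) <=
  \sum_(a <= j < b) cabs (expi (t * Y j w) - 1).
Proof.
have [ba|ab] := leqP b a.
  rewrite /range_expi /range_sum !big_geq// mulr0 expi0 subrr.
  by rewrite ComplexField.Normc.normc0.
elim: b ab => // b IH; rewrite ltnS leq_eqVlt => /predU1P[->|ab].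
  by rewrite /range_expi /range_sum !big_nat1.
rewrite (range_expi_cat (b := b) _ (ltnW ab))// big_nat_recr ?(ltnW ab)//.
have -> : range_expi b b.+1 w = expi (t * Y b w).
  by rewrite /range_expi /range_sum big_nat1.
have -> (x y : R[i]) : x * y - 1 = (x - 1) * y + (y - 1) by ring.
rewrite (le_trans (cabsD _ _))// lerD2r cabsM cabs_expi mulr1.
exact: IH.
Qed.

Lemma cabs_range_expiB1_le_sum a b w : cabs (range_expi a b w - 1) <=
  `|t| * \sum_(a <= j < b) `|Y j w|.
Proof.
rewrite (le_trans (cabs_range_expiB1_le _ _ _))// mulr_sumr ler_sum// => j _.
by rewrite -normrM cabs_expiB1_le.
Qed.

Lemma cabs_range_expiB1_le_count a b w : cabs (range_expi a b w - 1) <=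
  2 * \sum_(a <= j < b) \1_[set w' | Y j w' != 0] w.
Proof.
rewrite (le_trans (cabs_range_expiB1_le _ _ _))// mulr_sumr ler_sum// => j _.
rewrite indicE; have [Y0|Y0] := eqVneq (Y j w) 0.
  rewrite Y0 mulr0 expi0 subrr ComplexField.Normc.normc0 mulr_ge0//.
by rewrite mem_set//= mulr1 cabs_expiB1_le2.
Qed.

Variable k : R.
Hypothesis iY : forall j, rintegrable P (Y j).
Hypothesis probY : forall j, \int[P]_w (\1_[set w' | Y j w' != 0] w : R) <= k.
Hypothesis meanY : forall j, \int[P]_w `|Y j w| <= k.
Hypothesis pairY : forall i j, i <> j ->
  \int[P]_w (`|Y j w| * \1_[set w' | Y i w' != 0] w) <= k ^+ 2.

Lemma measurable_nonzero j : measurable [set w | Y j w != 0].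
Proof.
have -> : [set w | Y j w != 0] = Y j @^-1` (~` [set 0]).
  by apply/seteqP; split => w /= /eqP.
by rewrite -[X in measurable X]setTI; apply: measurable_funP => //; apply: measurableC.
Qed.

Lemma sum_range_le a b (f : nat -> R) (x : R) :
  (forall j, (a <= j < b)%N -> f j <= x) ->
  \sum_(a <= j < b) f j <= (b - a)%:R * x.
Proof.
move=> h; rewrite mulr_natl -sumr_const_nat big_nat_cond [leRHS]big_nat_cond.
by apply: ler_sum => j; rewrite andbT => /h.
Qed.


Lemma cabs_prod_integrable (Z W : T -> R[i]) (x y : R) :
  cmeasurable Z -> cmeasurable W -> (forall w, cabs (Z w) <= x) ->
  (forall w, cabs (W w) <= y) -> rintegrable P (fun w => cabs (Z w) * cabs (W w)).
Proof.
move=> mZ mW hZ hW; apply: (@rintegrable_bounded _ _ _ _ _ (x * y)).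
  by apply: measurable_funM; exact: measurable_cabs.
by move=> w; rewrite ger0_norm ?mulr_ge0 ?cabs_ge0// ler_pM ?cabs_ge0.
Qed.

Lemma cmeasurable_range_expiB z a b :
  cmeasurable (fun w => range_expi a b w - z).
Proof.
by apply: cmeasurableB; [exact: cmeasurable_range_expi|exact: cmeasurable_cst].
Qed.

Lemma cabs_range_expiB z a b w : cabs (range_expi a b w - z) <= 1 + cabs z.
Proof. by rewrite (le_trans (cabsB _ _))// cabs_range_expi. Qed.

Lemma rintegrable_range_expiB z a b :
  rintegrable P (fun w => cabs (range_expi a b w - z)).
Proof.
apply: (@rintegrable_bounded _ _ _ _ _ (1 + cabs z)).
  by apply: measurable_cabs; exact: cmeasurable_range_expiB.
by move=> w; rewrite ger0_norm ?cabs_ge0// cabs_range_expiB.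
Qed.

Lemma rintegrable_nonzero j : rintegrable P (\1_[set w' | Y j w' != 0]).
Proof. by apply: rintegrable_indic; exact: measurable_nonzero. Qed.

(** Two disjoint groups of variables are rarely nonzero together: summing the
    bound on pairs gives the product of the group sizes times the square of
    the small scale. *)
Lemma expectation_two_ranges a b c :
  \int[P]_w (cabs (range_expi a b w - 1) * cabs (range_expi b c w - 1)) <=
  2 * `|t| * ((b - a)%:R * ((c - b)%:R * k ^+ 2)).
Proof.
pose f i j w : R := `|Y j w| * \1_[set w' | Y i w' != 0] w.
have iA i j : rintegrable P (f i j).
  rewrite /f; under eq_fun do rewrite mulrC.
  apply: rintegrable_indicM; first exact: measurable_nonzero.
  by apply: rintegrable_norm; exact: iY.
have iS i : rintegrable P (fun w => \sum_(b <= j < c) f i j w).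
  exact: rintegrable_sum.
have iSS : rintegrable P (fun w => \sum_(a <= i < b) \sum_(b <= j < c) f i j w).
  exact: rintegrable_sum.
apply: (@le_trans _ _ (\int[P]_w (2 * `|t| *
    \sum_(a <= i < b) \sum_(b <= j < c) f i j w))).
  apply: le_RintegralT => [||w].
  - by apply: (@cabs_prod_integrable _ _ (1 + cabs 1) (1 + cabs 1));
      [exact: cmeasurable_range_expiB..| |] => w; exact: cabs_range_expiB.
  - exact: rintegrableZ.
  apply: le_trans (ler_pM _ _ (cabs_range_expiB1_le_count a b w)
    (cabs_range_expiB1_le_sum b c w)) _; rewrite ?cabs_ge0//.
  rewrite mulrACA mulr_suml ler_wpM2l ?mulr_ge0//; apply: ler_sum => i _.
  by rewrite mulr_sumr; apply: ler_sum => j _; rewrite mulrC.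
rewrite RintegralZT// ler_wpM2l ?mulr_ge0// Rintegral_sum//.
apply: sum_range_le => i /andP[_ ib].
rewrite Rintegral_sum//; apply: sum_range_le => j /andP[bj _].
by apply: pairY => ij; move: bj; rewrite -ij leqNgt ib.
Qed.

Lemma expectation_range_expiB1_count a b :
  \int[P]_w cabs (range_expi a b w - 1) <= 2 * ((b - a)%:R * k).
Proof.
have i0 : rintegrable P (fun w => \sum_(a <= j < b) \1_[set w' | Y j w' != 0] w).
  by apply: rintegrable_sum => j; exact: rintegrable_nonzero.
apply: (@le_trans _ _ (\int[P]_w
    (2 * \sum_(a <= j < b) \1_[set w' | Y j w' != 0] w))).
  apply: le_RintegralT => [||w].
  - exact: rintegrable_range_expiB.
  - exact: rintegrableZ.
  - exact: cabs_range_expiB1_le_count.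
rewrite RintegralZT// ler_wpM2l// Rintegral_sum; last exact: rintegrable_nonzero.
by apply: sum_range_le => j _; exact: probY.
Qed.

Lemma cabs_range_charfunB1 a b :
  cabs (range_charfun a b - 1) <= `|t| * ((b - a)%:R * k).
Proof.
have i0 : rintegrable P (fun w => \sum_(a <= j < b) `|Y j w|).
  by apply: rintegrable_sum => j; exact: rintegrable_norm.
rewrite -[X in _ - X](cexpectation_cst P) -cexpectationB.
- apply: (@le_trans _ _ (\int[P]_w (`|t| * \sum_(a <= j < b) `|Y j w|))).
    apply: cabs_cexpectation_le.
    + apply: (@cintegrable_bounded _ _ _ _ _ (1 + cabs 1)).
        exact: cmeasurable_range_expiB.
      by move=> w; exact: cabs_range_expiB.
    + exact: cabs_range_expiB1_le_sum.
    + exact: rintegrableZ.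
  rewrite RintegralZT// ler_wpM2l// Rintegral_sum; last first.
    by move=> j; exact: rintegrable_norm.
  by apply: sum_range_le => j _; exact: meanY.
- exact: cintegrable_range_expi.
- exact: cintegrable_cst.
Qed.

Let k_ge0 : 0 <= k.
Proof. by apply: le_trans (meanY 0); apply: Rintegral_ge0. Qed.

(** Splitting a range into a past, a gap and a block: replacing the factor of
    the gap by one costs little, since gap and block are rarely both nonzero,
    and what remains is the covariance of past and block. *)
Lemma range_charfun_split s a b c : (s <= a)%N -> (a <= b)%N -> (b <= c)%N ->
  cabs (range_charfun s c - range_charfun s b * range_charfun b c) <=
  4 * `|t| * ((b - a)%:R * ((c - b)%:R * k ^+ 2)) +
  cabs (cexpectation P (fun w =>
    range_expi s a w * (range_expi b c w - range_charfun b c))).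
Proof.
move=> sa ab bc; set chi := range_charfun b c.
have chi1 : cabs chi <= 1 := cabs_range_charfun b c.
pose L := range_expi s a; pose G := range_expi a b; pose B := range_expi b c.
pose Z1 w := L w * (G w - 1) * (B w - chi); pose Z2 w := L w * (B w - chi).
have mZ1 : cmeasurable Z1.
  apply: cmeasurableM; last exact: cmeasurable_range_expiB.
  by apply: cmeasurableM; [exact: cmeasurable_range_expi|
                           exact: cmeasurable_range_expiB].
have mZ2 : cmeasurable Z2.
  by apply: cmeasurableM; [exact: cmeasurable_range_expi|
                           exact: cmeasurable_range_expiB].
have Z2b w : cabs (Z2 w) <= 2.
  rewrite cabsM cabs_range_expi mul1r (le_trans (cabs_range_expiB _ _ _ _))//.
  by rewrite -[leRHS]/(1 + 1) lerD2l.
have Z1b w : cabs (Z1 w) <= cabs (G w - 1) * cabs (B w - 1) +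
    cabs (chi - 1) * cabs (G w - 1).
  rewrite !cabsM cabs_range_expi mul1r [cabs (chi - 1) * _]mulrC -mulrDr.
  rewrite ler_wpM2l ?cabs_ge0//.
  have -> : B w - chi = (B w - 1) - (chi - 1) by ring.
  exact: cabsB.
have iGB : rintegrable P (fun w => cabs (G w - 1) * cabs (B w - 1)).
  by apply: (@cabs_prod_integrable _ _ (1 + cabs 1) (1 + cabs 1));
      [exact: cmeasurable_range_expiB..| |] => w; exact: cabs_range_expiB.
have iG : rintegrable P (fun w => cabs (chi - 1) * cabs (G w - 1)).
  by apply: rintegrableZ; exact: rintegrable_range_expiB.
have iZ2 : cintegrable P Z2 by exact: cintegrable_bounded mZ2 Z2b.
have iZ1 : cintegrable P Z1.
  by apply: (le_cintegrable mZ1 Z1b); exact: rintegrableD.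
have -> : range_charfun s c - range_charfun s b * chi =
    cexpectation P Z1 + cexpectation P Z2.
  rewrite -cexpectationD// mulrC -cexpectationZ ?cexpectation_range//; last first.
    exact: cintegrable_range_expi.
  rewrite -cexpectationB; [|exact: cintegrable_range_expi|]; last first.
    by apply: cintegrableZ; exact: cintegrable_range_expi.
  apply: eq_cexpectation => w; rewrite -/(range_expi s c w) -/(range_expi s b w).
  rewrite (range_expi_cat (b := b) w (leq_trans sa ab) bc).
  by rewrite (range_expi_cat (b := a) w sa ab) /Z1 /Z2 /L /G /B; ring.
rewrite (le_trans (cabsD _ _))// lerD2r.
apply: le_trans (cabs_cexpectation_le iZ1 Z1b (rintegrableD iGB iG)) _.
rewrite RintegralDT// RintegralZT; last exact: rintegrable_range_expiB.
have h1 := expectation_two_ranges a b c.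
have h2 : cabs (chi - 1) * \int[P]_w cabs (G w - 1) <=
    (`|t| * ((c - b)%:R * k)) * (2 * ((b - a)%:R * k)).
  apply: ler_pM; rewrite ?cabs_ge0//.
  - by apply: Rintegral_ge0 => w _; exact: cabs_ge0.
  - exact: cabs_range_charfunB1.
  - exact: expectation_range_expiB1_count.
apply: le_trans (lerD h1 h2) _; rewrite le_eqVlt; apply/orP; left; apply/eqP.
ring.
Qed.

(** With an empty past no covariance is left. *)
Lemma range_charfun_adjacent a b c : (a <= b)%N -> (b <= c)%N ->
  cabs (range_charfun a c - range_charfun a b * range_charfun b c) <=
  4 * `|t| * ((b - a)%:R * ((c - b)%:R * k ^+ 2)).
Proof.
move=> ab bc; apply: le_trans (range_charfun_split (leqnn a) ab bc) _.
rewrite [X in cabs X](_ : _ = 0) ?ComplexField.Normc.normc0 ?addr0//.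
under eq_cexpectation do rewrite range_expi_nil mul1r.
rewrite cexpectationB; [|exact: cintegrable_range_expi|exact: cintegrable_cst].
by rewrite cexpectation_cst subrr.
Qed.

Lemma range_charfun_prod a c : (a <= c)%N ->
  cabs (range_charfun a c - \prod_(a <= j < c) charfun P (Y j) t) <=
  4 * `|t| * ((c - a)%:R ^+ 2 * k ^+ 2).
Proof.
elim: c => [|c IH].
  rewrite leqn0 => /eqP ->; rewrite range_charfun_nil big_geq// subrr.
  by rewrite ComplexField.Normc.normc0 ?mulr_ge0.
rewrite leq_eqVlt => /predU1P[->|]; last rewrite ltnS => ac.
  rewrite range_charfun_nil big_geq// subrr.
  by rewrite ComplexField.Normc.normc0 !mulr_ge0.
have := range_charfun_adjacent ac (leqnSn c).
rewrite range_charfun1 big_nat_recr//= => h.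
set F := range_charfun a c in h *; set p := charfun P (Y c) t in h *.
set Q := \prod_(_ <= _ < _) _.
have -> : range_charfun a c.+1 - Q * p = (range_charfun a c.+1 - F * p) +
  (F - Q) * p by ring.
rewrite (le_trans (cabsD _ _))//.
have h2 : cabs ((F - Q) * p) <= 4 * `|t| * ((c - a)%:R ^+ 2 * k ^+ 2).
  rewrite cabsM (le_trans _ (IH ac))// ler_piMr ?cabs_ge0//.
  by apply: cabs_charfun_le1.
apply: le_trans (lerD h h2) _; rewrite -mulrDr ler_wpM2l ?mulr_ge0//.
rewrite mulrA -mulrDl ler_wpM2r ?exprn_ge0// subSn// subnn mulr1 subSn//.
rewrite -[(c - a).+1%:R]natr1; have : 0 <= (c - a)%:R :> R by []; nra.
Qed.

Variables (n : nat) (b0 m0 : nat) (e : R).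
Hypothesis mixing : forall a b c, (2 <= a)%N -> (b = a + m0)%N -> (b <= c)%N ->
  (c <= n.+1)%N ->
  cabs (cexpectation P (fun w =>
    range_expi 1 a w * (range_expi b c w - range_charfun b c))) <= e.

(** Comparison with independent summands, block by block.  With blocks of
    length one this is Lindeberg replacement; long blocks pay the mixing error
    only once per block. *)
Lemma range_charfun_blocks q : (0 < b0)%N -> 0 <= e ->
  cabs (range_charfun 1 (minn (q * b0) n).+1 -
    \prod_(1 <= j < (minn (q * b0) n).+1) charfun P (Y j) t) <=
  q%:R * (4 * `|t| * (b0%:R * ((m0 + b0)%:R * k ^+ 2)) + e).
Proof.
move=> b00 e0; elim: q => [|q IH].
  rewrite mul0n min0n mul0r range_charfun_nil big_geq// subrr.
  by rewrite ComplexField.Normc.normc0.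
set u := minn (q * b0) n in IH *; set u' := minn (q.+1 * b0) n.
have uu' : (u <= u')%N by rewrite /u /u' mulSn; lia.
have u'u : (u' - u <= b0)%N by rewrite /u /u' mulSn; lia.
have u'n : (u' <= n)%N by rewrite /u'; lia.
set b := u.+1; set c := u'.+1.
have bc : (b <= c)%N by [].
rewrite (@big_cat_nat _ _ _ b)//=.
set Q1 := \prod_(_ <= _ < _) _; set Q2 := \prod_(_ <= _ < _) _.
set F := range_charfun 1 b; set chi := range_charfun b c.
have -> : range_charfun 1 c - Q1 * Q2 = (range_charfun 1 c - F * chi) +
  (F * (chi - Q2) + (F - Q1) * Q2) by ring.
have h3 : cabs ((F - Q1) * Q2) <=
    q%:R * (4 * `|t| * (b0%:R * ((m0 + b0)%:R * k ^+ 2)) + e).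
  rewrite cabsM (le_trans _ IH)// ler_piMr ?cabs_ge0//.
  by apply: cabs_prod_le1 => j _; apply: cabs_charfun_le1.
have h2 : cabs (F * (chi - Q2)) <= 4 * `|t| * (b0%:R * (b0%:R * k ^+ 2)).
  rewrite cabsM (@le_trans _ _ (cabs (chi - Q2)))//.
    by rewrite ler_piMl ?cabs_ge0// cabs_range_charfun.
  apply: le_trans (range_charfun_prod bc) _.
  rewrite ler_wpM2l ?mulr_ge0// mulrA ler_wpM2r ?exprn_ge0//.
  by rewrite -expr2 lerXn2r ?nnegrE// ler_nat subSS.
have h1 : cabs (range_charfun 1 c - F * chi) <=
    4 * `|t| * (m0%:R * (b0%:R * k ^+ 2)) + e.
  have [um|mu] := leqP u m0.
    rewrite -[leLHS]addr0 lerD// (le_trans (range_charfun_adjacent _ _))//.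
    rewrite ler_wpM2l ?mulr_ge0// ler_pM ?mulr_ge0 ?exprn_ge0//.
      by rewrite ler_nat subSS subn0.
    by rewrite ler_wpM2r ?exprn_ge0// ler_nat subSS.
  have := @range_charfun_split 1 (b - m0) b c.
  rewrite /b subSn ?(ltnW mu)// ltnS => /(_ isT (leq_subr _ _) bc).
  move=> /le_trans; apply; apply: lerD; last first.
    by apply: mixing => //; lia.
  rewrite ler_wpM2l ?mulr_ge0// ler_pM ?mulr_ge0 ?exprn_ge0//.
    by rewrite ler_nat; lia.
  by rewrite ler_wpM2r ?exprn_ge0// ler_nat subSS.
apply: le_trans (cabsD _ _) _; apply: le_trans (lerD h1 (cabsD _ _)) _.
apply: le_trans (lerD (lexx _) (lerD h2 h3)) _.
rewrite -[q.+1%:R]natr1 natrD le_eqVlt; apply/orP; left; apply/eqP; ring.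
Qed.

End block_estimate.

(** * Mixing rows *)

Section sub_sigma_algebra.
Context d (T : measurableType d) (R : realType).
Implicit Types (G : set_system T) (X Y : T -> R).

(** For a sigma-algebra this identifies the relation with measurability on the
    same type endowed with that sigma-algebra, so that closure properties
    carry over. *)
Lemma measurable_wrtP G X : sigma_algebra setT G ->
  measurable_wrt G X <->
  measurable_fun (setT : set (g_sigma_algebraType G)) (X : g_sigma_algebraType G -> R).
Proof.
move=> sG; split => [hX _ B mB|hX B mB].
  by rewrite setTI; apply: sub_sigma_algebra; exact: hX.
have := hX measurableT B mB; rewrite setTI /measurable /=.
by rewrite sigma_algebra_id.
Qed.

Lemma measurable_wrt_sum G (r : seq nat) (X : nat -> T -> R) :
  sigma_algebra setT G -> (forall j, j \in r -> measurable_wrt G (X j)) ->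
  measurable_wrt G (fun w => \sum_(j <- r) X j w).
Proof.
move=> sG hX; apply/measurable_wrtP => //.
under [X in measurable_fun _ X]eq_fun do rewrite big_seq big_mkcond/=.
apply: measurable_sum => j; case: (boolP (j \in r)) => // jr.
by apply/(measurable_wrtP _ sG); exact: hX.
Qed.

Lemma measurable_wrt_comp G (g : R -> R) X : measurable_fun setT g ->
  measurable_wrt G X -> measurable_wrt G (g \o X).
Proof.
move=> mg hX B mB; rewrite comp_preimage; apply: hX.
by rewrite -[X in measurable X]setTI; exact: mg.
Qed.

Lemma measurable_wrt_sub G G' X : G `<=` G' -> measurable_wrt G X ->
  measurable_wrt G' X.
Proof. by move=> GG' hX B mB; apply/GG'/hX. Qed.

End sub_sigma_algebra.

Section row.
Context (R : realType) d (T : measurableType d) (P : probability T R).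
Variables (F : nat -> set_system T) (Y : nat -> {RV P >-> R}) (n : nat).
Variables (k : R) (alpha : nat -> R).
Hypothesis hF : filtration F.
Hypothesis hY : forall j, (1 <= j <= n)%N -> measurable_wrt (F j) (Y j).
Hypothesis alpha_ge0 : forall i, 0 <= alpha i.
Hypothesis alpha_decr : nonincreasing_seq alpha.
Hypothesis k_ge0 : 0 <= k.
Hypothesis iY : forall j, (1 <= j <= n)%N -> rintegrable P (Y j).
Hypothesis probY : forall j, (1 <= j <= n)%N ->
  (P [set w | (Y j w != 0)%R] <= k%:E)%E.
Hypothesis meanY : forall j, (1 <= j <= n)%N -> \int[P]_w `|Y j w| <= k.
Hypothesis pairY : forall i j, (1 <= i <= n)%N -> (1 <= j <= n)%N -> i <> j ->
  \int[P]_w (`|Y j w| * \1_[set w' | Y i w' != 0] w) <= k ^+ 2.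
Hypothesis A3 : forall i j, (1 <= i)%N -> (i < j)%N -> (j <= n)%N ->
    forall v : (n - j).+1.-tuple R -> R,
    measurable_fun setT v -> (forall x, `|v x| <= 1) ->
    let V := fun w => v [tuple Y (j + k)%N w | k < (n - j).+1] in
    exists2 Z : T -> R, is_cond_exp P (F i) V Z &
      {ae P, forall w, `|Z w - fine 'E_P[V]| <= alpha (j - i)%N}.

(** Extending the row by zero makes the estimates on single summands and on
    pairs hold for all indices. *)
Let row0 j : {RV P >-> R} := if (1 <= j <= n)%N then Y j else cst 0.

Let range_sum_row0 a b w : (1 <= a)%N -> (b <= n.+1)%N ->
  range_sum row0 a b w = \sum_(a <= j < b) Y j w.
Proof.
move=> a1 bn; apply: eq_big_nat => j /andP[aj jb].
by rewrite /row0 ifT//; apply/andP; split; lia.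
Qed.

Let mY j : measurable [set w | Y j w != 0].
Proof. exact: measurable_nonzero. Qed.

(** The mixing condition is applied to the sine and the cosine of the sum of a
    block, seen as functions of all later variables of the row. *)
Let row_mixing (t : R) (m a b c : nat) : (2 <= a)%N -> (b = a + m)%N ->
  (b <= c)%N -> (c <= n.+1)%N ->
  cabs (cexpectation P (fun w => range_expi row0 t 1 a w *
    (range_expi row0 t b c w - range_charfun row0 t b c))) <= 4 * alpha m.
Proof.
move=> a2 bE bc cn.
have [cb|{}bc] := leqP c b.
  have -> : c = b by apply/eqP; rewrite eqn_leq cb.
  under eq_cexpectation do
    rewrite range_expi_nil range_charfun_nil subrr mulr0.
  by rewrite cexpectation_cst ComplexField.Normc.normc0 mulr_ge0.
have [sF mF FS] := hF; set i := a.-1.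
have cov (g : R -> R) : continuous g -> (forall x, `|g x| <= 1) ->
    forall A, F i A -> `|\int[P]_w (\1_A w * (g (t * range_sum row0 b c w) -
      \int[P]_w g (t * range_sum row0 b c w)))| <= alpha m * fine (P A).
  move=> cg g1 A FA.
  have mg := continuous_measurable_fun cg.
  pose v (x : (n - b).+1.-tuple R) : R :=
    g (t * \sum_(l < (n - b).+1) (if (l < c - b)%N then tnth x l else 0)).
  have mv : measurable_fun setT v.
    apply: measurableT_comp mg _; apply: measurable_funM => //.
    by apply: measurable_sum => l; case: (l < c - b)%N => //; exact: measurable_tnth.
  have v1 x : `|v x| <= 1 by exact: g1.
  have i1 : (1 <= i)%N by rewrite /i; lia.
  have ib : (i < b)%N by rewrite /i; lia.
  have bn : (b <= n)%N by lia.
  have [Z] := A3 i1 ib bn mv v1.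
  set V := fun w => v _; rewrite fine_expectation => hZ aeZ.
  have VE : V = fun w => g (t * range_sum row0 b c w).
    apply/funext => w; rewrite /V /v range_sum_row0//; last by lia.
    have -> : \sum_(b <= j < c) Y j w = \sum_(l < c - b) Y (l + b)%N w.
      by rewrite -{1}[b]add0n big_addn big_mkord.
    congr (g (t * _)).
    rewrite (big_ord_widen (n - b).+1 (fun l => Y (l + b)%N w)); last by lia.
    rewrite [RHS]big_mkcond/=; apply: eq_bigr => l _.
    by case: ifP => // _; rewrite tnth_mktuple addnC.
  have mV : measurable_fun setT V.
    by rewrite VE; apply: measurableT_comp mg _; apply: measurable_funM => //;
      exact: measurable_range_sum.
  have iV : rintegrable P V by apply: rintegrable_bounded mV (fun w => v1 _).
  have am : alpha (b - i)%N <= alpha m by apply: alpha_decr; rewrite /i; lia.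
  have := cond_exp_covariance (alpha_ge0 _) (mF i) iV hZ aeZ FA.
  rewrite VE => /le_trans; apply; rewrite ler_wpM2r//.
  by rewrite fine_ge0.
have GL (g : R -> R) : continuous g ->
    measurable_wrt (F i) (fun w => g (t * range_sum row0 1 a w)).
  move=> cg; apply: (@measurable_wrt_comp _ _ _ _ (fun x => g (t * x))).
    by apply: measurableT_comp (continuous_measurable_fun cg) _; apply: measurable_funM.
  rewrite (_ : range_sum _ _ _ = fun w => \sum_(1 <= j < a) Y j w); last first.
    by apply/funext => w; rewrite range_sum_row0//; lia.
  apply: measurable_wrt_sum => // j; rewrite mem_index_iota => /andP[j1 ja].
  apply: (@measurable_wrt_sub _ _ _ (F j)); first by apply: FS; rewrite /i; lia.
  by apply: hY; apply/andP; split; lia.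
apply: (@complex_decoupling _ _ _ P (F i) (range_expi row0 t 1 a)
  (fun w => range_expi row0 t b c w - range_charfun row0 t b c) (alpha m)).
- exact: cmeasurable_range_expi.
- by split; apply: GL; [exact: continuous_cos|exact: continuous_sin].
- by move=> w; rewrite cabs_range_expi.
- apply: (@cintegrable_bounded _ _ _ _ _ (1 + cabs (range_charfun row0 t b c))).
    exact: cmeasurable_range_expiB.
  by move=> w; exact: cabs_range_expiB.
- move=> A FA; split.
  + under eq_Rintegral do rewrite Re_cD Re_cN Re_cexpectation.
    exact: (cov _ (@continuous_cos R) (@cos_max R) A FA).
  + under eq_Rintegral do rewrite Im_cD Im_cN Im_cexpectation.
    exact: (cov _ (@continuous_sin R) (@sin_max R) A FA).
Qed.

Theorem row_charfun_prod (t : R) (q b m : nat) : (0 < b)%N -> (n <= q * b)%N ->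
  cabs (charfun P (fun w => \sum_(1 <= j < n.+1) Y j w) t -
    \prod_(1 <= j < n.+1) charfun P (Y j) t) <=
  q%:R * (4 * `|t| * (b%:R * ((m + b)%:R * k ^+ 2)) + 4 * alpha m).
Proof.
move=> b0 nqb.
have rowE j : (1 <= j <= n)%N -> row0 j = Y j by rewrite /row0 => ->.
have row00 j : ~~ (1 <= j <= n)%N -> row0 j = cst 0 by rewrite /row0 => /negbTE ->.
have iR j : rintegrable P (row0 j).
  have [hj|/row00->] := boolP (1 <= j <= n)%N; first by rewrite rowE//; exact: iY.
  exact: rintegrable_cst.
have set00 : [set w : T | (0 : R) != 0] = set0.
  by apply/seteqP; split => // w /=; rewrite eqxx.
have pR j : \int[P]_w (\1_[set w' | row0 j w' != 0] w : R) <= k.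
  have [hj|/row00->] := boolP (1 <= j <= n)%N.
    rewrite rowE// Rintegral_indic// -lee_fin probability_fin//.
    exact: probY.
  by rewrite /= set00 Rintegral_indic// measure0.
have eR j : \int[P]_w `|row0 j w| <= k.
  have [hj|/row00->] := boolP (1 <= j <= n)%N; first by rewrite rowE//; exact: meanY.
  by under eq_Rintegral do rewrite /= normr0; rewrite Rintegral_const.
have ppR i j : i <> j ->
    \int[P]_w (`|row0 j w| * \1_[set w' | row0 i w' != 0] w) <= k ^+ 2.
  move=> ij; have [hj|/row00->] := boolP (1 <= j <= n)%N; last first.
    under eq_Rintegral do rewrite /= normr0 mul0r.
    by rewrite Rintegral_const exprn_ge0.
  have [hi|/row00->] := boolP (1 <= i <= n)%N; last first.
    under eq_Rintegral do rewrite /= set00 indic0 mulr0.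
    by rewrite Rintegral_const exprn_ge0.
  by rewrite !rowE//; exact: pairY.
have e0 : 0 <= 4 * alpha m by rewrite mulr_ge0.
have := range_charfun_blocks iR pR eR ppR (@row_mixing t m) q b0 e0.
have -> : minn (q * b) n = n by apply/minn_idPr.
have -> : range_charfun row0 t 1 n.+1 =
    charfun P (fun w => \sum_(1 <= j < n.+1) Y j w) t.
  by rewrite /range_charfun; congr (charfun P _ t); apply/funext => w;
    exact: range_sum_row0.
by rewrite (eq_big_nat _ _ (F2 := fun j => charfun P (Y j) t))// => j hj;
  rewrite rowE.
Qed.

End row.

(** * Characteristic functions and their derivatives *)

Section charfun_derivative.
Context d (T : measurableType d) (R : realType) (P : probability T R).
Variable X : T -> R.
Hypothesis iX : rintegrable P X.

(** The difference quotients are dominated by [|X|], so one may differentiate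
    under the integral. *)
Let derivable_expectation (g dg : R -> R) :
  (forall x : R, is_derive x 1 g (dg x)) -> (forall x, `|g x| <= 1) ->
  (forall x, `|dg x| <= 1) ->
  forall t : R, derivable (fun s : R => \int[P]_w g (s * X w)) t 1.
Proof.
move=> hg g1 dg1 t.
have cg : continuous g.
  move=> x; apply: differentiable_continuous; apply/derivable1_diffP.
  by have [] := hg x.
have mX := rintegrable_measurable iX.
have gd (s : R) w : is_derive s 1 (fun s : R => g (s * X w)) (dg (s * X w) * X w).
  have d1 : is_derive s 1 (fun s : R => s * X w) (X w).
    have := is_deriveZ (X w) (is_derive_id s 1).
    rewrite /GRing.scale /= mulr1; congr is_derive.
    by apply/funext => x /=; rewrite /GRing.scale /= mulrC.
  exact: (@is_derive1_comp _ g (fun s => s * X w) _ _ _ (hg _) d1).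
have tI : `]t - 1, t + 1[%classic t.
  by rewrite /= in_itv/=; apply/andP; split; lra.
apply: (@derivable_under_integral R _ _ P (fun s w => g (s * X w)) setT
  measurableT t _ _ tI _ _ (fun w => `|X w|)).
- move=> s _; apply: (@rintegrable_bounded _ _ _ _ _ 1) => // .
  apply: measurableT_comp (continuous_measurable_fun cg) _.
  exact: measurable_funM.
- by move=> s w _ _; have [] := gd s w.
- by [].
- exact: rintegrable_norm.
- move=> s w _ _; rewrite partial1of2E.
  have [_ ->] := gd s w.
  by rewrite normrM ler_piMl.
Qed.

Lemma derivable_Re_charfun t :
  derivable (fun s : R => complex.Re (charfun P X s)) t 1.
Proof.
under [X in derivable X]eq_fun do rewrite Re_cexpectation.
apply: (derivable_expectation (dg := fun x => - sin x)) => x.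
- exact: cos_max.
- by rewrite normrN sin_max.
Qed.

Lemma derivable_Im_charfun t :
  derivable (fun s : R => complex.Im (charfun P X s)) t 1.
Proof.
under [X in derivable X]eq_fun do rewrite Im_cexpectation.
by apply: (derivable_expectation (dg := cos)) => x;
  [exact: sin_max|exact: cos_max].
Qed.

Lemma cabs_charfunB1 t : cabs (charfun P X t - 1) <= `|t| * \int[P]_w `|X w|.
Proof.
have mX := rintegrable_measurable iX.
rewrite -[X in _ - X](cexpectation_cst P) -cexpectationB.
- rewrite -RintegralZT; last exact: rintegrable_norm.
  apply: cabs_cexpectation_le.
  + apply: (@cintegrable_bounded _ _ _ _ _ 2).
      by apply: cmeasurableB; [exact: cmeasurable_expi|exact: cmeasurable_cst].
    by move=> w; exact: cabs_expiB1_le2.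
  + by move=> w; rewrite -normrM cabs_expiB1_le.
  + by apply: rintegrableZ; exact: rintegrable_norm.
- exact: cintegrable_expi.
- exact: cintegrable_cst.
Qed.

End charfun_derivative.

Lemma charfun0 d (T : measurableType d) (R : realType) (P : probability T R)
  (X : T -> R) : charfun P X 0 = 1.
Proof.
rewrite -[RHS](cexpectation_cst P); apply: eq_cexpectation => w.
by rewrite mul0r expi0.
Qed.

Section derivative_comparison.
Variable R : realType.

Lemma derive1_comparison (f g : R -> R) (c K : R) :
  (forall s : R, derivable f s 1) -> (forall s : R, derivable g s 1) ->
  (forall s, `|derive1 f s - c * derive1 g s| <= K) ->
  forall t, `|(f t - f 0) - c * (g t - g 0)| <= K * `|t|.
Proof.
move=> df dg hK t.
have fD (s : R) : is_derive s 1 f (derive1 f s) by rewrite derive1E; exact: derivableP.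
have gD (s : R) : is_derive s 1 g (derive1 g s) by rewrite derive1E; exact: derivableP.
have hD (s : R) : is_derive s 1 (fun s : R => f s - c * g s) (derive1 f s - c * derive1 g s).
  exact: (is_deriveB (fD s) (is_deriveZ c (gD s))).
have := mean_value_bound hD (fun s (_ : Num.min 0 t <= s <= Num.max 0 t) => hK s).
by rewrite subr0; congr (`|_| <= _); ring.
Qed.

Lemma complex_norm_le (z : R[i]) (K : R) : `|z| <= K%:C -> cabs z <= K.
Proof. by rewrite normc_def lecR -cabsE. Qed.

Lemma cderive_comparison (f g : R -> R[i]) (c K : R) :
  (forall s, cderivable f s) -> (forall s, cderivable g s) ->
  (forall s, `|cderive f s - c%:C * cderive g s| <= K%:C) ->
  forall t, cabs (f t - f 0 - c%:C * (g t - g 0)) <= 2 * K * `|t|.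
Proof.
move=> df dg hK t.
have -> : 2 * K * `|t| = K * `|t| + K * `|t| by ring.
apply: cabs_le_pair.
- rewrite Re_cD Re_cN Re_cM /= mul0r subr0 !Re_cD !Re_cN.
  apply: (@derive1_comparison (fun s => complex.Re (f s))
    (fun s => complex.Re (g s))) => s; [exact: (df s).1|exact: (dg s).1|].
  apply: le_trans (complex_norm_le (hK s)); apply: le_trans (Re_le_cabs _).
  by rewrite Re_cD Re_cN Re_cM /= mul0r subr0.
- rewrite Im_cD Im_cN Im_cM /= mul0r addr0 !Im_cD !Im_cN.
  apply: (@derive1_comparison (fun s => complex.Im (f s))
    (fun s => complex.Im (g s))) => s; [exact: (df s).2|exact: (dg s).2|].
  apply: le_trans (complex_norm_le (hK s)); apply: le_trans (Im_le_cabs _).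
  by rewrite Im_cD Im_cN Im_cM /= mul0r addr0.
Qed.

End derivative_comparison.

Section complex_exponential.
Variable R : realType.
Implicit Types (z w p : R[i]).

Definition complex_exp z : R[i] :=
  (expR (complex.Re z))%:C * expi (complex.Im z).

Lemma cabs_complex_exp z : cabs (complex_exp z) = expR (complex.Re z).
Proof. by rewrite cabsM cabs_expi mulr1 cabs_real ger0_norm// expR_ge0. Qed.

Lemma complex_exp_mulrn (n : nat) z :
  complex_exp (n%:R%:C * z) = complex_exp z ^+ n.
Proof.
rewrite /complex_exp Re_cM Im_cM /= !mul0r subr0 addr0 expRM_natl expi_mulrn.
by rewrite exprMn rmorphXn.
Qed.

Lemma cabs_complex_expB1D z : complex.Re z <= 0 ->
  cabs (complex_exp z - 1 - z) <= 3 * cabs z ^+ 2.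
Proof.
case: z => x y; rewrite [complex.Re _]/= => x0; have e0 := expR_ge0 x.
have e1 : expR x <= 1 by rewrite expR_le1.
have -> : 3 * cabs (x +i* y) ^+ 2 = (y ^+ 2 + x ^+ 2) +
  (y ^+ 2 + (2 * x ^+ 2 + y ^+ 2)) by rewrite sqr_cabs /=; ring.
apply: cabs_le_pair; rewrite ?Re_cD ?Im_cD ?Re_cN ?Im_cN ?Re_cM ?Im_cM /=.
- have -> : expR x * cos y - 0 * sin y - 1 - x =
    expR x * (cos y - 1) + (expR x - 1 - x) by ring.
  rewrite (le_trans (ler_normD _ _))// lerD ?norm_expRB1D_le_sqr//.
  rewrite normrM (ger0_norm e0) (le_trans _ (norm_cosB1_le_sqr y))//.
  by rewrite ler_piMl.
- have -> : expR x * sin y + 0 * cos y - 0 - y =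
    expR x * (sin y - y) + (expR x - 1) * y by ring.
  rewrite (le_trans (ler_normD _ _))// lerD//.
    rewrite normrM (ger0_norm e0) (le_trans _ (norm_sinBid_le_sqr y))//.
    by rewrite ler_piMl.
  rewrite normrM (@le_trans _ _ (`|x| * `|y|))//.
    by rewrite ler_wpM2r// norm_expRB1_le.
  have := sqr_ge0 (`|x| - `|y|); rewrite sqrrB !real_normK ?num_real//.
  have := sqr_ge0 x; have := sqr_ge0 y; lra.
Qed.

(** The error is quadratic in [(mu / n) (p - 1)]; one of the two factors
    [|p - 1|] is bounded by two. *)
Lemma cabs_complex_exp_approx (mu : R) p (n : nat) : 0 <= mu -> cabs p <= 1 ->
  cabs (complex_exp ((mu / n%:R)%:C * (p - 1)) - 1 - (mu / n%:R)%:C * (p - 1))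
  <= 6 * (mu / n%:R) ^+ 2 * cabs (p - 1).
Proof.
move=> mu0 p1; set c := mu / n%:R; have c0 : 0 <= c by rewrite divr_ge0.
apply: le_trans (cabs_complex_expB1D _) _.
  rewrite Re_cM /= mul0r subr0 mulr_ge0_le0// Re_cD Re_cN subr_le0.
  exact: le_trans (ler_norm _) (le_trans (Re_le_cabs _) p1).
rewrite cabsM cabs_real (ger0_norm c0) exprMn.
have h2 : cabs (p - 1) <= 2.
  by rewrite (le_trans (cabsB _ _))// ComplexField.Normc.normc1;
    rewrite -[leRHS]/(1 + 1) lerD2r.
rewrite [cabs (p - 1) ^+ 2]expr2.
have -> : 6 * c ^+ 2 * cabs (p - 1) = 3 * (c ^+ 2 * (2 * cabs (p - 1))) by ring.
by rewrite ler_wpM2l// ler_wpM2l ?exprn_ge0// ler_wpM2r ?cabs_ge0.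
Qed.

(** Each factor agrees with [exp ((mu / n) (p - 1))] up to order [n ^- 2], and
    the [n]-th power of the latter is [exp (mu (p - 1))]; one power of
    [|p - 1|] is kept because it is of order [|t|] in the application. *)
Lemma prod_complex_exp (mu : R) p (f : nat -> R[i]) (n : nat) (K : R) :
  (0 < n)%N -> 0 <= mu -> cabs p <= 1 ->
  (forall j, (1 <= j <= n)%N -> cabs (f j) <= 1) ->
  (forall j, (1 <= j <= n)%N ->
     cabs (f j - 1 - (mu / n%:R)%:C * (p - 1)) <= K / n%:R ^+ 2) ->
  cabs (\prod_(1 <= j < n.+1) f j - complex_exp (mu%:C * (p - 1))) <=
  (K + 6 * mu ^+ 2 * cabs (p - 1)) / n%:R.
Proof.
move=> n0 mu0 p1 f1 hf; have n0' : (n%:R : R) != 0 by rewrite pnatr_eq0 -lt0n.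
set z := (mu / n%:R)%:C * (p - 1).
have z0 : complex.Re z <= 0.
  rewrite Re_cM /= mul0r subr0 mulr_ge0_le0 ?divr_ge0// Re_cD Re_cN subr_le0.
  exact: le_trans (ler_norm _) (le_trans (Re_le_cabs _) p1).
have -> : complex_exp (mu%:C * (p - 1)) = \prod_(0 <= j < n) complex_exp z.
  rewrite prodr_const_nat subn0 -complex_exp_mulrn /z mulrA -rmorphM.
  by rewrite [n%:R * _]mulrC divfK.
rewrite big_add1 /=.
have -> : (K + 6 * mu ^+ 2 * cabs (p - 1)) / n%:R =
    n%:R * (K / n%:R ^+ 2 + 6 * (mu / n%:R) ^+ 2 * cabs (p - 1)) by field.
apply: (@cabs_prodB _ _ (fun j => f j.+1) (fun=> complex_exp z)) => j jn.
- exact: f1.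
- by rewrite cabs_complex_exp expR_le1.
have -> : f j.+1 - complex_exp z = (f j.+1 - 1 - z) - (complex_exp z - 1 - z).
  by ring.
rewrite (le_trans (cabsB _ _))// lerD ?hf//; exact: cabs_complex_exp_approx.
Qed.

End complex_exponential.

(** * The exponential series *)

Section exponential_series.
Variable R : realType.
Implicit Types (p z : R[i]) (s t : R) (f g df dg : R -> R[i]).

Definition is_cderive f df := forall s : R,
  is_derive s 1 (fun s : R => complex.Re (f s)) (complex.Re (df s)) /\
  is_derive s 1 (fun s : R => complex.Im (f s)) (complex.Im (df s)).

Lemma is_cderiveD f g df dg : is_cderive f df -> is_cderive g dg ->
  is_cderive (fun s => f s + g s) (fun s => df s + dg s).
Proof.
move=> hf hg s; have [f1 f2] := hf s; have [g1 g2] := hg s; split.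
- rewrite Re_cD; under [X in is_derive _ _ X]eq_fun do rewrite Re_cD.
  exact: (is_deriveD f1 g1).
- rewrite Im_cD; under [X in is_derive _ _ X]eq_fun do rewrite Im_cD.
  exact: (is_deriveD f2 g2).
Qed.

Lemma is_cderiveM f g df dg : is_cderive f df -> is_cderive g dg ->
  is_cderive (fun s => f s * g s) (fun s => df s * g s + f s * dg s).
Proof.
move=> hf hg s; have [f1 f2] := hf s; have [g1 g2] := hg s; split.
- under [X in is_derive _ _ X]eq_fun do rewrite Re_cM.
  have := is_deriveB (is_deriveM f1 g1) (is_deriveM f2 g2).
  congr is_derive; rewrite Re_cD !Re_cM /GRing.scale /=; ring.
- under [X in is_derive _ _ X]eq_fun do rewrite Im_cM.
  have := is_deriveD (is_deriveM f1 g2) (is_deriveM f2 g1).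
  congr is_derive; rewrite Im_cD !Im_cM /GRing.scale /=; ring.
Qed.

Lemma is_cderive_cst z : is_cderive (fun=> z) (fun=> 0).
Proof. by move=> s; split; exact: is_derive_cst. Qed.

Lemma cderive_bound f df (a b K : R) : is_cderive f df ->
  (forall x, Num.min a b <= x <= Num.max a b -> cabs (df x) <= K) ->
  cabs (f b - f a) <= 2 * K * `|b - a|.
Proof.
move=> hf hK; have -> : 2 * K * `|b - a| = K * `|b - a| + K * `|b - a| by ring.
apply: cabs_le_pair.
- rewrite Re_cD Re_cN; apply: (mean_value_bound (fun s => (hf s).1)) => x /hK.
  exact: le_trans (Re_le_cabs _).
- rewrite Im_cD Im_cN; apply: (mean_value_bound (fun s => (hf s).2)) => x /hK.
  exact: le_trans (Im_le_cabs _).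
Qed.

Definition exp_sum p (N : nat) s : R[i] :=
  \sum_(0 <= k < N) (s ^+ k / k`!%:R)%:C * p ^+ k.

Lemma is_derive_exp_monomial (k : nat) s :
  is_derive s 1 (fun s : R => s ^+ k.+1 / k.+1`!%:R) (s ^+ k / k`!%:R).
Proof.
have := is_deriveZ (k.+1`!%:R^-1) (is_deriveX k.+1 (is_derive_id s 1)).
congr is_derive.
- by apply/funext => x /=; rewrite /GRing.scale /= mulrC fctE.
- rewrite /GRing.scale /= mulr1 factS natrM; field.
  by rewrite nat1r !pnatr_eq0 -lt0n fact_gt0.
Qed.

Lemma is_cderive_exp_sum p (N : nat) :
  is_cderive (exp_sum p N.+1) (fun s => p * exp_sum p N s).
Proof.
elim: N => [|N IH].
  have -> : exp_sum p 1 = fun=> 1.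
    by apply/funext => s; rewrite /exp_sum big_nat1 !expr0 mulr1 divr1.
  have -> : (fun s => p * exp_sum p 0 s) = fun=> 0.
    by apply/funext => s; rewrite /exp_sum big_geq// mulr0.
  exact: is_cderive_cst.
have hm : is_cderive (fun s => (s ^+ N.+1 / N.+1`!%:R)%:C * p ^+ N.+1)
    (fun s => (s ^+ N / N`!%:R)%:C * p ^+ N.+1).
  have h0 : is_cderive (fun s => (s ^+ N.+1 / N.+1`!%:R)%:C)
      (fun s => (s ^+ N / N`!%:R)%:C).
    by move=> s; split; [exact: is_derive_exp_monomial|exact: is_derive_cst].
  have := is_cderiveM h0 (is_cderive_cst (p ^+ N.+1)).
  by congr is_cderive; apply/funext => s; rewrite mulr0 addr0.
have := is_cderiveD IH hm.
congr is_cderive; apply/funext => s; rewrite /exp_sum.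
  by rewrite [RHS]big_nat_recr.
by rewrite [in RHS]big_nat_recr//= mulrDr exprS; congr (_ + _); ring.
Qed.

Lemma is_cderive_complex_exp p :
  is_cderive (fun s => complex_exp (- s%:C * p))
             (fun s => - p * complex_exp (- s%:C * p)).
Proof.
have lin (c s : R) : is_derive s 1 (fun s : R => - s * c) (- c).
  have := is_deriveZ (- c) (is_derive_id s 1).
  rewrite /GRing.scale /= mulr1; congr is_derive.
  by apply/funext => x /=; rewrite /GRing.scale /= mulNr mulrC mulNr.
pose a := complex.Re p; pose b := complex.Im p.
have h1 : is_cderive (fun s => (expR (- s * a))%:C)
    (fun s => (- a)%:C * (expR (- s * a))%:C).
  move=> s; split; rewrite /= ?mul0r ?mulr0 ?subr0 ?addr0.
    rewrite mulrC; exact: (@is_derive1_comp _ expR (fun s => - s * a) _ _ _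
      (is_derive_expR _) (lin a s)).
  exact: is_derive_cst.
have h2 : is_cderive (fun s => expi (- s * b))
    (fun s => (0 +i* (- b)) * expi (- s * b)).
  move=> s; split; rewrite /= ?mul0r ?sub0r ?add0r.
    have := @is_derive1_comp _ cos (fun s => - s * b) _ _ _
      (is_derive_cos _) (lin b s).
    by congr is_derive; ring.
  rewrite mulrC; exact: (@is_derive1_comp _ sin (fun s => - s * b) _ _ _
      (is_derive_sin _) (lin b s)).
have := is_cderiveM h1 h2; congr is_cderive; apply/funext => s.
  by rewrite /complex_exp Re_cM Im_cM /= !oppr0 !mul0r subr0 addr0.
rewrite /complex_exp Re_cM Im_cM /= !oppr0 !mul0r subr0 addr0 -/a -/b.
have -> : - p = (- a)%:C + (0 +i* (- b)).
  by rewrite /a /b; case: (p) => x y; apply: complex_eq;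
    rewrite /= ?addr0 ?add0r.
ring.
Qed.

Lemma complex_expN z : complex_exp (- z) * complex_exp z = 1.
Proof.
rewrite /complex_exp mulrACA -rmorphM -expRD -expiD Re_cN Im_cN !addNr.
by rewrite expR0 expi0 mulr1.
Qed.

(** The partial sums of the exponential series times the inverse exponential
    have a derivative consisting of a single small term, because all other
    terms telescope. *)
Lemma exp_sum_approx p (N : nat) s : cabs p <= 1 -> 0 <= s ->
  cabs (exp_sum p N.+1 s - complex_exp (s%:C * p)) <=
  2 * (s ^+ N / N`!%:R * expR s) * s * expR s.
Proof.
move=> p1 s0; pose E x := complex_exp (- x%:C * p).
pose D x := exp_sum p N.+1 x * E x.
pose dD x := - ((x ^+ N / N`!%:R)%:C * p ^+ N.+1) * E x.
have hD : is_cderive D dD.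
  have := is_cderiveM (is_cderive_exp_sum p N) (is_cderive_complex_exp p).
  congr is_cderive; apply/funext => x; rewrite /dD -/(E x).
  by rewrite [in LHS]/exp_sum [in X in _ + X]big_nat_recr//= exprS; ring.
have Eb (c : R) x : `|c| <= 1 -> 0 <= x <= s -> expR (c * x) <= expR s.
  move=> c1 /andP[x0 xs]; rewrite ler_expR (le_trans _ xs)//.
  by rewrite ler_piMl// (le_trans (ler_norm _)).
have D0 : D 0 = 1.
  rewrite /D; have -> : E 0 = 1.
    by rewrite /E oppr0 mul0r /complex_exp expR0 expi0 mulr1.
  rewrite mulr1 /exp_sum big_nat_recl//= big1 ?addr0; last first.
    by move=> i _; rewrite expr0n/= !mul0r.
  by rewrite !expr0 divr1 mulr1.
have hb : cabs (D s - D 0) <= 2 * (s ^+ N / N`!%:R * expR s) * s.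
  rewrite -[X in _ * X](ger0_norm s0) -[X in `|X|](subr0 s).
  apply: (cderive_bound hD) => x; rewrite min_l// max_r// => hx.
  have /andP[x0 xs] := hx.
  rewrite cabsM cabsN cabsM cabs_real cabsX ger0_norm ?divr_ge0 ?exprn_ge0//.
  apply: ler_pM; rewrite ?cabs_ge0//.
  - by rewrite mulr_ge0 ?divr_ge0 ?exprn_ge0 ?cabs_ge0.
  - apply: (@le_trans _ _ (x ^+ N / N`!%:R)).
      by rewrite ler_piMr ?divr_ge0 ?exprn_ge0// exprn_ile1 ?cabs_ge0.
    by rewrite ler_wpM2r ?invr_ge0// lerXn2r ?nnegrE.
  rewrite cabs_complex_exp; have -> : complex.Re (- x%:C * p) = - complex.Re p * x.
    by rewrite Re_cM Re_cN Im_cN /= oppr0 mul0r subr0 mulNr mulNr mulrC.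
  by rewrite Eb// normrN (le_trans (Re_le_cabs _)).
have -> : exp_sum p N.+1 s - complex_exp (s%:C * p) =
    (D s - D 0) * complex_exp (s%:C * p).
  by rewrite D0 mulrBl mul1r /D /E mulNr -mulrA complex_expN mulr1.
rewrite cabsM ler_pM ?cabs_ge0//.
rewrite cabs_complex_exp Re_cM /= mul0r subr0 mulrC Eb ?s0 ?lexx//.
by rewrite (le_trans (Re_le_cabs _)).
Qed.

Lemma exp_tail_cvg0 s : (s ^+ N / N`!%:R) @[N --> \oo] --> (0 : R).
Proof. exact: (cvg_series_cvg_0 (is_cvg_series_exp_coeff s)). Qed.

End exponential_series.

(** * Sums of independent variables *)

Section independent_sums.
Context d (T : measurableType d) (R : realType) (P : probability T R).
Variables (xi : nat -> {RV P >-> R}) (t : R) (phi : R[i]).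
Hypothesis indep : independent_family P xi.
Hypothesis phiE : forall k, charfun P (xi k) t = phi.

Let bigcap_xi (J : {fset nat}) (A : nat -> set R) : set T :=
  \bigcap_(k in [set` J]) (xi k @^-1` A k).

Let measurable_xi k (B : set R) : measurable B -> measurable (xi k @^-1` B).
Proof. by move=> mB; rewrite -[X in measurable X]setTI; exact: measurable_funP. Qed.

Let measurable_bigcap_xi J A : (forall k, measurable (A k)) ->
  measurable (bigcap_xi J A).
Proof.
move=> mA; apply: fin_bigcap_measurable; first exact: finite_fset.
by move=> k _; exact: measurable_xi.
Qed.

Let bigcap_xiU1 (n : nat) (B : set R) J A : n \notin J ->
  bigcap_xi (n |` J)%fset (fun k => if k == n then B else A k) =
  xi n @^-1` B `&` bigcap_xi J A.
Proof.
move=> nJ; apply/seteqP; split => w.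
- move=> h; split; first by have := h n; rewrite /= eqxx; apply; rewrite /= !inE eqxx.
  move=> k /= kJ; have := h k; rewrite /= ifN; first by apply; rewrite /= !inE kJ orbT.
  by apply: contraNneq nJ => <-.
- move=> [h1 h2] k /=; rewrite !inE => /orP[/eqP ->|kJ]; first by rewrite eqxx.
  by case: ifPn => [/eqP ->//|_]; exact: h2.
Qed.

Let prob_bigcap_xiU1 (n : nat) (B : set R) J A : measurable B ->
  (forall k, measurable (A k)) -> n \notin J ->
  fine (P (xi n @^-1` B `&` bigcap_xi J A)) =
  fine (P (xi n @^-1` B)) * fine (P (bigcap_xi J A)).
Proof.
move=> mB mA nJ; rewrite -bigcap_xiU1// /bigcap_xi.
rewrite indep; last by move=> k; case: ifP.
have f1 : P (xi n @^-1` B) \is a fin_num.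
  by apply: fin_num_measure; exact: measurable_xi.
have f2 : P (\bigcap_(k in [set` J]) (xi k @^-1` A k)) \is a fin_num.
  by apply: fin_num_measure; exact: measurable_bigcap_xi.
rewrite -fineM// indep// big_fsetU1//= eqxx.
congr (fine (_ * _)); apply: eq_big_seq => k kJ; rewrite ifN//.
by apply: contraNneq nJ => <-.
Qed.

Let partial_sum (n : nat) w : R := \sum_(0 <= k < n) xi k w.

Let measurable_partial_sum n : measurable_fun setT (partial_sum n).
Proof. exact: measurable_sum. Qed.

(** Partial sums are peeled off one variable at a time, carrying along an
    arbitrary event depending on the later variables; that event is what the
    decoupling of the next variable needs. *)
Let charfun_partial_sum_event n : forall (J : {fset nat}) A,
  (forall k, measurable (A k)) -> (forall k, k \in J -> (n <= k)%N) ->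
  cexpectation P (fun w =>
    (\1_(bigcap_xi J A) w)%:C * expi (t * partial_sum n w)) =
  (fine (P (bigcap_xi J A)))%:C * phi ^+ n.
Proof.
have iV m E : measurable E -> cintegrable P (fun w =>
    (\1_E w)%:C * expi (t * partial_sum m w)).
  move=> mE; apply: (@cintegrable_bounded _ _ _ _ _ 1).
    by apply: cmeasurableM; [exact: cmeasurable_indic|exact: cmeasurable_expi].
  move=> w; rewrite cabsM cabs_expi mulr1 cabs_real indicE ger0_norm//.
  by case: (_ \in _).
elim: n => [|n IH] J A mA hJ.
  rewrite expr0 mulr1; apply: complex_eq.
    rewrite Re_cexpectation -(Rintegral_indic P (measurable_bigcap_xi J mA)).
    apply: eq_Rintegral => w _.
    by rewrite /partial_sum big_geq// mulr0 expi0 mulr1.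
  rewrite Im_cexpectation -[RHS](Rintegral_const P); apply: eq_Rintegral => w _.
  by rewrite /partial_sum big_geq// mulr0 expi0 mulr1.
have nJ : n \notin J by apply/negP => /hJ; rewrite ltnn.
have hJ' k : k \in J -> (n <= k)%N by move/hJ/ltnW.
have mC := measurable_bigcap_xi J mA; set C := bigcap_xi J A in mC *.
pose V w := (\1_C w)%:C * expi (t * partial_sum n w).
pose U w := expi (t * xi n w).
have EV : cexpectation P V = (fine (P C))%:C * phi ^+ n := IH J A mA hJ'.
set v := (fine (P C))%:C * phi ^+ n in EV.
have iU : cintegrable P U by exact: cintegrable_expi.
have iVn : cintegrable P V := iV n C mC.
have iVv : cintegrable P (fun w => V w - v).
  have := cintegrableD iVn (cintegrable_cst P (- v)); by [].
pose G : set_system T := [set E | exists2 B, measurable B & E = xi n @^-1` B].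
have GU (g : R -> R) : continuous g -> measurable_wrt G (fun w => g (t * xi n w)).
  move=> cg B mB; exists ((fun x => g (t * x)) @^-1` B) => //.
  rewrite -[X in measurable X]setTI.
  have mg : measurable_fun setT (fun x : R => g (t * x)).
    by apply: measurableT_comp (continuous_measurable_fun cg) _; exact: measurable_funM.
  exact: mg.
have hE (E : set T) : G E ->
    cexpectation P (fun w => (\1_E w)%:C * (V w - v)) = 0.
  move=> [B mB ->]; set E0 := xi n @^-1` B.
  have mE : measurable E0 by exact: measurable_xi.
  have mA' k : measurable (if k == n then B else A k) by case: ifP.
  have hJn k : k \in (n |` J)%fset -> (n <= k)%N.
    by rewrite !inE => /orP[/eqP ->//|/hJ'].
  have := IH _ _ mA' hJn; rewrite bigcap_xiU1// prob_bigcap_xiU1// -/E0 -/C.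
  rewrite rmorphM -mulrA -/v => h.
  have -> : cexpectation P (fun w => (\1_E0 w)%:C * (V w - v)) =
      cexpectation P (fun w => (\1_(E0 `&` C) w)%:C * expi (t * partial_sum n w)) -
      v * cexpectation P (fun w => (\1_E0 w)%:C).
    rewrite -cexpectationZ; last first.
      by split; [exact: rintegrable_indic|exact: rintegrable_cst].
    rewrite -cexpectationB.
    - apply: eq_cexpectation => w; rewrite /V indicI rmorphM; ring.
    - by apply: iV; exact: measurableI.
    - apply: cintegrableZ.
      by split; [exact: rintegrable_indic|exact: rintegrable_cst].
  rewrite h; have -> : cexpectation P (fun w => (\1_E0 w)%:C) = (fine (P E0))%:C.
    apply: complex_eq; rewrite ?Re_cexpectation ?Im_cexpectation /=.
      exact: Rintegral_indic.
    exact: Rintegral_const.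
  by rewrite mulrC subrr.
have hcomp (E : set T) : G E ->
    `|\int[P]_w (\1_E w * complex.Re (V w - v))| <= 0 * fine (P E) /\
    `|\int[P]_w (\1_E w * complex.Im (V w - v))| <= 0 * fine (P E).
  move=> /hE h0; rewrite mul0r !normr_le0; split; apply/eqP.
    apply: etrans (congr1 (@complex.Re R) h0); rewrite Re_cexpectation.
    by apply: eq_Rintegral => w _; rewrite Re_cM /= mul0r subr0.
  apply: etrans (congr1 (@complex.Im R) h0); rewrite Im_cexpectation.
  by apply: eq_Rintegral => w _; rewrite Im_cM /= mul0r addr0.
have := @complex_decoupling _ _ _ P G U (fun w => V w - v) 0
  (cmeasurable_expi t (measurable_funPT (xi n)))
  (conj (GU _ (@continuous_cos R)) (GU _ (@continuous_sin R))).
rewrite mulr0 => /(_ _ iVv hcomp) h.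
have {}h : cexpectation P (fun w => U w * (V w - v)) = 0.
  apply: ComplexField.Normc.eq0_normc; apply/eqP; rewrite eq_le cabs_ge0 andbT.
  by apply: h => w; rewrite cabs_expi.
have -> : cexpectation P (fun w => (\1_C w)%:C * expi (t * partial_sum n.+1 w)) =
    cexpectation P (fun w => U w * (V w - v)) + v * cexpectation P U.
  rewrite -cexpectationZ// -cexpectationD.
  - apply: eq_cexpectation => w; rewrite /U /V /partial_sum big_nat_recr//=.
    by rewrite mulrDr expiD; ring.
  - apply: (@cintegrable_bounded _ _ _ _ _ (1 * (1 + cabs v))).
      apply: cmeasurableM; first exact: cmeasurable_expi.
      apply: cmeasurableB; last exact: cmeasurable_cst.
      by apply: cmeasurableM; [exact: cmeasurable_indic|exact: cmeasurable_expi].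
    move=> w; rewrite cabsM cabs_expi !mul1r (le_trans (cabsB _ _))// lerD2r.
    rewrite cabsM cabs_expi mulr1 cabs_real indicE ger0_norm//.
    by case: (_ \in _).
  - exact: cintegrableZ.
by rewrite h add0r [cexpectation P U]phiE /v exprSr mulrA.
Qed.

Lemma charfun_partial_sum n :
  charfun P (fun w => \sum_(k < n) xi k w) t = phi ^+ n.
Proof.
have h0 (k : nat) : k \in (fset0 : {fset nat}) -> (n <= k)%N by rewrite in_fset0.
have := @charfun_partial_sum_event n fset0 (fun=> setT) (fun=> measurableT) h0.
have -> : bigcap_xi fset0 (fun=> setT) = setT.
  by apply/seteqP; split => // w _ k /=.
rewrite probability_setT mul1r => <-; apply: eq_cexpectation => w.
by rewrite indicT mul1r /partial_sum big_mkord.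
Qed.

End independent_sums.

(** * Poisson sums of independent variables *)

Section random_sum.
Context d (T : measurableType d) (R : realType) (P : probability T R).
Variables (N : {RV P >-> nat}) (xi : nat -> {RV P >-> R}).
Variables (t mu : R) (phi : R[i]).
Hypothesis mu_gt0 : 0 < mu.
Hypothesis NE : forall k, P (N @^-1` [set k]) = (poisson_pmf mu k)%:E.
Hypothesis indep : independent_family P xi.
Hypothesis phiE : forall k, charfun P (xi k) t = phi.
Hypothesis indepN : independent_of_family P N xi.

Definition random_sum w : R := \sum_(k < N w) xi k w.

Let measurable_N (B : set nat) : measurable (N @^-1` B).
Proof. by rewrite -[X in measurable X]setTI; exact: measurable_funP. Qed.

Lemma measurable_random_sum : measurable_fun setT random_sum.
Proof.
move=> _ B mB; rewrite setTI.
have -> : random_sum @^-1` B = \bigcup_k (N @^-1` [set k] `&`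
    (fun w => \sum_(0 <= i < k) xi i w) @^-1` B).
  apply/seteqP; split => w.
    by move=> Bw; exists (N w) => //; split => //=; rewrite big_mkord.
  by move=> [k _ [/= Nk]]; rewrite big_mkord /random_sum Nk.
apply: bigcupT_measurable => k; apply: measurableI; first exact: measurable_N.
rewrite -[X in measurable X]setTI.
have mS : measurable_fun setT (fun w => \sum_(0 <= i < k) xi i w).
  exact: measurable_sum.
exact: mS.
Qed.

Let slice (k : nat) w : R[i] := (\1_(N @^-1` [set k]) w)%:C * expi (t * random_sum w).

(** The event [N = k] is independent of the jumps, so decoupling applies with
    error zero. *)
Let charfun_slice k : cexpectation P (slice k) = (poisson_pmf mu k)%:C * phi ^+ k.
Proof.
pose S w := \sum_(i < k) xi i w.
have mS : measurable_fun setT S by exact: measurable_sum.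
pose U w := expi (t * S w).
set q := poisson_pmf mu k; set E0 := N @^-1` [set k].
have mE0 : measurable E0 by exact: measurable_N.
pose V w : R[i] := (\1_E0 w - q)%:C.
have iV : cintegrable P V.
  split; last exact: rintegrable_cst.
  by apply: rintegrableB; [exact: rintegrable_indic|exact: rintegrable_cst].
pose G := sigma_family xi.
have sG : sigma_algebra setT G by exact: smallest_sigma_algebra.
have mG : G `<=` measurable.
  apply: smallest_sub; first exact: sigma_algebra_measurable.
  move=> E [i [B [mB ->]]].
  by rewrite -[X in measurable X]setTI; exact: measurable_funP.
have GS : measurable_wrt G S.
  have -> : S = fun w => \sum_(0 <= i < k) xi i w.
    by apply/funext => w; rewrite big_mkord.
  apply: measurable_wrt_sum => // i _ B mB; apply: sub_sigma_algebra.
  by exists i, B.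
have GU (g : R -> R) : continuous g -> measurable_wrt G (fun w => g (t * S w)).
  move=> cg; apply: (@measurable_wrt_comp _ _ _ _ (fun x => g (t * x))) GS.
  by apply: measurableT_comp (continuous_measurable_fun cg) _; exact: measurable_funM.
have hV E : G E -> `|\int[P]_w (\1_E w * complex.Re (V w))| <= 0 * fine (P E) /\
    `|\int[P]_w (\1_E w * complex.Im (V w))| <= 0 * fine (P E).
  move=> GE; have mE := mG _ GE; rewrite mul0r !normr_le0; split; apply/eqP.
    rewrite /V /=; under eq_Rintegral do rewrite mulrBr -[\1_E _ * q]mulrC.
    rewrite RintegralBT; first last.
    - by apply: rintegrableZ; exact: rintegrable_indic.
    - by apply: rintegrable_indicM => //; exact: rintegrable_indic.
    rewrite RintegralZT; last exact: rintegrable_indic.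
    under eq_Rintegral do rewrite -[\1_E _ * _]/((\1_E \* \1_E0) _) -indicI.
    rewrite !Rintegral_indic//; last exact: measurableI.
    rewrite setIC indepN// NE -/q fineM ?fin_num_measure//.
    by rewrite subrr.
  by rewrite /V /=; under eq_Rintegral do rewrite mulr0; rewrite Rintegral_const.
have := @complex_decoupling _ _ _ P G U V 0 (cmeasurable_expi t mS)
  (conj (GU _ (@continuous_cos R)) (GU _ (@continuous_sin R))).
rewrite mulr0 => /(_ _ iV hV) h.
have {}h : cexpectation P (fun w => U w * V w) = 0.
  apply: ComplexField.Normc.eq0_normc; apply/eqP; rewrite eq_le cabs_ge0 andbT.
  by apply: h => w; rewrite cabs_expi.
have iU : cintegrable P U by exact: cintegrable_expi.
have <- : charfun P S t = phi ^+ k by exact: charfun_partial_sum.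
rewrite -[LHS]subr0 -h -cexpectationZ//.
have -> : cexpectation P (slice k) = cexpectation P (fun w => U w * V w) +
    cexpectation P (fun w => q%:C * U w).
  rewrite -cexpectationD; last exact: cintegrableZ.
    apply: eq_cexpectation => w; rewrite /slice /U /V rmorphB /=.
    rewrite indicE; case: (boolP (w \in N @^-1` [set k])) => [|_].
      by rewrite inE /= /random_sum => ->; rewrite -/(S w); ring.
    by rewrite !mul0r sub0r; ring.
  apply: (@cintegrable_bounded _ _ _ _ _ (1 + `|q|)).
    apply: cmeasurableM; first exact: cmeasurable_expi.
    by split; [exact: rintegrable_measurable iV.1|exact: measurable_cst].
  move=> w; rewrite cabsM cabs_expi mul1r cabs_real (le_trans (ler_normB _ _))//.
  rewrite lerD2r indicE ger0_norm//; by case: (_ \in _).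
by rewrite h add0r subr0.
Qed.

(** Cutting off large values of [N] leaves a partial sum of the exponential
    series, up to the Poisson tail. *)
Let charfun_random_sum_cut (M : nat) :
  cabs (charfun P random_sum t - \sum_(0 <= k < M) (poisson_pmf mu k)%:C * phi ^+ k)
  <= 1 - \sum_(0 <= k < M) poisson_pmf mu k.
Proof.
have islice k : cintegrable P (slice k).
  apply: (@cintegrable_bounded _ _ _ _ _ 1).
    apply: cmeasurableM; first by apply: cmeasurable_indic; exact: measurable_N.
    exact: cmeasurable_expi measurable_random_sum.
  move=> w; rewrite cabsM cabs_expi mulr1 cabs_real indicE ger0_norm//.
  by case: (_ \in _).
pose I w : R := \sum_(0 <= k < M) \1_(N @^-1` [set k]) w.
have I01 w : 0 <= I w <= 1.
  rewrite /I; apply/andP; split; first by rewrite sumr_ge0.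
  have [NM|MN] := ltnP (N w) M.
    rewrite (@big_cat_nat _ _ _ (N w))//= ?(ltnW NM)// big_nat_cond big1 ?add0r.
      rewrite big_ltn//= big_nat_cond big1 ?addr0.
        by rewrite indicE; case: (_ \in _).
      move=> i /andP[/andP[h _] _]; rewrite indicE memNset//=.
      by move=> e; rewrite e ltnn in h.
    move=> i /andP[/andP[_ h] _]; rewrite indicE memNset//=.
    by move=> e; rewrite e ltnn in h.
  rewrite big_nat_cond big1 // => i /andP[/andP[_ h] _]; rewrite indicE memNset//=.
  by move=> e; move: h; rewrite -e ltnNge MN.
have iI : rintegrable P I.
  by apply: rintegrable_sum => k; apply: rintegrable_indic; exact: measurable_N.
have EI : \int[P]_w (1 - I w) = 1 - \sum_(0 <= k < M) poisson_pmf mu k.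
  rewrite RintegralBT//; last exact: rintegrable_cst.
  rewrite Rintegral_const; congr (_ - _); rewrite Rintegral_sum.
    by apply: eq_bigr => k _; rewrite Rintegral_indic// NE.
  by move=> k; apply: rintegrable_indic; exact: measurable_N.
rewrite -EI; under eq_bigr do rewrite -charfun_slice.
rewrite -cexpectation_sum// -cexpectationB; last 2 first.
- exact: cintegrable_expi measurable_random_sum.
- exact: cintegrable_sum.
have sliceE w : expi (t * random_sum w) - \sum_(0 <= k < M) slice k w =
    (1 - I w)%:C * expi (t * random_sum w).
  rewrite /slice -mulr_suml -rmorph_sum /= -/(I w) rmorphB rmorph1; ring.
have mI := rintegrable_measurable iI.
have i1I : rintegrable P (fun w => 1 - I w).
  by apply: rintegrableB => //; exact: rintegrable_cst.
have hb w : cabs ((1 - I w)%:C * expi (t * random_sum w)) <= 1 - I w.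
  rewrite cabsM cabs_expi mulr1 cabs_real ger0_norm// subr_ge0.
  by have /andP[] := I01 w.
rewrite (eq_cexpectation P sliceE); apply: (cabs_cexpectation_le _ hb i1I).
apply: (le_cintegrable _ hb i1I); apply: cmeasurableM.
  by split; [exact: rintegrable_measurable i1I|exact: measurable_cst].
exact: cmeasurable_expi measurable_random_sum.
Qed.

(** Let the cut-off of [N] tend to infinity: the partial sums of the series at
    [phi] converge, and so does the Poisson tail, which is the same estimate
    at [phi = 1]. *)
Lemma charfun_random_sum :
  charfun P random_sum t = complex_exp (mu%:C * (phi - 1)).
Proof.
have p1 : cabs phi <= 1.
  by rewrite -(phiE 0); apply: cabs_charfun_le1; exact: measurable_funPT.
have mu0 := ltW mu_gt0.
have pmfE p M : \sum_(0 <= k < M) (poisson_pmf mu k)%:C * p ^+ k =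
    (expR (- mu))%:C * exp_sum p M mu.
  rewrite /exp_sum mulr_sumr; apply: eq_bigr => k _.
  by rewrite /poisson_pmf mu_gt0 !rmorphM /=; ring.
have pmf1 M : \sum_(0 <= k < M) poisson_pmf mu k =
    expR (- mu) * complex.Re (exp_sum 1 M mu).
  have := congr1 (@complex.Re R) (pmfE 1 M).
  rewrite Re_cM /= mul0r subr0 => <-; rewrite Re_sum; apply: eq_bigr => k _.
  by rewrite expr1n mulr1.
have e1 : expR (- mu) <= 1 by rewrite expR_le1 oppr_le0.
have cexpE : complex_exp (mu%:C * (phi - 1)) =
    (expR (- mu))%:C * complex_exp (mu%:C * phi).
  rewrite /complex_exp !Re_cM !Im_cM Re_cD Im_cD /= !mul0r !subr0 !addr0.
  by rewrite mulrBr mulr1 expRB -expRN rmorphM ?oppr0 ?addr0; ring.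
have key (M : nat) : cabs (charfun P random_sum t - complex_exp (mu%:C * (phi - 1)))
    <= (4 * expR mu * mu * expR mu) * (mu ^+ M / M`!%:R).
  have h1 := charfun_random_sum_cut M.+1; rewrite pmfE pmf1 in h1.
  have h2 := exp_sum_approx M p1 mu0.
  have h3 : cabs (exp_sum 1 M.+1 mu - complex_exp (mu%:C * 1)) <=
      2 * (mu ^+ M / M`!%:R * expR mu) * mu * expR mu.
    by apply: exp_sum_approx => //; rewrite ComplexField.Normc.normc1.
  set B := 2 * _ * _ * _ in h2 h3.
  have -> : 4 * expR mu * mu * expR mu * (mu ^+ M / M`!%:R) = B + B.
    by rewrite /B; ring.
  rewrite cexpE.
  have -> : charfun P random_sum t - (expR (- mu))%:C * complex_exp (mu%:C * phi) =
     (charfun P random_sum t - (expR (- mu))%:C * exp_sum phi M.+1 mu) +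
     (expR (- mu))%:C * (exp_sum phi M.+1 mu - complex_exp (mu%:C * phi)) by ring.
  rewrite (le_trans (cabsD _ _))// lerD//; last first.
    rewrite cabsM cabs_real ger0_norm ?expR_ge0// (le_trans _ h2)//.
    by rewrite ler_piMl ?cabs_ge0.
  rewrite (le_trans h1)//.
  have -> : 1 - expR (- mu) * complex.Re (exp_sum 1 M.+1 mu) =
      expR (- mu) * (expR mu - complex.Re (exp_sum 1 M.+1 mu)).
    by rewrite mulrBr -expRD addNr expR0.
  rewrite (@le_trans _ _ (`|expR mu - complex.Re (exp_sum 1 M.+1 mu)|))//.
    rewrite (le_trans (ler_norm _))// normrM (ger0_norm (expR_ge0 (- mu))).
    by rewrite ler_piMl.
  rewrite distrC (le_trans _ h3)// (le_trans _ (Re_le_cabs _))//.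
  rewrite Re_cD Re_cN mulr1 [complex.Re (complex_exp _)]/=.
  by rewrite sin0 cos0 mulr1 mulr0 subr0.
have {}key : cabs (charfun P random_sum t - complex_exp (mu%:C * (phi - 1))) <= 0.
  have hc : (4 * expR mu * mu * expR mu) * (mu ^+ M / M`!%:R) @[M --> \oo] --> (0 : R).
    rewrite -[X in _ --> X](mulr0 (4 * expR mu * mu * expR mu)).
    by apply: cvgM; [exact: cvg_cst|exact: exp_tail_cvg0].
  apply: (cvgr_to_ge hc).
  by apply: nearW => M; exact: key.
apply/eqP; rewrite -subr_eq0; apply/eqP; apply: ComplexField.Normc.eq0_normc.
by apply/eqP; rewrite eq_le cabs_ge0 key.
Qed.

End random_sum.

(** * Smoothing *)

Section law_transfer.
Variable R : realType.

Lemma expectation_of_law d (T : measurableType d) (P : probability T R)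
    d' (T' : measurableType d') (P' : probability T' R)
    (X : {RV P >-> R}) (X' : T' -> R) (g : R -> R) :
  measurable_fun setT X' ->
  (forall B, measurable B -> distribution P X B = P' (X' @^-1` B)) ->
  measurable_fun setT g -> (forall x, `|g x| <= 1) ->
  \int[P]_w g (X w) = \int[P']_w g (X' w).
Proof.
move=> mX' eqX mg g1.
pose X'' : {mfun T' >-> R} := HB.pack X' (isMeasurableFun.Build _ _ _ _ X' mX').
have mgE : measurable_fun setT (EFin \o g) by exact/measurable_EFinP.
have i1 : rintegrable P (fun w => g (X w)).
  by apply: (@rintegrable_bounded _ _ _ _ _ 1) => //; exact: measurableT_comp.
have i2 : rintegrable P' (fun w => g (X' w)).
  by apply: (@rintegrable_bounded _ _ _ _ _ 1) => //; exact: measurableT_comp.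
rewrite /Rintegral; congr fine.
have <- := @integral_distribution _ _ _ _ _ P X _ mgE i1.
have <- := @integral_distribution _ _ _ _ _ P' X'' _ mgE i2.
by apply: eq_measure_integral => A mA _; exact: eqX.
Qed.

Lemma charfun_compound_poisson (mu : R) (phi : R -> R[i])
    d (T : measurableType d) (P : probability T R) (S : {RV P >-> R}) :
  0 < mu -> compound_poisson mu phi S ->
  forall t, charfun P S t = complex_exp (mu%:C * (phi t - 1)).
Proof.
move=> mu0 [d0 [T0 [P0 [N [xi [hN hxi _ hphi [hind hS]]]]]]] t.
rewrite -(charfun_random_sum mu0 hN hxi (fun k => hphi k t) hind).
have mX0 := measurable_random_sum N xi.
have law (g : R -> R) : continuous g -> (forall x, `|g x| <= 1) ->
    \int[P]_w g (t * S w) = \int[P0]_w g (t * random_sum N xi w).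
  move=> cg g1; apply: (expectation_of_law (g := fun x => g (t * x)) mX0) => //.
  by apply: measurableT_comp (continuous_measurable_fun cg) _; exact: measurable_funM.
apply: complex_eq; rewrite ?Re_cexpectation ?Im_cexpectation.
- exact: (law cos (@continuous_cos R) (@cos_max R)).
- exact: (law sin (@continuous_sin R) (@sin_max R)).
Qed.

End law_transfer.

Section smoothing.
Context (R : realType) d (T : measurableType d) (P : probability T R).
Context d' (T' : measurableType d') (P' : probability T' R).
Variables (X : {RV P >-> R}) (X' : {RV P' >-> R}).
Implicit Types (N i : nat) (x y z a w h s t : R).

Lemma measurable_le_set (x : R) d0 (T0 : measurableType d0)
  (P0 : probability T0 R) (Z : {RV P0 >-> R}) : measurable [set u | Z u <= x].
Proof.
have -> : [set u | Z u <= x] = Z @^-1` `]-oo, x].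
  by apply/seteqP; split => u /=; rewrite in_itv.
by rewrite -[X in measurable X]setTI; exact: measurable_funP.
Qed.

Lemma dfunE (x : R) d0 (T0 : measurableType d0) (P0 : probability T0 R)
  (Z : {RV P0 >-> R}) :
  dfun Z x = \int[P0]_u (\1_[set u | Z u <= x] u : R).
Proof.
rewrite Rintegral_indic /dfun /cdf /distribution /pushforward /=.
  by congr (fine (P0 _)); apply/seteqP; split => u /=; rewrite in_itv.
exact: measurable_le_set.
Qed.

Lemma dfun_ge0 (x : R) d0 (T0 : measurableType d0) (P0 : probability T0 R)
  (Z : {RV P0 >-> R}) : 0 <= dfun Z x.
Proof. by rewrite fine_ge0// cdf_ge0. Qed.

Lemma dfun_mono (x y : R) d0 (T0 : measurableType d0) (P0 : probability T0 R)
  (Z : {RV P0 >-> R}) : x <= y -> dfun Z x <= dfun Z y.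
Proof.
move=> xy; rewrite !dfunE; apply: le_RintegralT => [||u].
- by apply: rintegrable_indic; exact: measurable_le_set.
- by apply: rintegrable_indic; exact: measurable_le_set.
rewrite !indicE ler_nat; case: (boolP (u \in [set u | Z u <= x])) => //.
by rewrite inE /= => Zx; rewrite mem_set//= (le_trans Zx).
Qed.

Lemma dfun_le1 (x : R) d0 (T0 : measurableType d0) (P0 : probability T0 R)
  (Z : {RV P0 >-> R}) : dfun Z x <= 1.
Proof.
rewrite dfunE -[leRHS](Rintegral_const P0); apply: le_RintegralT => [||u].
- by apply: rintegrable_indic; exact: measurable_le_set.
- exact: rintegrable_cst.
by rewrite indicE lern1; case: (_ \in _).
Qed.

(** The increments of the smooth step, as functions of their base point: they
    play the role of the indicator of the interval from [y] to [x]. *)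
Definition smooth_window N w y x s : R :=
  smooth_step N (w * (x - s)) - smooth_step N (w * (y - s)).

Lemma smooth_window_ge0 N w y x s : 0 <= w -> y <= x ->
  0 <= smooth_window N w y x s.
Proof.
move=> w0 yx; rewrite subr_ge0 smooth_step_nondecreasing// ler_wpM2l//.
by rewrite lerD2r.
Qed.

Lemma smooth_window_le N w y x s : 0 <= w -> w * (x - y) <= pi ->
  smooth_window N w y x s <= step_slope R N * pi.
Proof.
move=> w0 xy; rewrite /smooth_window lerBlDl -smooth_stepDpi.
rewrite smooth_step_nondecreasing// -lerBlDl; apply: le_trans xy.
by rewrite le_eqVlt; apply/orP; left; apply/eqP; ring.
Qed.

Lemma smooth_window_inside N w h y x s : 0 <= w -> 0 <= h ->
  w * (x - y) <= pi -> s <= x - h -> y + h <= s ->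
  w * (x - s) <= pi - w * h -> w * (s - y) <= pi - w * h ->
  step_slope R N * pi - cos (w * h) ^+ (2 * N) * pi <= smooth_window N w y x s.
Proof.
move=> w0 h0 xy sx sy h1 h2; have wh0 : 0 <= w * h by rewrite mulr_ge0.
have := @smooth_step_plateau R N (w * h) (w * (x - s)) wh0.
rewrite h1 andbT ler_wpM2l//; last by lra.
move=> /(_ isT); rewrite ler_norml => /andP[+ _].
have := @smooth_step_plateau R N (w * h) (w * (s - y)) wh0.
rewrite h2 andbT ler_wpM2l//; last by lra.
move=> /(_ isT); rewrite ler_norml => /andP[+ _].
rewrite /smooth_window; have -> : w * (y - s) = - (w * (s - y)) by ring.
rewrite smooth_stepN; lra.
Qed.

Lemma smooth_window_outside N w h y x s : 0 <= w -> 0 <= h ->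
  x + h <= s -> y + h <= s -> w * (s - x) <= pi - w * h ->
  w * (s - y) <= pi - w * h ->
  smooth_window N w y x s <= cos (w * h) ^+ (2 * N) * pi.
Proof.
move=> w0 h0 sx sy h1 h2; have wh0 : 0 <= w * h by rewrite mulr_ge0.
have := @smooth_step_plateau R N (w * h) (w * (s - x)) wh0.
rewrite h1 andbT ler_wpM2l//; last by lra.
move=> /(_ isT); rewrite ler_norml => /andP[+ _].
have := @smooth_step_plateau R N (w * h) (w * (s - y)) wh0.
rewrite h2 andbT ler_wpM2l//; last by lra.
move=> /(_ isT); rewrite ler_norml => /andP[_ +].
rewrite /smooth_window; have -> : w * (y - s) = - (w * (s - y)) by ring.
have -> : w * (x - s) = - (w * (s - x)) by ring.
rewrite !smooth_stepN; lra.
Qed.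

(** The sine of [t * (x - X)] is, up to sign, the imaginary part of
    [exp (- i t x) exp (i t X)]. *)
Lemma sin_expectation_diff t x :
  `|\int[P]_u sin (t * (x - X u)) - \int[P']_u sin (t * (x - X' u))| <=
  cabs (charfun P X t - charfun P' X' t).
Proof.
have E d0 (T0 : measurableType d0) (P0 : probability T0 R) (Z : {RV P0 >-> R}) :
    \int[P0]_u sin (t * (x - Z u)) =
    - complex.Im (expi (- (t * x)) * charfun P0 Z t).
  have iZ : cintegrable P0 (fun u => expi (t * Z u)) by exact: cintegrable_expi.
  rewrite -cexpectationZ// Im_cexpectation -mulN1r -RintegralZT.
    apply: eq_Rintegral => u _; rewrite -expiD /= mulN1r -sinN.
    by congr sin; ring.
  by have [] := cintegrableZ (expi (- (t * x))) iZ.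
rewrite !E; set e := expi _.
have -> : - complex.Im (e * charfun P X t) - - complex.Im (e * charfun P' X' t) =
    - complex.Im (e * (charfun P X t - charfun P' X' t)).
  by rewrite mulrBr Im_cD Im_cN; ring.
by rewrite normrN (le_trans (Im_le_cabs _))// cabsM cabs_expi mul1r.
Qed.


Lemma smooth_window_fourier N w y x s : smooth_window N w y x s =
  \sum_(0 <= i < (2 * N).+1) (binomial_weight R N i *
    (if i == N then w * (x - y) else
     (sin (frequency R N i * w * (x - s)) - sin (frequency R N i * w * (y - s))) /
     frequency R N i)).
Proof.
rewrite /smooth_window /smooth_step -sumrB big_mkord; apply: eq_bigr => i _.
rewrite -mulrBr; congr (_ * _); case: ifP => _; first by ring.
by rewrite -mulrBl !mulrA.
Qed.

Lemma rintegrable_sinB (t x : R) d0 (T0 : measurableType d0)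
    (P0 : probability T0 R) (Z : {RV P0 >-> R}) :
  rintegrable P0 (fun u => sin (t * (x - Z u))).
Proof.
apply: (@rintegrable_bounded _ _ _ _ _ 1) => [|u]; last exact: sin_max.
apply: (@measurableT_comp _ _ _ _ _ _ (fun z => sin (t * (x - z)))) => //.
apply: continuous_measurable_fun => z; apply: continuous_comp.
  by apply: cvgM; [exact: cvg_cst|apply: cvgB; [exact: cvg_cst|exact: cvg_id]].
exact: continuous_sin.
Qed.

Lemma smooth_window_expectation N w y x d0 (T0 : measurableType d0)
    (P0 : probability T0 R) (Z : {RV P0 >-> R}) :
  \int[P0]_u smooth_window N w y x (Z u) =
  \sum_(0 <= i < (2 * N).+1) (binomial_weight R N i *
    (if i == N then w * (x - y) else
     (\int[P0]_u sin (frequency R N i * w * (x - Z u)) -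
      \int[P0]_u sin (frequency R N i * w * (y - Z u))) / frequency R N i)).
Proof.
under eq_Rintegral do rewrite smooth_window_fourier.
rewrite Rintegral_sum => [|i].
  apply: eq_bigr => i _; case: (i == N).
    by rewrite Rintegral_const.
  rewrite -RintegralBT; [|exact: rintegrable_sinB..].
  rewrite [RHS]mulrA [RHS]mulrAC -RintegralZT; last first.
    by apply: rintegrableB; exact: rintegrable_sinB.
  by apply: eq_Rintegral => u _; rewrite [LHS]mulrA [LHS]mulrAC.
case: (i == N); first exact: rintegrable_cst.
under [X in rintegrable _ X]eq_fun do rewrite mulrA mulrAC.
by apply: rintegrableZ; apply: rintegrableB; exact: rintegrable_sinB.
Qed.

Lemma rintegrable_smooth_window N w y x d0 (T0 : measurableType d0)
    (P0 : probability T0 R) (Z : {RV P0 >-> R}) :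
  rintegrable P0 (fun u => smooth_window N w y x (Z u)).
Proof.
under [X in rintegrable _ X]eq_fun do rewrite smooth_window_fourier.
apply: rintegrable_sum => i.
case: (i == N); first exact: rintegrable_cst.
under [X in rintegrable _ X]eq_fun do rewrite mulrA mulrAC.
by apply: rintegrableZ; apply: rintegrableB; exact: rintegrable_sinB.
Qed.

(** Only finitely many values of the two characteristic functions enter, each
    divided by its frequency. *)
Lemma smooth_window_expectation_diff N w y x (e eta : R) :
  0 <= e -> 0 <= eta ->
  (forall i, (i < (2 * N).+1)%N -> cabs (charfun P X (frequency R N i * w) -
     charfun P' X' (frequency R N i * w)) <= e * `|frequency R N i| + eta) ->
  `|\int[P]_u smooth_window N w y x (X u) -
    \int[P']_u smooth_window N w y x (X' u)| <= 2 * e + eta.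
Proof.
move=> e0 eta0 hd; rewrite !smooth_window_expectation -sumrB.
rewrite (le_trans (ler_norm_sum _ _ _))//.
have -> : 2 * e + eta =
    \sum_(i < (2 * N).+1) binomial_weight R N i * (2 * e + eta).
  by rewrite -mulr_suml sum_binomial_weight mul1r.
rewrite big_mkord.
apply: ler_sum => i _; rewrite -mulrBr normrM.
rewrite (ger0_norm (binomial_weight_ge0 _ _ _)) ler_wpM2l ?binomial_weight_ge0//.
case: ifPn => [_|iN]; first by rewrite subrr normr0; lra.
have f2 := @norm_frequency_ge2 R N i iN; set f := frequency R N i in f2 *.
have f0 : 0 < `|f| by lra.
rewrite -mulrBl normrM normfV ler_pdivrMr//.
have hx (z : R) := le_trans (sin_expectation_diff (f * w) z) (hd i (ltn_ord i)).
have -> (a b a' b' : R) : a - b - (a' - b') = (a - a') - (b - b') by ring.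
rewrite (le_trans (ler_normB _ _))// (le_trans (lerD (hx x) (hx y)))// -/f.
by nra.
Qed.

(** One side of the comparison of distribution functions.  The base point of
    the window sits at [- 2 * a], the period of the window is [4 * a], and the
    last term is the loss from comparing expectations of the window. *)
Lemma smoothing_one_sided N w h a (e eta : R) x : 0 < a -> 0 <= h <= a ->
  w = pi / (4 * a) -> 0 <= e -> 0 <= eta ->
  (forall i, (i < (2 * N).+1)%N -> cabs (charfun P X (frequency R N i * w) -
     charfun P' X' (frequency R N i * w)) <= e * `|frequency R N i| + eta) ->
  dfun X (x - h) <= dfun X' (x + h) + (dfun X (- a) + (1 - dfun X' a) +
    (2 * cos (w * h) ^+ (2 * N) + (2 * e + eta) / pi) / step_slope R N).
Proof.
move=> a0 /andP[h0 ha] wE e0 eta0 hd.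
have pi0 := pi_gt0 R.
have w0 : 0 <= w by rewrite wE divr_ge0 ?mulr_ge0// ltW.
have wa : w * a = pi / 4 by rewrite wE; field; rewrite gt_eqF.
have wh : w * h <= pi / 4 by rewrite -wa ler_wpM2l.
have wh0 : 0 <= w * h by rewrite mulr_ge0.
have cosh0 : 0 <= cos (w * h) ^+ (2 * N) by rewrite exprM exprn_ge0// sqr_ge0.
have sl0 := step_slope_gt0 R N; set sl := step_slope R N in sl0 *.
set c := cos (w * h) ^+ (2 * N) in cosh0 *.
have err0 : 0 <= (2 * c + (2 * e + eta) / pi) / sl.
  have q0 : 0 <= (2 * e + eta) / pi by apply: divr_ge0; [lra|exact: pi_ge0].
  by apply: divr_ge0; [lra|exact: ltW].
have Xa0 := dfun_ge0 (- a) X; have X'a1 := dfun_le1 a X'.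
have X'x0 := dfun_ge0 (x + h) X'.
have [xa|xa] := ltP x (- a).
  have xha : x - h <= - a by lra.
  by have := dfun_mono X xha; lra.
have [ax|ax] := ltP a x.
  have axh : a <= x + h by lra.
  by have := dfun_mono X' axh; have := dfun_le1 (x - h) X; lra.
(* [H] is 4a-periodic, so all points of [-a, a] lie in one period with [y] *)
pose y := - 2 * a; pose H := smooth_window N w y x.
have wle z : z <= 3 * a -> w * z <= pi - w * h.
  move=> z3; apply: le_trans (ler_wpM2l w0 z3) _.
  by rewrite [3 * a]mulrC mulrA wa; lra.
have wxy : w * (x - y) <= pi.
  by apply: le_trans (wle _ _) _; rewrite /y; lra.
have yx : y <= x by rewrite /y; lra.
have ind01 (b : bool) : 0 <= sl * pi * b%:R.
  by rewrite mulr_ge0// mulr_ge0// ltW.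
have lower s : sl * pi * \1_[set z | z <= x - h] s <=
    H s + (c * pi + sl * pi * \1_[set z | z <= - a] s).
  have H0 : 0 <= H s by exact: smooth_window_ge0.
  have cp : 0 <= c * pi by rewrite mulr_ge0// ltW.
  have sp : 0 <= sl * pi by rewrite mulr_ge0// ltW.
  rewrite !indicE; have [sa|sa] := leP s (- a).
    rewrite [in leRHS]mem_set//=; case: (_ \in _) => /=; lra.
  rewrite [in leRHS]memNset/=; last by apply/negP; rewrite -ltNge.
  have [sx|sx] := leP s (x - h); last first.
    by rewrite memNset/=; [lra|apply/negP; rewrite -ltNge].
  rewrite mem_set//=.
  have := @smooth_window_inside N w h y x s w0 h0 wxy sx.
  rewrite -/sl -/c -/H; have -> : y + h <= s by rewrite /y; lra.
  rewrite !wle; [move=> /(_ isT isT isT); lra|rewrite /y; lra|lra].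
have upper s : H s <= sl * pi * \1_[set z | z <= x + h] s +
    (c * pi + sl * pi * (1 - \1_[set z | z <= a] s)).
  have Hle : H s <= sl * pi by exact: smooth_window_le.
  have cp : 0 <= c * pi by rewrite mulr_ge0// ltW.
  have sp : 0 <= sl * pi by rewrite mulr_ge0// ltW.
  rewrite !indicE; have [sx|sx] := leP s (x + h).
    rewrite mem_set//=; case: (_ \in _) => /=; lra.
  rewrite memNset/=; last by apply/negP; rewrite -ltNge.
  have [sa|sa] := leP s a; last first.
    by rewrite memNset/=; [lra|apply/negP; rewrite -ltNge].
  rewrite mem_set//=.
  have := @smooth_window_outside N w h y x s w0 h0 (ltW sx).
  rewrite -/c -/H; have -> : y + h <= s by rewrite /y; lra.
  rewrite !wle; [move=> /(_ isT isT isT); lra|rewrite /y; lra|lra].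
have indE z d0 (T0 : measurableType d0) (P0 : probability T0 R) (Z : {RV P0 >-> R}) :
    rintegrable P0 (fun u => \1_[set r | r <= z] (Z u) : R) /\
    \int[P0]_u \1_[set r | r <= z] (Z u) = dfun Z z.
  rewrite dfunE; split; last by apply: eq_Rintegral => u _; rewrite !indicE.
  exact: (rintegrable_indic P0 (measurable_le_set z Z)).
have [i1 e1] := indE (x - h) _ _ _ X; have [i2 e2] := indE (- a) _ _ _ X.
have [i3 e3] := indE (x + h) _ _ _ X'; have [i4 e4] := indE a _ _ _ X'.
have iH := rintegrable_smooth_window N w y x X.
have iH' := rintegrable_smooth_window N w y x X'.
have icst d0 (T0 : measurableType d0) (P0 : probability T0 R) z :
  rintegrable P0 (fun=> z) := rintegrable_cst P0 z.
have h1 : sl * pi * dfun X (x - h) <=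
    \int[P]_u H (X u) + (c * pi + sl * pi * dfun X (- a)).
  have iA := rintegrableZ (sl * pi) i2.
  have iB := rintegrableD (icst _ _ P (c * pi)) iA.
  have iC := rintegrableD iH iB; have iD := rintegrableZ (sl * pi) i1.
  rewrite -e1 -e2 -(RintegralZT _ i1) -(RintegralZT _ i2).
  rewrite -(Rintegral_const P (c * pi)) -(RintegralDT (icst _ _ P _) iA).
  by rewrite -(RintegralDT iH iB) le_RintegralT.
have h2 : \int[P']_u H (X' u) <= sl * pi * dfun X' (x + h) +
    (c * pi + sl * pi * (1 - dfun X' a)).
  have i5 : rintegrable P' (fun u => 1 - \1_[set r | r <= a] (X' u)).
    exact: rintegrableB.
  have iA := rintegrableZ (sl * pi) i5.
  have iB := rintegrableD (icst _ _ P' (c * pi)) iA.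
  have iD := rintegrableZ (sl * pi) i3; have iC := rintegrableD iD iB.
  rewrite -e3 -e4 -[X in X - _](Rintegral_const P' 1).
  rewrite -(RintegralBT (icst _ _ P' 1) i4).
  rewrite -(RintegralZT _ i3) -(RintegralZT _ i5).
  rewrite -(Rintegral_const P' (c * pi)) -(RintegralDT (icst _ _ P' _) iA).
  by rewrite -(RintegralDT iD iB) le_RintegralT.
have h3 := smooth_window_expectation_diff y x e0 eta0 hd.
have {h3} h3 : \int[P]_u H (X u) <= \int[P']_u H (X' u) + (2 * e + eta).
  by move: h3; rewrite ler_norml => /andP[_]; rewrite lerBlDl.
have sp : 0 < sl * pi by rewrite mulr_gt0.
rewrite -(ler_pM2l sp).
have -> : sl * pi * (dfun X' (x + h) + (dfun X (- a) + (1 - dfun X' a) +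
    (2 * c + (2 * e + eta) / pi) / sl)) =
  sl * pi * dfun X' (x + h) + (c * pi + sl * pi * (1 - dfun X' a)) +
  (2 * e + eta) + (c * pi + sl * pi * dfun X (- a)).
  move: (lt0r_neq0 pi0) (lt0r_neq0 sl0); move: (pi : R) => p p0 s0.
  by field; rewrite p0 s0.
by lra.
Qed.

End smoothing.

(** * Two-sided smoothing and tails *)

Section smoothing_two_sided.
Context (R : realType) d (T : measurableType d) (P : probability T R).
Context d' (T' : measurableType d') (P' : probability T' R).
Variables (X : {RV P >-> R}) (X' : {RV P' >-> R}).

(** Use [cos ^ 2 = 1 - sin ^ 2 <= exp (- sin ^ 2)] and the lower bound on the
    mean of the bump. *)
Lemma step_tail_le (N : nat) (u : R) : (0 < N)%N ->
  cos u ^+ (2 * N) / step_slope R N <=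
  2 * Num.sqrt N%:R * expR (- (N%:R * sin u ^+ 2)).
Proof.
move=> N0; have sl := step_slope_ge R N0; have sl0 := step_slope_gt0 R N.
have s0 : 0 < Num.sqrt N%:R :> R by rewrite sqrtr_gt0 ltr0n.
have cu : cos u ^+ (2 * N) <= expR (- (N%:R * sin u ^+ 2)).
  rewrite exprM -mulrN expRM_natl lerXn2r ?nnegrE ?expR_ge0 ?sqr_ge0//.
  by rewrite cos2sin2; exact: expR_ge1Dx.
rewrite ler_pdivrMr// mulrAC [leRHS]mulrC.
by apply: le_trans cu _; rewrite ler_peMr ?expR_ge0.
Qed.

Lemma smoothing (N : nat) (w h a e eta tX tX' : R) : (0 < N)%N ->
  0 < a -> 0 <= h <= a -> w = pi / (4 * a) -> 0 <= e -> 0 <= eta ->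
  (forall i, (i < (2 * N).+1)%N -> cabs (charfun P X (frequency R N i * w) -
     charfun P' X' (frequency R N i * w)) <= e * `|frequency R N i| + eta) ->
  dfun X (- a) <= tX -> 1 - dfun X a <= tX ->
  dfun X' (- a) <= tX' -> 1 - dfun X' a <= tX' ->
  let E := tX + tX' + 2 * Num.sqrt N%:R *
     (2 * expR (- (N%:R * sin (w * h) ^+ 2)) + (e + eta)) in
  forall x, dfun X (x - 2 * h) - E <= dfun X' x /\
    dfun X' x <= dfun X (x + 2 * h) + E.
Proof.
move=> N0 a0 ha wE e0 eta0 hd t1 t2 t3 t4 E x.
have sl := step_slope_ge R N0; have sl0 := step_slope_gt0 R N.
have s0 : 0 < Num.sqrt N%:R :> R by rewrite sqrtr_gt0 ltr0n.
have hE : (2 * cos (w * h) ^+ (2 * N) + (2 * e + eta) / pi) / step_slope R N <=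
    2 * Num.sqrt N%:R * (2 * expR (- (N%:R * sin (w * h) ^+ 2)) + (e + eta)).
  rewrite mulrDl [leRHS]mulrDr; apply: lerD.
    rewrite -mulrA [leRHS]mulrCA ler_wpM2l//.
    by rewrite (le_trans (step_tail_le _ N0)).
  have q : (2 * e + eta) / pi <= e + eta.
    rewrite ler_pdivrMr ?pi_gt0//; have := pi_ge2 R; nra.
  have slV : (step_slope R N)^-1 <= 2 * Num.sqrt N%:R.
    by rewrite -div1r ler_pdivrMr.
  rewrite mulrC ler_pM//; first by rewrite invr_ge0 ltW.
  by rewrite divr_ge0 ?pi_ge0//; lra.
have hd' i : (i < (2 * N).+1)%N -> cabs (charfun P' X' (frequency R N i * w) -
     charfun P X (frequency R N i * w)) <= e * `|frequency R N i| + eta.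
  by move=> hi; rewrite -cabsN opprB; exact: hd.
split.
- have := smoothing_one_sided (x - h) a0 ha wE e0 eta0 hd.
  have -> : x - h - h = x - 2 * h by ring.
  have -> : x - h + h = x by ring.
  rewrite /E; lra.
- have := smoothing_one_sided (x + h) a0 ha wE e0 eta0 hd'.
  have -> : x + h + h = x + 2 * h by ring.
  have -> : x + h - h = x by ring.
  rewrite /E; lra.
Qed.

End smoothing_two_sided.

Section distribution_tails.
Context (R : realType) d (T : measurableType d) (P : probability T R).
Variable X : {RV P >-> R}.

Lemma dfun_tail_markov (C a : R) : rintegrable P X -> \int[P]_w `|X w| <= C ->
  0 < a -> dfun X (- a) <= C / a /\ 1 - dfun X a <= C / a.
Proof.
move=> iX EC a0; have iaX := rintegrableZ a^-1 (rintegrable_norm iX).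
have hb : \int[P]_w (a^-1 * `|X w|) <= C / a.
  rewrite RintegralZT; last exact: rintegrable_norm.
  by rewrite mulrC ler_wpM2r// invr_ge0 ltW.
have iI z : rintegrable P (\1_[set u | X u <= z] : T -> R).
  by apply: rintegrable_indic; exact: measurable_le_set.
split; rewrite dfunE.
- apply: le_trans hb; apply: le_RintegralT => // w.
  rewrite indicE; have [Xa|Xa] := leP (X w) (- a).
    by rewrite mem_set//= mulrC ler_pdivlMr// mul1r ler_normr; apply/orP; right; lra.
  rewrite memNset/=; last by apply/negP; rewrite -ltNge.
  by rewrite mulr_ge0// invr_ge0 ltW.
- apply: le_trans hb; rewrite -[X in X - _](Rintegral_const P 1) -RintegralBT//;
    last exact: rintegrable_cst.
  apply: le_RintegralT => //; first by apply: rintegrableB => //; exact: rintegrable_cst.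
  move=> w; rewrite indicE; have [Xa|Xa] := leP (X w) a.
    by rewrite mem_set//= subrr mulr_ge0// invr_ge0 ltW.
  rewrite memNset/=; last by apply/negP; rewrite -ltNge.
  by rewrite subr0 mulrC ler_pdivlMr// mul1r (le_trans (ltW Xa))// ler_norm.
Qed.

Lemma dfun_tail_cvg0 (e : R) : 0 < e ->
  exists a0 : R, forall a, a0 <= a -> dfun X (- a) <= e /\ 1 - dfun X a <= e.
Proof.
move=> e0.
have c1 : dfun X x @[x --> -oo] --> (0 : R) by exact: fine_cvg (cvg_cdfNy0 X).
have c2 : dfun X x @[x --> +oo] --> (1 : R) by exact: fine_cvg (cvg_cdfy1 X).
have /cvgrPdist_le/(_ _ e0)[M1 [_ h1]] := c1.
have /cvgrPdist_le/(_ _ e0)[M2 [_ h2]] := c2.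
exists (Num.max (1 - M1) (M2 + 1)) => a; rewrite ge_max => /andP[a1 a2].
split.
- have := h1 (- a); rewrite sub0r normrN => /(_ ltac:(lra)).
  exact: le_trans (ler_norm _).
- have := h2 a; move=> /(_ ltac:(lra)); exact: le_trans (ler_norm _).
Qed.

End distribution_tails.

(** * From characteristic functions to distribution functions *)

Section limit_theorem.
Context (R : realType) d (T : measurableType d) (P : probability T R).
Context d' (T' : measurableType d') (P' : probability T' R).
Variables (X : nat -> {RV P >-> R}) (S : {RV P' >-> R}).
Variables (C D : R) (alpha : nat -> R).
Hypothesis C_gt0 : 0 < C.
Hypothesis D_ge0 : 0 <= D.
Hypothesis alpha_ge0 : forall k, 0 <= alpha k.
Hypothesis alpha_cvg0 : alpha k @[k --> \oo] --> (0 : R).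
Hypothesis iX : forall n, (0 < n)%N -> rintegrable P (X n).
Hypothesis EX : forall n, (0 < n)%N -> \int[P]_w `|X n w| <= C.
Hypothesis charfun_close : forall (n : nat) (t : R) (q b m : nat),
  (0 < n)%N -> (0 < b)%N -> (n <= q * b)%N ->
  cabs (charfun P (X n) t - charfun P' S t) <=
  q%:R * (4 * `|t| * (b%:R * ((m + b)%:R * (C / n%:R) ^+ 2)) + 4 * alpha m) +
  D * `|t| / n%:R.

Let exists_nat_ge (x : R) : exists n : nat, (0 < n)%N /\ x <= n%:R.
Proof.
exists (Num.truncn `|x|).+1; split => //; apply: (le_trans (ler_norm x)).
by have /andP[_ /ltW] := truncn_itv (normr_ge0 x).
Qed.

(** A fixed number [K] of blocks makes the error from pairs inside a block of
    order [1 / K]; then the gap length [m] makes [K] mixing errors small, and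
    finally [n] makes the gaps negligible. *)
Let charfun_sum_uniform (t0 e : R) : 0 <= t0 -> 0 < e ->
  exists n0 : nat, forall n t, (n0 <= n)%N -> `|t| <= t0 ->
  cabs (charfun P (X n) t - charfun P' S t) <= e.
Proof.
move=> t00 e0.
have [K [K0 hK]] := exists_nat_ge (64 * t0 * C ^+ 2 / e).
have K0' : 0 < K%:R :> R by rewrite ltr0n.
have [m hm] : exists m, 16 * K%:R * alpha m <= e.
  have e1 : 0 < e / (16 * K%:R) by rewrite divr_gt0// mulr_gt0.
  have /cvgrPdist_le/(_ _ e1)[m _ h] := alpha_cvg0; exists m.
  have := h m (leqnn m); rewrite sub0r normrN ger0_norm//.
  by rewrite ler_pdivlMr ?mulr_gt0// mulrC.
have [n1 [n10 hn1]] := exists_nat_ge (32 * t0 * C ^+ 2 * m%:R / e).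
have [n2 [n20 hn2]] := exists_nat_ge (4 * D * t0 / e).
exists (maxn K (maxn n1 n2)) => n t; rewrite !geq_max => /andP[Kn /andP[n1n n2n]] ht.
have n0 : (0 < n)%N by exact: leq_trans n10 n1n.
have n0' : 0 < n%:R :> R by rewrite ltr0n.
pose b := (n %/ K).+1.
have nKb : (n <= K * b)%N by rewrite mulnC; apply/ltnW/ltn_ceil.
have hb : K%:R * b%:R <= 2 * n%:R :> R.
  rewrite -!natrM ler_nat /b mulnS mul2n -addnn leq_add//.
  by rewrite mulnC leq_trunc_div.
apply: le_trans (charfun_close t m n0 (ltn0Sn _) nKb) _; rewrite -/b.
have t0' : 0 <= `|t| by [].
have m0 : 0 <= m%:R :> R by []. have b0 : 0 <= b%:R :> R by [].
have C2 : 0 < C ^+ 2 by rewrite exprn_gt0.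
rewrite ler_pdivrMr// in hK; rewrite ler_pdivrMr// in hn1.
rewrite ler_pdivrMr// in hn2.
have n1r : n1%:R <= n%:R :> R by rewrite ler_nat.
have n2r : n2%:R <= n%:R :> R by rewrite ler_nat.
have h1 : K%:R * (4 * `|t| * (b%:R * ((m + b)%:R * (C / n%:R) ^+ 2))) <=
    e / 4 + e / 4.
  have tC0 : 0 <= `|t| * C ^+ 2 by rewrite mulr_ge0// ltW.
  have tC : `|t| * C ^+ 2 <= t0 * C ^+ 2 by rewrite ler_wpM2r// ltW.
  have step1 : K%:R * (4 * `|t| * (b%:R * ((m + b)%:R * (C / n%:R) ^+ 2))) =
      4 * (`|t| * C ^+ 2) * (K%:R * b%:R) * (m%:R + b%:R) / n%:R ^+ 2.
    by rewrite natrD; field; rewrite lt0r_neq0.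
  rewrite step1 ler_pdivrMr ?exprn_gt0//.
  have b2 : b%:R <= 2 * n%:R / K%:R :> R by rewrite ler_pdivlMr// mulrC.
  have s2 : (`|t| * C ^+ 2) * (K%:R * b%:R) <= (t0 * C ^+ 2) * (2 * n%:R).
    by apply: ler_pM => //; rewrite mulr_ge0.
  have s3 : 4 * (t0 * C ^+ 2) * 2 * m%:R <= e / 4 * n%:R.
    by have := ler_wpM2r (ltW e0) n1r; lra.
  have s4 : 4 * (t0 * C ^+ 2) * 2 * b%:R <= e / 4 * n%:R.
    apply: (@le_trans _ _ (4 * (t0 * C ^+ 2) * 2 * (2 * n%:R / K%:R))).
      by rewrite ler_wpM2l// !mulr_ge0// ltW.
    have -> : 4 * (t0 * C ^+ 2) * 2 * (2 * n%:R / K%:R) =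
      16 * (t0 * C ^+ 2) * n%:R / K%:R by ring.
    by rewrite ler_pdivrMr//; have := ler_wpM2r (ltW n0') hK; lra.
  have s5 : 0 <= m%:R + b%:R :> R by rewrite addr_ge0.
  have := ler_wpM2r s5 s2; have := ler_wpM2r (ltW n0') s3.
  have := ler_wpM2r (ltW n0') s4.
  rewrite expr2; lra.
have h2 : K%:R * (4 * alpha m) <= e / 4 by lra.
have h3 : D * `|t| / n%:R <= e / 4.
  rewrite ler_pdivrMr//; have := ler_wpM2l D_ge0 ht.
  have := ler_wpM2r (ltW e0) n2r; lra.
by rewrite mulrDr; lra.
Qed.

(** Fix the period and the degree of the smoothing polynomial first: its
    finitely many frequencies are bounded, so uniform convergence on a bounded
    interval is enough. *)
Let levy_close (e : R) : 0 < e -> exists n0 : nat, forall n, (n0 <= n)%N ->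
  forall x, dfun (X n) (x - e) - e <= dfun S x /\
            dfun S x <= dfun (X n) (x + e) + e.
Proof.
move=> e0; have e8 : 0 < e / 8 by lra.
have [a0 ha0] := dfun_tail_cvg0 S e8.
pose a := Num.max (Num.max a0 1) (Num.max e (8 * C / e)).
have [a0a [a1 [ea Ca]]] : a0 <= a /\ (1 <= a /\ (e <= a /\ 8 * C / e <= a)).
  by rewrite /a !le_max !lexx !orbT.
have ag0 : 0 < a by lra.
have {ha0} [tS1 tS2] := ha0 a a0a.
have pi0 := pi_gt0 R; have pi2 := pihalf_lt2 R.
pose w := pi / (4 * a); pose h := e / 2.
have w0 : 0 < w by rewrite divr_gt0// mulr_gt0.
have ha : 0 <= h <= a by rewrite /h; apply/andP; split; lra.
have y0 : 0 < sin (w * h) ^+ 2.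
  have wh0 : 0 < w * h by rewrite mulr_gt0// divr_gt0.
  have wh4 : w * h <= pi / 4.
    have <- : w * a = pi / 4 by rewrite /w; field; rewrite lt0r_neq0.
    by rewrite ler_wpM2l ?(ltW w0)//; case/andP: ha.
  by rewrite exprn_gt0// sin_gt0_pihalf// wh0 /=; lra.
set y := sin (w * h) ^+ 2 in y0.
have [N [N0 hN]] := exists_nat_ge (32 / (e * y ^+ 2)).
have Nr : 0 < N%:R :> R by rewrite ltr0n.
have N1 : 1 <= N%:R :> R by rewrite ler1n.
have s0 : 0 < Num.sqrt N%:R :> R by rewrite sqrtr_gt0.
have sN : Num.sqrt N%:R <= N%:R :> R.
  have s1 : 1 <= Num.sqrt N%:R :> R by rewrite -{1}(sqrtr1 R) ler_wsqrtr.
  by rewrite -[leRHS](sqr_sqrtr (ltW Nr)) expr2 ler_peMl// ltW.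
pose eta := e / (8 * Num.sqrt N%:R).
have eta0 : 0 < eta by rewrite divr_gt0// mulr_gt0.
have t00 : 0 <= 2 * N%:R * w by apply: mulr_ge0; [lra|exact: ltW].
have [n0 hn0] := charfun_sum_uniform t00 eta0.
exists n0.+1 => n n0n x.
have ngt0 : (0 < n)%N by exact: leq_ltn_trans n0n.
have hd i : (i < (2 * N).+1)%N -> cabs (charfun P (X n) (frequency R N i * w) -
     charfun P' S (frequency R N i * w)) <= 0 * `|frequency R N i| + eta.
  move=> hi; rewrite mul0r add0r; apply: hn0; first exact: ltnW.
  rewrite normrM (ger0_norm (ltW w0)) ler_wpM2r ?(ltW w0)//.
  rewrite normrM (ger0_norm (ler0n R 2)) mulrC ler_wpM2l// ler_norml.
  have : (i%:R : R) <= 2 * N%:R by rewrite -natrM ler_nat -ltnS.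
  have : 0 <= (i%:R : R) by []. move=> i0 i1; apply/andP; split; lra.
have [tX1 tX2] := dfun_tail_markov (iX ngt0) (EX ngt0) ag0.
have tX : C / a <= e / 8.
  by move: Ca; rewrite !ler_pdivrMr// => Ca; lra.
have := @smoothing _ _ _ P _ _ P' (X n) S N w h a 0 eta _ _ N0 ag0 ha erefl
  (lexx 0) (ltW eta0) hd tX1 tX2 tS1 tS2 x.
rewrite -/y add0r /h (_ : 2 * (e / 2) = e); last by field.
have hE : 2 * Num.sqrt N%:R * (2 * expR (- (N%:R * y)) + eta) <= e / 4 + e / 4.
  rewrite mulrDr; apply: lerD; last first.
    rewrite /eta le_eqVlt; apply/orP; left; apply/eqP; field.
    by rewrite lt0r_neq0.
  have Ny : 0 < N%:R * y by rewrite mulr_gt0.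
  have hexp : (N%:R * y) ^+ 2 / 2 <= expR (N%:R * y).
    by have := expR_ge1Dxn 1 (ltW Ny); rewrite !factS fact0 muln1; lra.
  rewrite expRN; have -> : 2 * Num.sqrt N%:R * (2 * (expR (N%:R * y))^-1) =
    4 * Num.sqrt N%:R / expR (N%:R * y) by ring.
  rewrite ler_pdivrMr ?expR_gt0//.
  apply: (@le_trans _ _ (e / 4 * ((N%:R * y) ^+ 2 / 2))); last first.
    by rewrite ler_wpM2l//; lra.
  apply: (@le_trans _ _ (4 * N%:R)); first by rewrite ler_wpM2l.
  have ey : 0 < e * y ^+ 2 by apply: mulr_gt0 => //; apply: exprn_gt0.
  rewrite (ler_pdivrMr _ _ ey) in hN.
  have -> : e / 4 * ((N%:R * y) ^+ 2 / 2) = N%:R * (e * y ^+ 2) * N%:R / 8 by field.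
  by have := ler_wpM2r (ltW Nr) hN; lra.
by move=> [g1 g2]; split; lra.
Qed.

Lemma cvg_in_distribution_of_charfun : cvg_in_distribution X S.
Proof.
move=> x cx; apply/cvgrPdist_le => e e0.
have e2 : 0 < e / 2 by lra.
have /cvgrPdist_le/(_ _ e2) := cx; rewrite near_simpl /=.
move=> /nbhs_ballP[r /= r0 hr].
pose h := Num.min (e / 2) (r / 2).
have [h0 he hr2] : [/\ 0 < h, h <= e / 2 & h <= r / 2].
  split; first by rewrite lt_min; apply/andP; split; lra.
  - by rewrite ge_min lexx.
  - by rewrite ge_min lexx orbT.
have [n0 hn0] := levy_close h0.
exists n0 => // n /= n0n.
have [_ g1] := hn0 n n0n (x - h); have [g2 _] := hn0 n n0n (x + h).
rewrite subrK in g1; rewrite addrK in g2.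
have := hr (x - h); rewrite /ball /= opprB addrC subrK ger0_norm ?(ltW h0)//.
move=> /(_ ltac:(lra)); rewrite ler_norml => /andP[k1 k2].
have := hr (x + h); rewrite /ball /= opprD addNKr normrN ger0_norm ?(ltW h0)//.
move=> /(_ ltac:(lra)); rewrite ler_norml => /andP[k3 k4].
by rewrite ler_norml; apply/andP; split; lra.
Qed.

(** A first moment of the limit is not at hand, so its tails are controlled by
    those of the sums, through the closeness of distribution functions. *)
Let dfun_limit_tail a : 0 < a ->
  dfun S (- a) <= (2 * C + 1) / a /\ 1 - dfun S a <= (2 * C + 1) / a.
Proof.
move=> a0; pose h := Num.min (a / 2) a^-1.
have aV : 0 < a^-1 by rewrite invr_gt0.
have [h0 ha hV] : [/\ 0 < h, h <= a / 2 & h <= a^-1].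
  split; first by rewrite lt_min; apply/andP; split; lra.
  - by rewrite ge_min lexx.
  - by rewrite ge_min lexx orbT.
have [n0 hn0] := levy_close h0.
have ah : 0 < a - h by lra.
have [t1 t2] := dfun_tail_markov (iX (ltn0Sn n0)) (EX (ltn0Sn n0)) ah.
have Cah : C / (a - h) <= 2 * C / a.
  rewrite ler_pdivrMr// mulrAC ler_pdivlMr//.
  have := ler_wpM2l (ltW C_gt0) ha; lra.
have [_ g1] := hn0 n0.+1 (leqnSn _) (- a).
have [g2 _] := hn0 n0.+1 (leqnSn _) a.
rewrite mulrDl mul1r; rewrite opprB in t1.
rewrite [- a + h]addrC in g1.
by split; lra.
Qed.


Lemma levy_distance_le (F G : R -> R) (h : R) : 0 < h ->
  (forall x, G (x - h) - h <= F x /\ F x <= G (x + h) + h) ->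
  levy_distance G F <= h.
Proof.
move=> h0 hh; apply: ge_inf; last by split.
by exists 0 => y [y0 _]; exact: ltW.
Qed.

(** With geometric mixing a gap of length proportional to [ln n] makes the
    covariances negligible, so the characteristic functions differ by a
    multiple of [|t| * ln n / n].  Smoothing at scale [ln n / sqrt n] turns
    this into the stated distance; the period of the smoothing kernel is of
    order [sqrt n] because the tails beyond are of order [1 / sqrt n]. *)
Lemma levy_distance_rate (r C3 : R) : 0 < r < 1 -> 0 < C3 ->
  (forall k, alpha k <= C3 * r ^+ k) ->
  exists2 K : R, 0 < K & \forall n \near \oo,
    levy_distance (dfun (X n)) (dfun S) <= K * (n%:R `^ (- 2^-1)) * ln n%:R.
Proof.
move=> /andP[r0 r1] C30 halpha; pose l := - ln r; have Cgt0 := C_gt0.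
have l0 : 0 < l by rewrite oppr_gt0 ln_lt0// r0.
pose C5 := 4 * C ^+ 2 * (3 / l + 2) + D.
have l3 : 0 < 3 / l by rewrite divr_gt0.
have CC : 0 < C ^+ 2 by rewrite exprn_gt0.
have C50 : 0 <= C5.
  have c1 : 0 <= 4 * C ^+ 2 by rewrite mulr_ge0// ltW.
  have c2 : 0 <= 3 / l + 2 by rewrite addr_ge0// ltW.
  by apply: addr_ge0 => //; exact: mulr_ge0.
exists (3 * C + 7 + 2 * C5 + 8 * C3).
  by lra.
have [n0 [n00 hn0]] := exists_nat_ge (expR 32).
exists n0 => // n /= n0n.
pose x : R := n%:R; pose L := ln x; pose s := Num.sqrt x.
have nx : expR 32 <= x by rewrite (le_trans hn0)// ler_nat.
have x0 : 0 < x by exact: lt_le_trans (expR_gt0 _) nx.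
have ngt0 : (0 < n)%N by rewrite -(ltr0n R).
have expL : expR L = x by exact: lnK.
have L32 : 32 <= L by rewrite -ler_expR expL.
have s0 : 0 < s by rewrite sqrtr_gt0.
have ss : s * s = x by rewrite -expr2 sqr_sqrtr// ltW.
have xL : 16 * L <= x.
  have L0 : 0 <= L by lra.
  have := expR_ge1Dxn 1 L0; rewrite expL !factS fact0 muln1.
  have := ler_wpM2r L0 L32; rewrite -expr2; lra.
have s1 : 1 <= s by rewrite -(sqrtr1 R) ler_wsqrtr//; lra.
have pi2 := pi_ge2 R; have pi4 := pihalf_lt2 R.
pose w := pi / (4 * s); pose h := L / s.
have w0 : 0 < w by rewrite divr_gt0 ?mulr_gt0//; lra.
have ws : w <= s^-1.
  by rewrite /w invfM mulrA ler_piMl ?invr_ge0 ?(ltW s0)//; lra.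
have hs : 0 <= h <= s.
  apply/andP; split; first by rewrite divr_ge0 ?(ltW s0)//; lra.
  by rewrite ler_pdivrMr// ss; lra.
have whE : w * h = pi / 4 * (L / x).
  by rewrite /w /h -ss; move: (pi : R) => p; field; rewrite lt0r_neq0.
have Lx0 : 0 < L / x by rewrite divr_gt0//; lra.
have Lx : L / x <= 1 / 16 by rewrite ler_pdivrMr//; lra.
have u1 : L / x / 2 <= w * h.
  by rewrite whE [leLHS]mulrC ler_pM2r//; lra.
have u2 : w * h <= 1 / 2.
  rewrite whE; apply: (@le_trans _ _ (1 * (1 / 16))); last by lra.
  by rewrite ler_pM ?(ltW Lx0)//; lra.
have sinu : L / x / 4 <= sin (w * h).
  have := norm_sinBid_le_sqr (w * h); rewrite ler_norml => /andP[+ _].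
  have wh0 : 0 <= w * h by lra.
  have := ler_wpM2l wh0 u2; rewrite -expr2; lra.
have sx2 : Num.sqrt (n ^ 2)%:R = x :> R.
  by rewrite natrX sqrtr_sqr ger0_norm// ltW.
have expu : expR (- ((n ^ 2)%:R * sin (w * h) ^+ 2)) <= x^-1 * x^-1.
  have -> : x^-1 * x^-1 = expR (- (2 * L)).
    by rewrite mulrDl mul1r opprD expRD expRN expL.
  rewrite ler_expR lerN2 natrX -exprMn -/x.
  have hx : L / 4 <= x * sin (w * h).
    have := ler_wpM2l (ltW x0) sinu; apply: le_trans.
    by rewrite le_eqVlt; apply/orP; left; apply/eqP; field; rewrite lt0r_neq0.
  apply: (@le_trans _ _ ((L / 4) ^+ 2)).
    have L0 : 0 <= L by lra.
    by have := ler_wpM2r L0 L32; rewrite expr_div_n -!expr2; lra.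
  by rewrite lerXn2r ?nnegrE//; lra.
(* a gap for which [r ^+ m] is at most [n ^- 3] *)
have [m [m1 m2]] : exists m : nat, 3 * L / l <= m%:R /\ m%:R <= 3 * L / l + 1.
  exists (Num.truncn (3 * L / l)).+1.
  have q0 : 0 <= 3 * L / l by rewrite divr_ge0 ?(ltW l0)//; lra.
  have /andP[h1 h2] := truncn_itv q0; split; first exact: ltW.
  by rewrite -natr1 lerD2r.
have am : alpha m <= C3 * (x^-1 * x^-1 * x^-1).
  apply: le_trans (halpha m) _; rewrite ler_wpM2l ?(ltW C30)//.
  have -> : x^-1 * x^-1 * x^-1 = expR (- (3 * L)).
    have -> : 3 * L = L + L + L by ring.
    by rewrite !opprD !expRD expRN expL.
  have -> : r ^+ m = expR (m%:R * ln r) by rewrite expRM_natl lnK.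
  rewrite ler_expR -lerN2 opprK -mulrN -/l.
  by rewrite ler_pdivrMr// in m1.
pose eps := C5 * L / x; pose eta := 4 * C3 * (x^-1 * x^-1).
have eps0 : 0 <= eps by rewrite divr_ge0 ?(ltW x0)// mulr_ge0//; lra.
have xV : 0 < x^-1 by rewrite invr_gt0.
have eta0 : 0 <= eta by rewrite !mulr_ge0// ltW.
(* blocks of length one: Lindeberg replacement of single summands *)
have close t : cabs (charfun P (X n) t - charfun P' S t) <= eps * `|t| + eta.
  have hb : (n <= n * 1)%N by rewrite muln1.
  apply: le_trans (charfun_close t m ngt0 (ltn0Sn 0) hb) _; rewrite -/x.
  have -> : x * (4 * `|t| * (1 * ((m + 1)%:R * (C / x) ^+ 2)) + 4 * alpha m) +
      D * `|t| / x = (4 * (m%:R + 1) * C ^+ 2 + D) / x * `|t| + 4 * x * alpha m.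
    by rewrite natrD; field; rewrite lt0r_neq0.
  apply: lerD.
    rewrite ler_wpM2r// ler_wpM2r ?(ltW xV)// /C5 [leRHS]mulrDl lerD//; last first.
      by rewrite ler_peMr//; lra.
    have hm : m%:R + 1 <= (3 / l + 2) * L.
      have -> : (3 / l + 2) * L = 3 * L / l + 2 * L by ring.
      by lra.
    have -> : 4 * (m%:R + 1) * C ^+ 2 = 4 * C ^+ 2 * (m%:R + 1) by ring.
    have c0 : 0 <= 4 * C ^+ 2 by rewrite mulr_ge0// ltW.
    by rewrite -(mulrA (4 * C ^+ 2)); exact: ler_wpM2l.
  have -> : eta = 4 * x * (C3 * (x^-1 * x^-1 * x^-1)).
    by rewrite /eta; field; rewrite lt0r_neq0.
  by rewrite ler_wpM2l// mulr_ge0// ltW.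
have hd i : (i < (2 * n ^ 2).+1)%N ->
    cabs (charfun P (X n) (frequency R (n ^ 2) i * w) -
          charfun P' S (frequency R (n ^ 2) i * w)) <=
    eps * w * `|frequency R (n ^ 2) i| + eta.
  move=> _; apply: le_trans (close _) _.
  by rewrite normrM (ger0_norm (ltW w0)) -(mulrA eps) (mulrC w).
have epsw : 0 <= eps * w by rewrite mulr_ge0// ltW.
have N0 : (0 < n ^ 2)%N by rewrite expn_gt0 ngt0.
have [tX1 tX2] := dfun_tail_markov (iX ngt0) (EX ngt0) s0.
have [tS1 tS2] := dfun_limit_tail s0.
have := @smoothing _ _ _ P _ _ P' (X n) S (n ^ 2) w h s (eps * w) eta _ _
  N0 s0 hs erefl epsw eta0 hd tX1 tX2 tS1 tS2.
rewrite sx2; set E := C / s + _ + _ => /= hsm.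
clear hd tX1 tX2 tS1 tS2 close am m1 m2 sinu u1 u2 Lx whE hs nx hn0 l3 l0 CC.
clear pi2 pi4 xL expL sx2 N0 epsw.
have sV : 0 < s^-1 by rewrite invr_gt0.
have sLV : s^-1 <= L / s by rewrite ler_peMl ?(ltW sV)//; lra.
have xsV : x^-1 <= s^-1.
  by rewrite -ss invfM ler_piMr ?(ltW sV)// invf_le1.
have hE : E <= (3 * C + 5 + 2 * C5 + 8 * C3) * (L / s).
  have e1 : C / s + (2 * C + 1) / s <= (3 * C + 1) * (L / s).
    have -> : C / s + (2 * C + 1) / s = (3 * C + 1) * s^-1 by ring.
    by rewrite ler_wpM2l//; lra.
  have e2 : 2 * x * (2 * expR (- ((n ^ 2)%:R * sin (w * h) ^+ 2))) <= 4 * (L / s).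
    apply: (@le_trans _ _ (2 * x * (2 * (x^-1 * x^-1)))).
      by rewrite ler_wpM2l ?mulr_ge0 ?(ltW x0)// ler_wpM2l.
    have -> : 2 * x * (2 * (x^-1 * x^-1)) = 4 * x^-1.
      by field; rewrite lt0r_neq0.
    by lra.
  have e3 : 2 * x * (eps * w) <= 2 * C5 * (L / s).
    have -> : 2 * x * (eps * w) = 2 * C5 * (L * w).
      by rewrite /eps; field; rewrite lt0r_neq0.
    by rewrite ler_wpM2l ?mulr_ge0// ler_wpM2l//; lra.
  have e4 : 2 * x * eta <= 8 * C3 * (L / s).
    have -> : 2 * x * eta = 8 * C3 * x^-1.
      by rewrite /eta; field; rewrite lt0r_neq0.
    by rewrite ler_wpM2l ?mulr_ge0 ?(ltW C30)//; lra.
  by rewrite /E; lra.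
rewrite -/x powRN powR12_sqrt ?(ltW x0)// -/s -/L -mulrA [s^-1 * L]mulrC.
set K := 3 * C + 7 + 2 * C5 + 8 * C3.
have Ls : 0 < L / s by lra.
have KE : E <= K * (L / s) by rewrite /K; lra.
have Kh : 2 * h <= K * (L / s) by rewrite /K /h ler_wpM2r ?(ltW Ls)//; lra.
apply: levy_distance_le; first by rewrite mulr_gt0//; rewrite /K; lra.
move=> y; have [g1 g2] := hsm y; split.
- have yh : y - K * (L / s) <= y - 2 * h by lra.
  by have := dfun_mono (X n) yh; lra.
- have yh : y + 2 * h <= y + K * (L / s) by lra.
  by have := dfun_mono (X n) yh; lra.
Qed.

End limit_theorem.

(** * The theorem *)

Section mfun_sums.
Context d (T : measurableType d) (R : realType) (P : probability T R).

Lemma RV_sumE (r : seq nat) (Y : nat -> {RV P >-> R}) w :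
  (\sum_(j <- r) Y j : {RV P >-> R}) w = \sum_(j <- r) Y j w.
Proof. by elim/big_rec2 : _ => // j x y _ <-. Qed.

Lemma rintegrable_finite_mean (X : T -> R) (k : R) : measurable_fun setT X ->
  ('E_P[fun w => `|X w|%R] <= k%:E)%E ->
  rintegrable P X /\ \int[P]_w `|X w| <= k.
Proof.
move=> mX; rewrite unlock => hX.
have iX : rintegrable P X.
  apply/integrableP; split; first exact/measurable_EFinP.
  by apply: le_lt_trans (ltry k); under eq_integral do rewrite abse_EFin.
split => //; rewrite -lee_fin /Rintegral fineK//.
by apply: integrable_fin_num => //; exact: (rintegrable_norm iX).
Qed.

End mfun_sums.

Theorem theorem1p1 (R : realType)
  (d : measure_display) (T : measurableType d) (P : probability T R)
  (F : nat -> set_system T) (Y : nat -> nat -> {RV P >-> R})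
  (C1 C2 mu : R) (l : nat) (alpha : nat -> R) (phi : R -> R[i])
  (d' : measure_display) (T' : measurableType d') (P' : probability T' R)
  (S : {RV P' >-> R})
  (hF : filtration F)
  (hY : forall n j, (1 <= j <= n)%N -> measurable_wrt (F j) (Y n j))
  (hC1 : 0 < C1) (hl : (1 <= l)%N)
  (halpha_ge0 : forall k, 0 <= alpha k)
  (halpha_decr : nonincreasing_seq alpha)
  (halpha_cvg0 : alpha k @[k --> \oo] --> (0 : R))
  (hphi : is_charfun phi)
  (hphi_derivable : forall t, cderivable phi t)
  (hC2 : 0 < C2) (hmu : 0 < mu)
  (A1a : forall n j, (1 <= j <= n)%N ->
    (P [set w | (Y n j w != 0)%R] <= (C1 / n%:R)%:E)%E /\
    ('E_P[fun w => `|Y n j w|%R] <= (C1 / n%:R)%:E)%E)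
  (A1b : forall n i j, (1 <= i <= n)%N -> (1 <= j <= n)%N -> i <> j ->
    ('E_P[fun w => (`|Y n j w| * \1_[set w' | Y n i w' != 0] w)%R]
      <= ((C1 / n%:R) ^+ 2)%:E)%E)
  (A2 : forall n i j, (1 <= i)%N -> (i + l <= j)%N -> (j <= n)%N ->
    exists2 Z : T -> R, is_cond_exp P (F i) (Y n j) Z &
      {ae P, forall w,
        `|Z w - fine 'E_P[Y n j]| <= C1 / n%:R * alpha (j - i)%N})
  (A3 : forall n i j, (1 <= i)%N -> (i < j)%N -> (j <= n)%N ->
    forall v : (n - j).+1.-tuple R -> R,
    measurable_fun setT v -> (forall x, `|v x| <= 1) ->
    let V := fun w => v [tuple Y n (j + k)%N w | k < (n - j).+1] in
    exists2 Z : T -> R, is_cond_exp P (F i) V Z &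
      {ae P, forall w, `|Z w - fine 'E_P[V]| <= alpha (j - i)%N})
  (A4 : forall n j (t : R), (1 <= j <= n)%N ->
    `|cderive (charfun P (Y n j)) t - (n%:R^-1 * mu)%:C * cderive phi t|
      <= (C2 / n%:R ^+ 2)%:C)
  (hS : compound_poisson mu phi S) :
  let Sn : nat -> {RV P >-> R} :=
    fun n => \sum_(1 <= j < n.+1) Y n j in
  cvg_in_distribution Sn S /\
  (forall r C3 : R, 0 < r < 1 -> 0 < C3 ->
    (forall k, alpha k <= C3 * r ^+ k) ->
    exists2 C : R, 0 < C & \forall n \near \oo,
      levy_distance (dfun (Sn n)) (dfun S)
        <= C * (n%:R `^ (- 2^-1)) * ln n%:R).
Proof.
move=> Sn.
have [sF mF FS] := hF.
have SnE n : (Sn n : T -> R) = (fun w => \sum_(1 <= j < n.+1) Y n j w).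
  by apply/funext => w; rewrite /Sn RV_sumE.
have n0' n : (0 < n)%N -> 0 < n%:R :> R by rewrite ltr0n.
have k0 n : 0 <= C1 / n%:R by rewrite divr_ge0// ltW.
have intY n j (hj : (1 <= j <= n)%N) :=
  rintegrable_finite_mean (measurable_funPT (Y n j)) (A1a n j hj).2.
have pairY n i j : (1 <= i <= n)%N -> (1 <= j <= n)%N -> i <> j ->
    \int[P]_w (`|Y n j w| * \1_[set w' | Y n i w' != 0] w) <= (C1 / n%:R) ^+ 2.
  move=> hi hj ij; have := A1b n i j hi hj ij; rewrite unlock => h.
  rewrite -lee_fin /Rintegral fineK//; apply: integrable_fin_num => //.
  have mY0 := measurable_nonzero (Y n) i.
  have := rintegrable_indicM mY0 (rintegrable_norm (intY n j hj).1).
  by congr rintegrable; apply/funext => w; rewrite mulrC.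
have phi0 : phi 0 = 1 by have [Q ->] := hphi; exact: charfun0.
have phi1 t : cabs (phi t) <= 1.
  by have [Q ->] := hphi; apply: cabs_charfun_le1.
have phij n j t : (1 <= j <= n)%N ->
    cabs (charfun P (Y n j) t - 1 - (mu / n%:R)%:C * (phi t - 1)) <=
    2 * C2 * `|t| / n%:R ^+ 2.
  move=> hj; have iY := (intY n j hj).1.
  have -> : 2 * C2 * `|t| / n%:R ^+ 2 = 2 * (C2 / n%:R ^+ 2) * `|t| by ring.
  rewrite -{1}(charfun0 P (Y n j)) -[X in phi t - X]phi0 [mu / _]mulrC.
  apply: cderive_comparison => [s|s|s].
  - by split; [exact: derivable_Re_charfun|exact: derivable_Im_charfun].
  - exact: hphi_derivable.
  - exact: A4.
(* the first row alone shows that [phi] is Lipschitz at the origin *)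
pose M := (C1 + 2 * C2) / mu.
have phiM t : cabs (phi t - 1) <= M * `|t|.
  have h11 : (1 <= 1 <= 1)%N by [].
  have := phij 1%N 1%N t h11; rewrite !divr1 expr1n divr1 => h.
  have h2 := cabs_charfunB1 (intY 1%N 1%N h11).1 t.
  have h3 := (intY 1%N 1%N h11).2; rewrite divr1 in h3.
  rewrite /M mulrAC ler_pdivlMr//.
  have -> : cabs (phi t - 1) * mu = cabs (mu%:C * (phi t - 1)).
    by rewrite cabsM cabs_real (ger0_norm (ltW hmu)) mulrC.
  have -> : mu%:C * (phi t - 1) = (charfun P (Y 1%N 1%N) t - 1) -
    (charfun P (Y 1%N 1%N) t - 1 - mu%:C * (phi t - 1)) by ring.
  rewrite (le_trans (cabsB _ _))//.
  have := ler_wpM2l (normr_ge0 t) h3; lra.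
pose D := 2 * C2 + 6 * mu ^+ 2 * M.
have D0 : 0 <= D.
  have M0 : 0 <= M by rewrite divr_ge0 ?(ltW hmu)//; lra.
  by rewrite addr_ge0// mulr_ge0// ?(ltW hC2)// mulr_ge0// exprn_ge0// ltW.
have close n t q b m : (0 < n)%N -> (0 < b)%N -> (n <= q * b)%N ->
    cabs (charfun P (Sn n) t - charfun P' S t) <=
    q%:R * (4 * `|t| * (b%:R * ((m + b)%:R * (C1 / n%:R) ^+ 2)) + 4 * alpha m) +
    D * `|t| / n%:R.
  move=> n0 b0 nqb.
  have h1 := row_charfun_prod hF (hY n) halpha_ge0 halpha_decr (k0 n)
    (fun j hj => (intY n j hj).1) (fun j hj => (A1a n j hj).1)
    (fun j hj => (intY n j hj).2) (pairY n) (A3 n) t m b0 nqb.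
  have h2 := prod_complex_exp n0 (ltW hmu) (phi1 t)
    (fun j _ => cabs_charfun_le1 P t (measurable_funPT (Y n j)))
    (fun j hj => phij n j t hj).
  rewrite SnE (charfun_compound_poisson hmu hS).
  set A := charfun P _ t in h1 *; set B := \prod_(1 <= j < n.+1) _ in h1 h2.
  set E := complex_exp _ in h2 *.
  have -> : A - E = (A - B) + (B - E) by ring.
  apply: le_trans (cabsD _ _) (lerD h1 (le_trans h2 _)).
  rewrite ler_wpM2r ?invr_ge0// /D [leRHS]mulrDl lerD2l -[leRHS]mulrA.
  by rewrite ler_wpM2l// mulr_ge0// exprn_ge0// ltW.
have iSn n : rintegrable P (fun w => \sum_(1 <= j < n.+1) Y n j w).
  rewrite (_ : (fun _ => _) = fun w => \sum_(1 <= j < n.+1)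
    (if (1 <= j <= n)%N then Y n j w else 0)); last first.
    by apply/funext => w; apply: eq_big_nat => j; rewrite ltnS => ->.
  apply: rintegrable_sum => j; case: (boolP (1 <= j <= n)%N) => hj.
    exact: (intY n j hj).1.
  exact: rintegrable_cst.
have ESn n : (0 < n)%N -> \int[P]_w `|Sn n w| <= C1.
  move=> n0.
  have iA j : rintegrable P (fun w => if (1 <= j <= n)%N then `|Y n j w| else 0).
    case: (boolP (1 <= j <= n)%N) => hj; last exact: rintegrable_cst.
    by apply: rintegrable_norm; exact: (intY n j hj).1.
  apply: (@le_trans _ _ (\int[P]_w \sum_(1 <= j < n.+1)
      (if (1 <= j <= n)%N then `|Y n j w| else 0))).
    apply: le_RintegralT => [||w].
    - by rewrite SnE; apply: rintegrable_norm.
    - exact: rintegrable_sum.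
    rewrite SnE (le_trans (ler_norm_sum _ _ _))//.
    by rewrite le_eqVlt; apply/orP; left; apply/eqP; apply: eq_big_nat => j;
      rewrite ltnS => ->.
  rewrite Rintegral_sum//.
  have -> : C1 = (n.+1 - 1)%:R * (C1 / n%:R).
    by rewrite subn1 mulrC divfK// lt0r_neq0// n0'.
  apply: sum_range_le => j; rewrite ltnS => hj.
  by under eq_Rintegral do rewrite hj; exact: (intY n j hj).2.
have iSn' n : (0 < n)%N -> rintegrable P (Sn n) by move=> _; rewrite SnE.
split.
  exact: (cvg_in_distribution_of_charfun hC1 D0 halpha_ge0 halpha_cvg0
    iSn' ESn close).
move=> r C3 r01 C30 hr.
exact: (levy_distance_rate hC1 D0 halpha_ge0 halpha_cvg0 iSn' ESn close r01 C30 hr).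
Qed.
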